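(* Let $f\in L^\infty(Q)$ be such that $f\le 0$ a.e. in $Q$, and let $\rho_0\in L^\infty(\Omega)$. Then the weak solution $\rho$ of $$\rho_t+(-\Delta)^s\rho=f\ \text{ in }Q,\qquad \rho=0\ \text{ in }\Sigma,\qquad \rho(\cdot,0)=\rho_0\ \text{ in }\Omega$$ satisfies $$\rho(x,t)\le\|f\|_{L^\infty(Q)}+\|\rho_0\|_{L^\infty(\Omega)}\quad\text{for a.e. }(x,t)\in\mathbb{R}^N\times[0,T].$$
   Context: Setting: $N\ge 1$, $\Omega\subset\mathbb{R}^N$ is a bounded open domain with Lipschitz continuous boundary, $0<s<1$, $T>0$, $Q=\Omega\times(0,T)$, $\Sigma=(\mathbb{R}^N\setminus\Omega)\times(0,T)$, and $C_{N,s}=\frac{s2^{2s}\Gamma((2s+N)/2)}{\pi^{N/2}\Gamma(1-s)}$. Formally, $(-\Delta)^s w(x)=C_{N,s}\,\mathrm{P.V.}\int_{\mathbb{R}^N}\frac{w(x)-w(y)}{|x-y|^{N+2s}}\,dy$. Spaces: $\mathbb{H}^s_0(\Omega)=\{\rho\in H^s(\mathbb{R}^N):\rho=0\text{ in }\mathbb{R}^N\setminus\Omega\}$ is a Hilbert space with norm $\|\rho\|_{\mathbb{H}^s_0(\Omega)}=\mathcal{F}(\rho,\rho)^{1/2}$, where $$\mathcal{F}(\rho,\psi)=\frac{C_{N,s}}{2}\int_{\mathbb{R}^N}\int_{\mathbb{R}^N}\frac{(\rho(x)-\rho(y))(\psi(x)-\psi(y))}{|x-y|^{N+2s}}\,dx\,dy.$$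 $\mathbb{H}^{-s}(\Omega)$ is its dual with respect to the pivot space $L^2(\Omega)$. $W(0,T;\mathbb{H}^s_0(\Omega))=\{\zeta\in L^2(0,T;\mathbb{H}^s_0(\Omega)):\zeta_t\in L^2(0,T;\mathbb{H}^{-s}(\Omega))\}$ embeds continuously in $C([0,T];L^2(\Omega))$, so values at fixed times make sense in $L^2(\Omega)$. Let $H(Q)=\{\xi\in W(0,T;\mathbb{H}^s_0(\Omega)):\xi(\cdot,T)=0\text{ a.e. in }\Omega\}$. Weak solution: for $f\in L^2(Q)$, $\rho_0\in L^2(\Omega)$, the weak solution is the unique $\rho\in W(0,T;\mathbb{H}^s_0(\Omega))$ such that for all $\phi\in H(Q)$, $$-\int_0^T\langle\phi_t,\rho\rangle_{\mathbb{H}^{-s}(\Omega),\mathbb{H}^s_0(\Omega)}\,dt+\int_0^T\mathcal{F}(\rho,\phi)\,dt=\int_Q f\phi\,dx\,dt+\int_\Omega\rho_0\,\phi(\cdot,0)\,dx.$$ *)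

(* Defs.v *)
From HB Require Import structures.
From mathcomp Require Import all_boot all_order all_algebra.
From mathcomp Require Import all_classical all_reals all_analysis.
Set Implicit Arguments.
Unset Strict Implicit.
Unset Printing Implicit Defensive.
Import Order.TTheory GRing.Theory Num.Theory.
Import numFieldNormedType.Exports.

Local Open Scope classical_set_scope.
Local Open Scope ring_scope.

Definition rV_display : measure_display -> measure_display.
Proof. exact. Qed.

Section measurable_rV.
Context d (T : measurableType d) (n : nat).

Let coord (i : 'I_n) (x : 'rV[T]_n) : T := x ord0 i.

Let rV_set0 : g_sigma_preimage coord set0.
Proof. exact: sigma_algebra0. Qed.

Let rV_setC A : g_sigma_preimage coord A -> g_sigma_preimage coord (~` A).
Proof. exact: sigma_algebraC. Qed.

Let rV_bigcup (F : _^nat) : (forall i, g_sigma_preimage coord (F i)) ->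
  g_sigma_preimage coord (\bigcup_i (F i)).
Proof. exact: sigma_algebra_bigcup. Qed.

(* The sigma-algebra generated by the coordinates (for T the Borel line, the
   Borel sigma-algebra of R^n); same construction as for [n.-tuple T]. *)
HB.instance Definition _ := @isMeasurable.Build (rV_display d)
  'rV[T]_n (g_sigma_preimage coord) rV_set0 rV_setC rV_bigcup.

End measurable_rV.


Lemma measurable_coord d (T : measurableType d) n (i : 'I_n) :
  measurable_fun [set: 'rV[T]_n] (fun x : 'rV[T]_n => x ord0 i).
Proof.
move=> _ Y mY; rewrite setTI; apply: sub_sigma_algebra => /=.
rewrite -bigcup_seq/=; exists i => /=; first by rewrite mem_index_enum.
by exists Y => //; rewrite setTI.
Qed.

Lemma measurable_fun_rVP d1 d2 (T1 : measurableType d1) (T2 : measurableType d2)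
    n (f : T1 -> 'rV[T2]_n) :
  (forall i, measurable_fun [set: T1] (fun x => f x ord0 i)) ->
  measurable_fun [set: T1] f.
Proof.
move=> mf _ A; rewrite setTI; move: A.
suff : measurable `<=` [set A | measurable (f @^-1` A)] by [].
apply: smallest_sub.
  split=> /=.
  - by rewrite preimage_set0.
  - by move=> A mA; rewrite setTD -preimage_setC; exact: measurableC.
  - by move=> F mF; rewrite preimage_bigcup; exact: bigcupT_measurable.
rewrite -bigcup_seq/= => A [i _ [B mB <-]] /=.
rewrite setTI; have := mf i measurableT B mB.
by rewrite setTI.
Qed.

(* The library proves this only inside the declaration of a canonical instance,
   which a later instance for finite measures shadows. *)
Lemma product_measure_sigma_finite d1 d2 (T1 : measurableType d1)
    (T2 : measurableType d2) (R : realType)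
    (m1 : {sigma_finite_measure set T1 -> \bar R})
    (m2 : {sigma_finite_measure set T2 -> \bar R}) :
  sigma_finite setT (m1 \x m2)%E.
Proof.
have /sigma_finiteP[F [TF ndF Foo]] := sigma_finiteT m1.
have /sigma_finiteP[G [TG ndG Goo]] := sigma_finiteT m2.
exists (fun n => F n `*` G n).
  rewrite -setXTT TF TG predeqE => -[x y]; split.
    move=> [/= [n _ Fnx] [k _ Gky]]; exists (maxn n k) => //; split.
    - by move: x Fnx; exact/subsetPset/ndF/leq_maxl.
    - by move: y Gky; exact/subsetPset/ndG/leq_maxr.
  by move=> [n _ []/= ? ?]; split; exists n.
move=> k; have [? ?] := Foo k; have [? ?] := Goo k.
split; first exact: measurableX.
by rewrite product_measure1E// lte_mul_pinfty// ge0_fin_numE.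
Qed.

Section lebesgue_rV.
Variable R : realType.

Definition cons_rV n (p : measurableTypeR R * 'rV[R]_n) : 'rV[R]_n.+1 :=
  row_mx (p.1 : R)%:M p.2.

Definition uncons_rV n (v : 'rV[R]_n.+1) : measurableTypeR R * 'rV[R]_n :=
  (v ord0 ord0, \row_j v ord0 (lift ord0 j)).

Lemma cons_rVK n : cancel (@cons_rV n) (@uncons_rV n).
Proof.
move=> [a v]; rewrite /uncons_rV /cons_rV /=; congr pair.
  by rewrite mxE; case: splitP => // j _; rewrite !ord1 mxE eqxx mulr1n.
apply/rowP => j; rewrite mxE.
by rewrite -rshift1 (@row_mxEr _ 1 1 n).
Qed.

Lemma uncons_rVK n : cancel (@uncons_rV n) (@cons_rV n).
Proof.
move=> v; apply/rowP => i; rewrite /cons_rV /uncons_rV /= mxE.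
case: splitP => j ij /=.
  rewrite !mxE !ord1 eqxx mulr1n; congr (v _ _).
  by apply/val_inj; rewrite /= ij ord1.
rewrite mxE; congr (v _ _).
by apply/val_inj; rewrite /= ij.
Qed.

Lemma measurable_cons_rV n : measurable_fun setT (@cons_rV n).
Proof.
apply: measurable_fun_rVP => i.
have [->|[j ->]] : i = ord0 \/ exists j, i = lift ord0 j.
  by case: (unliftP ord0 i) => [j|] ->; [right; exists j|left].
- rewrite (_ : (fun _ => _) = fst); first exact: measurable_fst.
  by apply/funext => p; rewrite -[p in RHS]cons_rVK.
- rewrite (_ : (fun _ => _) =
      (fun v : 'rV[R]_n => v ord0 j) \o snd); last first.
    apply/funext => p /=.
    by rewrite -[p in RHS]cons_rVK /uncons_rV/= mxE.
  by apply: measurableT_comp => //; exact: measurable_coord.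
Qed.

Lemma measurable_uncons_rV n : measurable_fun setT (@uncons_rV n).
Proof.
apply: measurable_fun_pair; first exact: measurable_coord.
apply: measurable_fun_rVP => i.
rewrite (_ : (fun _ => _) = (fun v : 'rV[R]_n.+1 => v ord0 (lift ord0 i))).
  exact: measurable_coord.
by apply/funext => v; rewrite mxE.
Qed.

Section step.
Variables (n : nat) (mu : {sigma_finite_measure set 'rV[R]_n -> \bar R}).

Definition cons_measure : set 'rV[R]_n.+1 -> \bar R :=
  pushforward (@lebesgue_measure R \x mu)%E (@cons_rV n).

Let cons_measure0 : cons_measure set0 = 0%E.
Proof. by rewrite /cons_measure /pushforward preimage_set0 measure0. Qed.

Let cons_measure_ge0 A : (0 <= cons_measure A)%E.
Proof. by rewrite /cons_measure /pushforward measure_ge0. Qed.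

Let cons_measure_sigma_additive : semi_sigma_additive cons_measure.
Proof.
move=> F mF tF mUF; rewrite /cons_measure /pushforward preimage_bigcup.
apply: measure_semi_sigma_additive.
- by move=> i; rewrite -[X in measurable X]setTI; exact: measurable_cons_rV.
- apply/trivIsetP => /= i j _ _ ij; rewrite -preimage_setI.
  by move/trivIsetP : tF => /(_ _ _ _ _ ij) ->//; rewrite preimage_set0.
- rewrite -preimage_bigcup -[X in measurable X]setTI.
  exact: measurable_cons_rV.
Qed.

HB.instance Definition _ := isMeasure.Build _ _ _ cons_measure
  cons_measure0 cons_measure_ge0 cons_measure_sigma_additive.

Let cons_measure_sigma_finite : sigma_finite setT cons_measure.
Proof.
have [F FT mF] : sigma_finite setT (@lebesgue_measure R \x mu)%E.
  exact: product_measure_sigma_finite.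
exists (fun i => @uncons_rV n @^-1` F i).
  by rewrite -preimage_bigcup -FT preimage_setT.
move=> i; have [mFi Foo] := mF i; split.
  by rewrite -[X in measurable X]setTI; exact: measurable_uncons_rV.
rewrite /cons_measure /pushforward -comp_preimage.
rewrite (_ : _ \o _ = id) ?preimage_id//.
by apply/funext => p /=; rewrite cons_rVK.
Qed.

HB.instance Definition _ := Measure_isSigmaFinite.Build _ _ _ cons_measure
  cons_measure_sigma_finite.

End step.

(* Lebesgue measure of R^n as the n-fold product of [lebesgue_measure]; on R^0
   it is the unit mass at the only point. *)
Fixpoint lebesgue_rV (n : nat) : {sigma_finite_measure set 'rV[R]_n -> \bar R} :=
  if n is m.+1 then cons_measure (lebesgue_rV m) else \d_(0 : 'rV[R]_0).

End lebesgue_rV.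

Section fractional.
Context {R : realType} {N : nat}.
Local Notation V := 'rV[R]_N.
Local Notation mu := (lebesgue_rV R N).
Local Notation leb := (@lebesgue_measure R).

(* The norm of the library on ['rV[R]_N] is the sup norm. *)
Definition dotv (x y : V) : R := \sum_(i < N) x ord0 i * y ord0 i.
Definition enorm (x : V) : R := Num.sqrt (dotv x x).

(* Near each boundary point Om is the strict epigraph, in a unit direction e, of
   a Lipschitz function of the orthogonal projection onto the hyperplane
   orthogonal to e (which is a rotated coordinate system, without the rotation). *)
Definition lipschitz_boundary (Om : set V) : Prop :=
  forall x0, (closure Om `\` Om^°) x0 ->
  exists (U : set V) (e : V) (gamma : V -> R) (L : R),
    [/\ nbhs x0 U, enorm e = 1,
        forall y z, `|gamma y - gamma z| <= L * enorm (y - z) &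
        forall y, U y -> (Om y <-> gamma (y - dotv y e *: e) < dotv y e)].

Definition Gamma_fun (z : R) : R :=
  \int[leb]_(t in `]0, +oo[) (t `^ (z - 1) * expR (- t)).

Definition C_Ns (s : R) : R :=
  s * 2 `^ (2 * s) * Gamma_fun ((2 * s + N%:R) / 2) /
  (pi `^ (N%:R / 2) * Gamma_fun (1 - s)).

Definition Fform (s : R) (rho psi : V -> R) : R :=
  C_Ns s / 2 *
  (\int[(mu \x mu)%E]_p ((rho p.1 - rho p.2) * (psi p.1 - psi p.2)
                         / enorm (p.1 - p.2) `^ (N%:R + 2 * s))).

(* H^s(R^N), as square integrable functions with finite Gagliardo seminorm. *)
Definition Hs (s : R) : set (V -> R) :=
  [set rho | rho \in Lfun mu 2%:E /\
    (fun p : V * V =>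
       (rho p.1 - rho p.2) / enorm (p.1 - p.2) `^ (N%:R / 2 + s))
      \in Lfun (mu \x mu)%E 2%:E].

Definition Hs0 (s : R) (Om : set V) : set (V -> R) :=
  [set rho | Hs s rho /\ {ae mu, forall x, ~ Om x -> rho x = 0}].

Definition Hs0_norm (s : R) (rho : V -> R) : R := Num.sqrt (Fform s rho rho).

(* Functionals are total functions on [V -> R], of which only the values on
   [Hs0 s Om] matter. *)
Definition dual_norm (s : R) (Om : set V) (l : (V -> R) -> R) : \bar R :=
  ereal_sup [set `|l v|%:E | v in [set v | Hs0 s Om v /\ Hs0_norm s v <= 1]].

Definition Hs0_dual (s : R) (Om : set V) : set ((V -> R) -> R) :=
  [set l | (forall (a : R) v w, Hs0 s Om v -> Hs0 s Om w ->
              l (fun x => a * v x + w x) = a * l v + l w) /\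
           (dual_norm s Om l < +oo)%E].

Definition Linfty_norm d (X : measurableType d) (m : {measure set X -> \bar R})
    (A : set X) (u : X -> R) : \bar R :=
  'N[m]_+oo [EFin \o (u \_ A)].

Definition in_Linfty d (X : measurableType d) (m : {measure set X -> \bar R})
    (A : set X) : set (X -> R) :=
  [set u | (u \_ A) \in Lfun m +oo%E].

Definition inner_L2 (Om : set V) (u v : V -> R) : R :=
  \int[mu]_(x in Om) (u x * v x).

Definition norm_L2 (Om : set V) (u : V -> R) : \bar R :=
  'N[mu]_2%:E [EFin \o (u \_ Om)].

Definition in_L2 (Om : set V) : set (V -> R) :=
  [set u | (u \_ Om) \in Lfun mu 2%:E].

Section bochner.
Context {U : zmodType} (D : set U) (nrm : U -> \bar R).

Definition bochner_simple (u : R -> U) : Prop :=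
  [/\ finite_set (range u), range u `<=` D &
      forall c, measurable (u @^-1` [set c] : set (measurableTypeR R))].

Definition strongly_measurable (I : set R) (u : R -> U) : Prop :=
  exists u_ : (R -> U)^nat, (forall n, bochner_simple (u_ n)) /\
    {ae leb, forall t, I t -> (nrm (u_ n t - u t) @[n --> \oo] --> 0%E)}.

Definition bochner_L2 (I : set R) : set (R -> U) :=
  [set u | [/\ {ae leb, forall t, I t -> D (u t)},
               strongly_measurable I u &
               (\int[leb]_(t in I) (nrm (u t) ^+ 2) < +oo)%E]].

End bochner.

Definition cylinder (Om : set V) (T : R) : set (V * R) := Om `*` `]0, T[.

Definition at_time (z : V * R -> R) (t : R) : V -> R := fun x => z (x, t).

(* L^2(0,T; H^s_0(Om)).  Classes are represented by functions of (x,t) that are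
   jointly measurable, so that integrals over space-time and "for a.e. (x,t)"
   make sense for the representative. *)
Definition L2_Hs0 (s : R) (Om : set V) (T : R) : set (V * R -> R) :=
  [set z | measurable_fun ([set: V] `*` (`]0, T[ : set (measurableTypeR R))) z /\
           bochner_L2 (Hs0 s Om) (EFin \o Hs0_norm s) `]0, T[ (at_time z)].

Definition L2_dual (s : R) (Om : set V) (T : R) : set (R -> (V -> R) -> R) :=
  bochner_L2 (Hs0_dual s Om) (dual_norm s Om) `]0, T[.

Definition test_function (T : R) (eta : R -> R) : Prop :=
  (forall n t, derivable (derive1n n eta) t 1) /\
  exists a b, [/\ 0 < a, b < T & forall t, ~ (a <= t <= b) -> eta t = 0].

(* dz = z_t as distributions on (0,T) with values in the dual of [Hs0 s Om], in
   which [Hs0 s Om] is embedded through the pivot space L^2(Om). *)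
Definition is_time_derivative (s : R) (Om : set V) (T : R)
    (z : V * R -> R) (dz : R -> (V -> R) -> R) : Prop :=
  forall eta v, test_function T eta -> Hs0 s Om v ->
    \int[leb]_(t in `]0, T[) (derive1 eta t * inner_L2 Om (at_time z t) v) =
    - (\int[leb]_(t in `]0, T[) (eta t * dz t v)).

Definition W_with_derivative (s : R) (Om : set V) (T : R)
    (z : V * R -> R) (dz : R -> (V -> R) -> R) : Prop :=
  [/\ L2_Hs0 s Om T z, L2_dual s Om T dz & is_time_derivative s Om T z dz].

Definition Wspace (s : R) (Om : set V) (T : R) : set (V * R -> R) :=
  [set z | exists dz, W_with_derivative s Om T z dz].

Definition C0T_L2 (Om : set V) (T : R) : set (R -> V -> R) :=
  [set c | forall t, 0 <= t <= T ->
     in_L2 Om (c t) /\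
     (norm_L2 Om (c r - c t) @[r --> within `[0, T] (nbhs t)] --> 0%E)].

(* c is the representative of z in C([0,T]; L^2(Om)): c t is the value of z at
   time t. *)
Definition L2_continuous_rep (Om : set V) (T : R)
    (z : V * R -> R) (c : R -> V -> R) : Prop :=
  C0T_L2 Om T c /\
  {ae leb, forall t, 0 < t < T -> {ae mu, forall x, Om x -> c t x = z (x, t)}}.

(* phi belongs to H(Q), with time derivative dphi and values at fixed times
   given by c. *)
Definition HQ (s : R) (Om : set V) (T : R) (phi : V * R -> R)
    (dphi : R -> (V -> R) -> R) (c : R -> V -> R) : Prop :=
  [/\ W_with_derivative s Om T phi dphi, L2_continuous_rep Om T phi c &
      {ae mu, forall x, Om x -> c T x = 0}].

(* As dphi and c are determined by phi up to null sets, quantifying over them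
   amounts to quantifying over phi in H(Q). *)
Definition weak_solution (s : R) (Om : set V) (T : R)
    (f : V * R -> R) (rho0 : V -> R) (rho : V * R -> R) : Prop :=
  Wspace s Om T rho /\
  forall phi dphi c, HQ s Om T phi dphi c ->
    - (\int[leb]_(t in `]0, T[) dphi t (at_time rho t))
    + (\int[leb]_(t in `]0, T[) Fform s (at_time rho t) (at_time phi t))
    = (\int[(mu \x leb)%E]_(p in cylinder Om T) (f p * phi p))
      + (\int[mu]_(x in Om) (rho0 x * c 0 x)).

End fractional.

(* Main.v *)
From HB Require Import structures.
From mathcomp Require Import all_boot all_order all_algebra.
From mathcomp Require Import all_classical all_reals all_analysis.
From mathcomp Require Import measurable_realfun ess_sup_inf.
From mathcomp Require Import ring lra.
Require Import Defs.
Set Implicit Arguments.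
Unset Strict Implicit.
Unset Printing Implicit Defensive.
Import Order.TTheory GRing.Theory Num.Theory.
Import numFieldNormedType.Exports.

Local Open Scope classical_set_scope.
Local Open Scope ring_scope.

(** Stampacchia's truncation method. Let M be the supremum norm of rho0, let
    beta a = min ((a - M)^+, 1) and let Beta be the primitive of beta that
    vanishes for a <= M; it is convex and positive for a > M. Testing the equation
    with beta rho gives, formally,
      d/dt (integral of Beta rho) + F (rho, beta rho) = integral of f beta rho <= 0.
    Since beta is nondecreasing, F (rho, beta rho) >= 0, and Beta rho0 = 0, so
    that Beta rho vanishes almost everywhere, which says that rho <= M. As the
    supremum norm of f is non-negative, this gives the claimed bound.

    The function beta rho is not admissible, as a test function must have a time
    derivative and vanish at time T. It is replaced by the Steklov average
      phi_h (t) = 1/h (integral of w over [t, t + h]),  w (t) = (2 T - t) beta rho (t),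
    where w is extended by zero. As w is bounded and has finite energy, phi_h is
    Hoelder continuous in time with exponent 1/2 and with values in H^s_0, it
    vanishes at T, and its time derivative is the difference quotient of w
    ([tphi_HQ], [wtest_HQ]). Strong measurability in the dual space comes from
    simple approximations of rho, composed with beta and the weight
    ([wtest_approx]), and from the embedding of L^2 in the dual, that is, from a
    Poincare inequality ([poincare]).

    In the time derivative term the difference quotient is moved onto rho by a
    translation, and convexity, beta a (a - b) >= Beta a - Beta b, replaces the
    chain rule ([pointwise_energy]). The weight 2 T - t loses exactly h over a time
    step h, and this loss is what remains of the telescoping differences: with the
    sign of f and the bound on rho0 one finds ([weak_energy])
      C/2 <D rho, D phi_h> + integral of Beta rho <= 0    for 0 < h <= T,
    where D u (x, y) is u (x) - u (y) over |x - y|^(N/2 + s) and <., .> is the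
    inner product of L^2 over pairs of points and times.

    It remains to let h tend to 0 ([Beta_integral_le0]). Averaging does not
    increase the norm of D w, so that
      |D rho + D phi_h|^2 <= |D rho|^2 + |D w|^2 - 4/C (integral of Beta rho).
    For each pair of points D phi_h tends to D w at almost every time, by Lebesgue
    differentiation. Fatou's lemma bounds the limit inferior of the left-hand side
    below by |D rho + D w|^2, which is at least |D rho|^2 + |D w|^2 because
    D rho D w >= 0 pointwise. Hence the integral of Beta rho is at most 0. *)

(** * Integrals and square integrals *)
Section integral_utils.
Context d (X : measurableType d) (R : realType) (m : {measure set X -> \bar R}).

(** The integral of a non-negative function is the supremum of the integrals of the
    simple functions below it, for measurable and non-measurable functions alike. *)
Lemma ge0_integral_mono (D : set X) (f g : X -> \bar R) :
  (forall x, D x -> 0 <= f x)%E -> (forall x, D x -> f x <= g x)%E ->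
  (\int[m]_(x in D) f x <= \int[m]_(x in D) g x)%E.
Proof.
move=> f0 fg; have g0 x : D x -> (0 <= g x)%E.
  by move=> Dx; exact: le_trans (f0 _ Dx) (fg _ Dx).
rewrite !ge0_integralE//; apply: ereal_sup_le => _ [h hf <-].
by exists h => // x; apply: le_trans (hf x) _; exact: lee_restrict.
Qed.

Definition sqint (f : X -> R) : \bar R := (\int[m]_x (f x ^+ 2)%:E)%E.

Lemma sqint_ge0 f : (0 <= sqint f)%E.
Proof. by apply: integral_ge0 => x _; rewrite lee_fin sqr_ge0. Qed.

Lemma le_sqint f g : (forall x, `|f x| <= `|g x|) -> (sqint f <= sqint g)%E.
Proof.
move=> fg; apply: ge0_integral_mono => x _; rewrite lee_fin ?sqr_ge0//.
by rewrite -[f x ^+ 2]real_normK ?num_real// -[g x ^+ 2]real_normK ?num_real// lerXn2r ?nnegrE.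
Qed.

Lemma Lnorm2E f : ('N[m]_2%:E [EFin \o f] = sqrte (sqint f))%E.
Proof.
rewrite unlock -poweR12_sqrt ?sqint_ge0//; congr (_ `^ _)%E.
apply: eq_integral => x _ /=.
by rewrite powR_mulrn// real_normK ?num_real.
Qed.

Lemma Lfun2P f : f \in Lfun m 2%:E <-> measurable_fun setT f /\ (sqint f < +oo)%E.
Proof.
have H : ('N[m]_2%:E [EFin \o f] < +oo)%E = (sqint f < +oo)%E.
  rewrite Lnorm2E; have := sqint_ge0 f; case: (sqint f) => [r||]//= _.
  by rewrite !ltry.
split.
  by move=> /andP[]; rewrite !inE/= /finite_norm H => mf ?.
by move=> [mf ffin]; apply/andP; rewrite !inE /= /finite_norm H.
Qed.

Lemma measurable_sqr (f : X -> R) : measurable_fun setT f ->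
  measurable_fun setT (fun x => (f x ^+ 2)%:E : \bar R).
Proof.
by move=> mf; apply/measurable_EFinP; exact: measurable_funX.
Qed.

Lemma cauchy_schwarz f g : measurable_fun setT f -> measurable_fun setT g ->
  (sqint f < +oo)%E -> (sqint g < +oo)%E ->
  m.-integrable setT (fun x => (f x * g x)%:E) /\
  (`|\int[m]_x (f x * g x)| ^+ 2 <= fine (sqint f) * fine (sqint g)).
Proof.
move=> mf mg ff gg.
have ffin : sqint f \is a fin_num by rewrite ge0_fin_numE// sqint_ge0.
have gfin : sqint g \is a fin_num by rewrite ge0_fin_numE// sqint_ge0.
have h2 : 2^-1 + 2^-1 = 1 :> R by lra.
have := hoelder m mf mg (ltr0Sn _ 1) (ltr0Sn _ 1) h2.
rewrite Lnorm1 !Lnorm2E -[sqint f]fineK// -[sqint g]fineK// /= -EFinM.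
set I := (\int[m]_x _)%E => Ile.
have mfg : measurable_fun setT (fun x => (f x * g x)%:E).
  by apply/measurable_EFinP; exact: measurable_funM.
have int : m.-integrable setT (fun x => (f x * g x)%:E).
  by apply/integrableP; split => //; apply: le_lt_trans Ile _; rewrite ltry.
split => //.
have Ifin : I \is a fin_num.
  by rewrite ge0_fin_numE ?(le_lt_trans Ile) ?ltry//; exact: integral_ge0.
apply: (@le_trans _ _ (fine I ^+ 2)).
  rewrite lerXn2r ?nnegrE//.
    by rewrite fine_ge0// integral_ge0.
  by have := le_normr_Rintegral measurableT int.
rewrite -lee_fin.
have : fine I <= Num.sqrt (fine (sqint f)) * Num.sqrt (fine (sqint g)).
  by rewrite -lee_fin fineK.
move=> /(@lerXn2r _ 2); rewrite !nnegrE fine_ge0 ?integral_ge0// mulr_ge0 ?sqrtr_ge0//.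
move=> /(_ isT isT).
by rewrite exprMn !sqr_sqrtr ?fine_ge0 ?sqint_ge0// => ?; rewrite lee_fin.
Qed.

Lemma sqint_indic (A : set X) : measurable A -> sqint (\1_A : X -> R) = m A.
Proof.
move=> mA; rewrite /sqint (eq_integral (fun x => (\1_A x)%:E)) ?integral_indic ?setIT//.
by move=> x _; rewrite indicE; case: (x \in A); rewrite ?expr1n ?expr0n.
Qed.

Lemma sqr_Rintegral_le (A : set X) (c : R) (g : X -> R) : measurable A ->
  m A = c%:E -> measurable_fun setT g -> (sqint g < +oo)%E ->
  (\int[m]_(x in A) g x) ^+ 2 <= c * fine (sqint g).
Proof.
move=> mA Ac mg gfin.
have sA := sqint_indic mA.
have m1A : measurable_fun setT (\1_A : X -> R) by exact: measurable_indic.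
have [] := @cauchy_schwarz \1_A g m1A mg.
- by rewrite sA Ac ltry.
- by [].
have E : (fun x => (\1_A x * g x)%:E) = (EFin \o g) \_ A.
  apply/funext => x; rewrite patchE indicE; case: ifPn => _ /=; by rewrite ?mul1r ?mul0r.
rewrite E => int; rewrite sA Ac real_normK ?num_real//.
rewrite (_ : Rintegral _ _ _ = \int[m]_(x in A) g x)//.
by rewrite /Rintegral E -integral_mkcond.
Qed.

End integral_utils.

Lemma sqint_lincomb d (X : measurableType d) (R : realType)
    (m : {measure set X -> \bar R})
    (f g k : X -> R) (a b : R) :
  measurable_fun setT f -> measurable_fun setT g ->
  (forall x, `|k x| <= `|a * f x| + `|b * g x|) ->
  (sqint m k <= (2 * a ^+ 2)%:E * sqint m f + (2 * b ^+ 2)%:E * sqint m g)%E.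
Proof.
move=> mf mg H.
have a0 (e : R) : 0 <= 2 * e ^+ 2 by rewrite mulr_ge0// sqr_ge0.
rewrite -!ge0_integralZl_EFin//; last 4 first.
- by move=> x _; rewrite lee_fin sqr_ge0.
- exact: measurable_sqr.
- by move=> x _; rewrite lee_fin sqr_ge0.
- exact: measurable_sqr.
rewrite -ge0_integralD//; last 4 first.
- by move=> x _; rewrite -EFinM lee_fin mulr_ge0// sqr_ge0.
- by apply: measurable_funeM; exact: measurable_sqr.
- by move=> x _; rewrite -EFinM lee_fin mulr_ge0// sqr_ge0.
- by apply: measurable_funeM; exact: measurable_sqr.
apply: ge0_integral_mono => x _; first by rewrite lee_fin sqr_ge0.
rewrite -!EFinM -EFinD lee_fin.
apply: (@le_trans _ _ ((`|a * f x| + `|b * g x|) ^+ 2)).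
  by rewrite -[leLHS]real_normK ?num_real// lerXn2r ?nnegrE// addr_ge0.
have -> : 2 * a ^+ 2 * f x ^+ 2 = 2 * `|a * f x| ^+ 2 by rewrite real_normK ?num_real//; ring.
have -> : 2 * b ^+ 2 * g x ^+ 2 = 2 * `|b * g x| ^+ 2 by rewrite real_normK ?num_real//; ring.
have : 0 <= (`|a * f x| - `|b * g x|) ^+ 2 by exact: sqr_ge0.
rewrite !expr2; lra.
Qed.

Lemma sqintD_lty d (X : measurableType d) (R : realType) (m : {measure set X -> \bar R})
    (f g : X -> R) : measurable_fun setT f -> measurable_fun setT g ->
  (sqint m f < +oo)%E -> (sqint m g < +oo)%E ->
  (sqint m (fun x => f x + g x)%R < +oo)%E.
Proof.
move=> mf mg ff gg.
have := @sqint_lincomb _ _ _ m f g (fun x => f x + g x) 1 1 mf mg.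
move=> /(_ _)/wrap[|/le_lt_trans]; first by move=> x; rewrite !mul1r ler_normD.
by apply; rewrite lte_add_pinfty// lte_mul_pinfty// lee_fin mulr_ge0// sqr_ge0.
Qed.

Lemma sqint_quot d (X : measurableType d) (R : realType) (m : {measure set X -> \bar R})
    (a b : X -> R) (h : R) : measurable_fun setT a -> measurable_fun setT b ->
  (sqint m (fun x => (a x - b x) / h)%R <= (2 / h ^+ 2)%:E * (sqint m a + sqint m b))%E.
Proof.
move=> ma mb; rewrite ge0_muleDr ?sqint_ge0//.
rewrite -[h ^+ 2]invrK -exprVn invrK; apply: sqint_lincomb => // x.
by rewrite mulrBl (le_trans (ler_normB _ _))// ![h^-1 * _]mulrC.
Qed.

Lemma ge0_lty_fineE (R : realType) (x : \bar R) : (0 <= x)%E -> (x < +oo)%E ->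
  x = (fine x)%:E.
Proof. by move=> x0 xoo; rewrite fineK// ge0_fin_numE. Qed.

Section square_of_sum.
Context d (X : measurableType d) (R : realType) (m : {measure set X -> \bar R}).

Lemma limn_einf_le_cst (u : (\bar R)^nat) (c : \bar R) : (forall n, u n <= c)%E ->
  (limn_einf u <= c)%E.
Proof.
move=> uc; rewrite limn_einf_lim; apply: lime_le; first exact: is_cvg_einfs.
apply: nearW => n; apply: le_trans (uc n).
by apply: ereal_inf_lbound; exists n => /=.
Qed.

(** The cross term is isolated: it is the one on which [weak_energy] gives
    information. *)
Lemma sqint_expand (a b : X -> R) : measurable_fun setT a -> measurable_fun setT b ->
  (sqint m a < +oo)%E -> (sqint m b < +oo)%E ->
  sqint m (fun x => a x + b x) =
    (fine (sqint m a) + fine (sqint m b) + 2 * \int[m]_x (a x * b x))%:E.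
Proof.
move=> ma mb fa fb.
have isq g : measurable_fun setT g -> (sqint m g < +oo)%E ->
  m.-integrable setT (fun x => (g x ^+ 2)%:E).
  move=> mg fg; apply/integrableP; split; first exact: measurable_sqr.
  rewrite (_ : (\int[m]_x _)%E = sqint m g)//; apply: eq_integral => x _.
  by rewrite abse_EFin ger0_norm// sqr_ge0.
have [iab _] := cauchy_schwarz ma mb fa fb.
have ia := isq a ma fa; have ib := isq b mb fb.
have iab2 : m.-integrable setT (fun x => (2 * (a x * b x))%:E)
  by exact: (integrableZl measurableT 2 iab).
have iD : m.-integrable setT (fun x => (a x ^+ 2 + b x ^+ 2)%:E)
  by exact: (integrableD measurableT ia ib).
have fD := sqintD_lty ma mb fa fb.
rewrite -[LHS]fineK ?ge0_fin_numE ?sqint_ge0//; congr (_%:E).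
transitivity (\int[m]_x (a x ^+ 2 + b x ^+ 2 + 2 * (a x * b x))).
  by rewrite /Rintegral; congr fine; apply: eq_integral => x _; congr (_%:E); ring.
by rewrite RintegralD// RintegralD// RintegralZl.
Qed.

End square_of_sum.

Lemma integrable_dominated d (X : measurableType d) (R : realType) (m : {measure set X -> \bar R})
    (g k : X -> R) (c : R) : m.-integrable setT (EFin \o g) -> measurable_fun setT k ->
  (forall x, `|k x| <= c * `|g x|) -> m.-integrable setT (EFin \o k).
Proof.
move=> ig mk H.
apply: (le_integrable measurableT _ _ (integrableZl measurableT c (integrable_abse ig))).
  exact/measurable_EFinP.
move=> x _ /=; rewrite lee_fin; apply: le_trans (H x) _; exact: ler_norm.
Qed.

Section ae_integral.
Context d (X : measurableType d) (R : realType) (m : {measure set X -> \bar R}).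
Import HBNNSimple.

(** A simple function below f keeps its integral when it is set to 0 on the
    exceptional null set, and is then below g everywhere. *)
Lemma ae_ge0_integral_mono (f g : X -> \bar R) : (forall x, 0 <= f x)%E ->
  (forall x, 0 <= g x)%E -> {ae m, forall x, (f x <= g x)%E} ->
  (\int[m]_x f x <= \int[m]_x g x)%E.
Proof.
move=> f0 g0 [Z [mZ Z0 HZ]].
rewrite ge0_integralTE//; apply: ge_ereal_sup => _ [k kf <-].
rewrite -integralT_nnsfun.
have mk : measurable_fun setT (EFin \o k) by apply/measurable_EFinP; exact: measurable_funPT.
have mkZ : measurable_fun setT ((EFin \o k) \_ (~` Z)).
  apply: (iffLR (measurable_restrictT _ (measurableC mZ))).
  exact: (measurable_funS measurableT).
have -> : (\int[m]_x (k x)%:E = \int[m]_x ((EFin \o k) \_ (~` Z)) x)%E.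
  apply: ae_eq_integral => //; exists Z; split => // x /= Hx.
  apply: contrapT => nZ; apply: Hx => _.
  by rewrite patchE mem_set.
apply: ge0_integral_mono => x _; rewrite patchE; case: ifPn => // xZ.
  by rewrite lee_fin fun_ge0.
move: xZ; rewrite inE/= => nZ; apply: le_trans (kf x) _.
by apply: contrapT => nle; apply: nZ; exact: HZ.
Qed.

Lemma ae_eq_ge0_integral (f g : X -> \bar R) : (forall x, 0 <= f x)%E ->
  (forall x, 0 <= g x)%E -> {ae m, forall x, f x = g x} ->
  (\int[m]_x f x = \int[m]_x g x)%E.
Proof.
move=> f0 g0 fg; apply/eqP; rewrite eq_le !ae_ge0_integral_mono//.
  by apply: filterS fg => x ->.
by apply: filterS fg => x ->.
Qed.

Lemma ae_eq_integralT (f g : X -> \bar R) : {ae m, forall x, f x = g x} ->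
  (\int[m]_x f x = \int[m]_x g x)%E.
Proof.
move=> fg; rewrite integralE [RHS]integralE; congr (_ - _)%E.
  apply: ae_eq_ge0_integral => //.
  by apply: filterS fg => x e; rewrite !funeposE e.
apply: ae_eq_ge0_integral => //.
by apply: filterS fg => x e; rewrite !funenegE e.
Qed.

End ae_integral.

Lemma sqint_ae d (X : measurableType d) (R : realType)
    (m : {measure set X -> \bar R}) (f g : X -> R) :
  measurable_fun setT f -> measurable_fun setT g ->
  {ae m, forall x, f x = g x} -> sqint m f = sqint m g.
Proof.
move=> mf mg fg; apply: ae_eq_integral => //; [exact: measurable_sqr|exact: measurable_sqr|].
by apply: filterS fg => x -> _.
Qed.

(** The inner integrals in Fubini's theorem are infinite at worst on a null set;
    this transfers statements about them to their real values. *)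
Lemma integrable_fine d (Y : measurableType d) (R : realType)
    (n : {measure set Y -> \bar R}) (g : Y -> \bar R) :
  n.-integrable setT g -> n.-integrable setT (fun y => (fine (g y))%:E) /\
  \int[n]_y fine (g y) = fine (\int[n]_y g y)%E.
Proof.
move=> ig; have mg := measurable_int _ ig; split.
  apply: (le_integrable measurableT _ _ (integrable_abse ig)).
    by apply/measurable_EFinP; exact: (measurableT_comp (fine_measurable measurableT) mg).
  by move=> y _ /=; case: (g y) => [q||]//=; rewrite ?normr_id// normr0 ?leey.
rewrite /Rintegral; congr fine; apply: ae_eq_integralT.
have := integrable_ae measurableT ig.
by apply: filterS => y gy; rewrite fineK//; exact: gy.
Qed.

(** When the integral of k is minus infinity its real value is 0 by default, hence
    the sign of g. *)
Lemma Rintegral_ae_le d (Y : measurableType d) (R : realType)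
    (n : {measure set Y -> \bar R}) (k g : Y -> R) :
  (forall y, 0 <= g y) -> n.-integrable setT (EFin \o g) ->
  {ae n, forall y, k y <= g y} -> \int[n]_y k y <= \int[n]_y g y.
Proof.
move=> g0 ig kg.
have le : (\int[n]_y (k y)%:E <= \int[n]_y (g y)%:E)%E.
  rewrite integralE; apply: (@le_trans _ _ (\int[n]_y ((EFin \o k)^\+ y))%E).
    by rewrite geeDl// oppe_le0 integral_ge0.
  apply: ae_ge0_integral_mono => //.
  by apply: filterS kg => y ky; rewrite funeposE/= ge_max !lee_fin ky g0.
have fg : (\int[n]_y (g y)%:E)%E \is a fin_num by exact: integrable_fin_num.
have Ig : (0 <= \int[n]_y (g y)%:E)%E by apply: integral_ge0 => y _; rewrite lee_fin.
move: le; rewrite /Rintegral; case: (\int[n]_y (k y)%:E)%E => [q||] le /=.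
- by rewrite -lee_fin fineK.
- by move: le; rewrite leye_eq => /eqP E; rewrite E in fg.
- by rewrite fine_ge0.
Qed.

(** * Translation and product measures *)

Section translation.
Context (R : realType).
Local Notation leb := (@lebesgue_measure R).
Variable h : R.
Let shft (t : measurableTypeR R) : measurableTypeR R := (t + h : R).

Lemma measurable_shift : measurable_fun setT (fun t : R => t + h).
Proof. by apply: measurable_funD => //; exact: measurable_id. Qed.

Let mshft : measurable_fun setT shft.
Proof. exact: measurable_shift. Qed.

Let pf := pushforward leb shft.

(** Translation preserves the length of half-open intervals, which determine
    Lebesgue measure. *)
Lemma lebesgue_measure_shift (A : set R) : measurable A ->
  leb ((fun t : R => t + h) @^-1` A) = leb A.
Proof.
move=> mA; symmetry.
apply: (@lebesgue_measure_unique _ pf) => // _ [[a b] _ <-].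
rewrite /pf /pushforward /shft.
transitivity (leb `]a - h, b - h]%classic).
  rewrite !lebesgue_measure_itv/= !lte_fin ltrD2r; case: ifPn => // _.
  by rewrite -!EFinD; congr (_%:E); lra.
rewrite /pf /pushforward; congr (leb _); apply/seteqP; split => x /=.
  by rewrite /shft !in_itv/= ltrBlDr lerBrDr.
by rewrite /shft !in_itv/= ltrBlDr lerBrDr.
Qed.

Lemma ge0_integral_shift (f : R -> \bar R) : measurable_fun setT f ->
  (forall t, 0 <= f t)%E -> (\int[leb]_t f (t + h)%R = \int[leb]_t f t)%E.
Proof.
move=> mf f0.
have := ge0_integral_pushforward mshft leb measurableT mf (fun y _ => f0 y).
rewrite preimage_setT => <-.
by apply: eq_measure_integral => A mA _; exact: lebesgue_measure_shift.
Qed.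

Lemma integrable_shift (f : R -> R) : leb.-integrable setT (EFin \o f) ->
  leb.-integrable setT (fun t => (f (t + h))%:E).
Proof.
move=> /integrableP[/= mf fi]; apply/integrableP; split.
  by have := measurableT_comp mf measurable_shift.
by rewrite (@ge0_integral_shift (fun t => `|(f t)%:E|%E))//; exact: measurableT_comp.
Qed.

Lemma Rintegral_shift (f : R -> R) : leb.-integrable setT (EFin \o f) ->
  \int[leb]_t f (t + h) = \int[leb]_t f t.
Proof.
move=> fi; rewrite /Rintegral; congr fine.
have mf := measurable_int _ fi.
have := @integral_pushforward _ _ _ _ _ _ mshft leb setT (EFin \o f) mf.
rewrite preimage_setT => /(_ (integrable_shift fi) measurableT) <-.
by apply: eq_measure_integral => A mA _; exact: lebesgue_measure_shift.
Qed.

Lemma ae_shift (A : R -> Prop) : {ae leb, forall t, A t} -> {ae leb, forall t, A (t + h)}.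
Proof.
move=> [N [mN N0 AN]]; exists (shft @^-1` N); split.
- by rewrite -[X in measurable X]setTI; exact: mshft.
- by rewrite -N0; exact: lebesgue_measure_shift.
- by move=> t /= At; apply: AN.
Qed.

End translation.

Section product_shift.
Context d (X : measurableType d) (R : realType) (m : {sigma_finite_measure set X -> \bar R}).
Local Notation leb := (@lebesgue_measure R).
Local Notation P := (m \x leb)%E.
Variable h : R.
Let sh (p : X * R) : X * R := (p.1, p.2 + h).

Lemma measurable_sh : measurable_fun setT sh.
Proof.
apply: measurable_fun_pair; first exact: measurable_fst.
by apply: measurable_funD => //; exact: measurable_snd.
Qed.

Lemma ge0_integral_prod_shift (f : X * R -> \bar R) : measurable_fun setT f ->
  (forall p, 0 <= f p)%E -> (\int[P]_p f (p.1, p.2 + h)%R = \int[P]_p f p)%E.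
Proof.
move=> mf f0.
have mfs : measurable_fun setT (fun p : X * R => f (p.1, p.2 + h))
  by exact: (measurableT_comp mf measurable_sh).
rewrite (fubini_tonelli1 (m1 := m) (m2 := leb) (fun p : X * R => f (p.1, p.2 + h)) mfs)//.
rewrite (fubini_tonelli1 (m1 := m) (m2 := leb) f mf)//.
apply: eq_integral => x _; rewrite /fubini_F/=.
apply: (ge0_integral_shift h (f := fun t => f (x, t))) => //.
exact: (measurableT_comp mf (pair1_measurable x)).
Qed.

Lemma integrable_prod_shift (g : X * R -> R) : P.-integrable setT (EFin \o g) ->
  P.-integrable setT (fun p => (g (p.1, p.2 + h))%:E) /\
  \int[P]_p g (p.1, p.2 + h) = \int[P]_p g p.
Proof.
move=> /[dup] ig /integrableP[mg fg]; split.
  apply/integrableP; split; first exact: (measurableT_comp mg measurable_sh).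
  rewrite (ge0_integral_prod_shift (f := fun p => `|(g p)%:E|%E))//.
  exact: measurableT_comp.
rewrite /Rintegral; congr fine; rewrite integralE [RHS]integralE; congr (_ - _)%E.
  have <- := ge0_integral_prod_shift (measurable_funepos mg) (fun p => funepos_ge0 _ p).
  by apply: eq_integral => p _; rewrite !funeposE.
have <- := ge0_integral_prod_shift (measurable_funeneg mg) (fun p => funeneg_ge0 _ p).
by apply: eq_integral => p _; rewrite !funenegE.
Qed.

Lemma integrable_fubini_G (F : X * R -> R) : P.-integrable setT (EFin \o F) ->
  leb.-integrable setT (fubini_G m (EFin \o F)).
Proof.
move=> iF; apply/integrableP; split; first exact: measurable_fubini_G iF.
have mF := measurable_int _ iF.
have := iffLR (integrable21ltyP m leb mF) iF.
apply: le_lt_trans; apply: ge0_integral_mono => // t _.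
apply: le_abse_integral => //.
exact: (measurableT_comp mF (pair2_measurable t)).
Qed.

Lemma sqint_prod1 (F : X * R -> R) : measurable_fun setT F ->
  sqint P F = (\int[m]_x sqint leb (fun t => F (x, t)))%E.
Proof.
move=> mF; rewrite /sqint (fubini_tonelli1 (m1 := m) (m2 := leb) (fun p => (F p ^+ 2)%:E))//.
  exact: measurable_sqr.
by move=> p; rewrite lee_fin sqr_ge0.
Qed.

End product_shift.

Section real_fubini.
Context d (X : measurableType d) (R : realType) (m : {sigma_finite_measure set X -> \bar R}).
Local Notation leb := (@lebesgue_measure R).
Local Notation P := (m \x leb)%E.

Lemma Rintegral_prod2 (F : X * R -> R) : P.-integrable setT (EFin \o F) ->
  leb.-integrable setT (fun t => (\int[m]_x F (x, t))%:E) /\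
  \int[leb]_t \int[m]_x F (x, t) = \int[P]_p F p.
Proof.
move=> iF; have [i1 E1] := integrable_fine (integrable_fubini_G iF); split => //.
by rewrite -[RHS]/(fine _) -(integral21_prod_meas1 iF) -E1.
Qed.

Lemma Rintegral_prod1 (F : X * R -> R) : P.-integrable setT (EFin \o F) ->
  m.-integrable setT (fun x => (\int[leb]_t F (x, t))%:E) /\
  \int[m]_x \int[leb]_t F (x, t) = \int[P]_p F p.
Proof.
move=> iF; have [i1 E1] := integrable_fine (integrable_fubini_F iF); split => //.
by rewrite -[RHS]/(fine _) -(integral12_prod_meas1 iF) -E1.
Qed.

End real_fubini.

(** * Positivity of the normalizing constant *)
Section gamma.
Context (R : realType).
Local Notation leb := (@lebesgue_measure R).

Lemma powR_continuous_gt0 (q x : R) : 0 < x -> {for x, continuous (fun t : R => t `^ q)}.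
Proof.
move=> x0; apply: differentiable_continuous; apply/derivable1_diffP.
by apply: derivable_powR; rewrite in_itv/= x0.
Qed.

Lemma integral_powR_itv (p a b : R) : 0 < a -> a < b -> p != 0 ->
  (\int[leb]_(t in `[a, b]) (t `^ (p - 1))%:E = ((b `^ p - a `^ p) / p)%:E)%E.
Proof.
move=> a0 ab p0.
have pos (x : R) : a <= x -> 0 < x by exact: lt_le_trans.
have dF (x : R) : 0 < x -> is_derive x 1 (fun t : R => p^-1 *: (t `^ p))
  (p^-1 *: (p * x `^ (p - 1))).
  by move=> x0; apply: is_deriveZ; exact: is_derive1_powR.
have cF (x : R) : 0 < x -> {for x, continuous (fun t : R => p^-1 *: (t `^ p))}.
  by move=> x0; apply: differentiable_continuous; apply/derivable1_diffP; have [] := dF x x0.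
rewrite (@continuous_FTC2 _ (fun t : R => t `^ (p - 1)) (fun t : R => p^-1 *: (t `^ p)) a b)//.
- by rewrite -EFinB; congr (_%:E); rewrite /GRing.scale/=; ring.
- apply: continuous_in_subspaceT => x; rewrite inE/= in_itv/= => /andP[ax _].
  by apply: powR_continuous_gt0; exact: pos.
- split.
  + by move=> x; rewrite in_itv/= => /andP[ax _]; have [] := dF x (lt_trans a0 ax).
  + by apply: cvg_at_right_filter; exact: cF.
  + by apply: cvg_at_left_filter; apply: cF; exact: lt_trans ab.
- move=> x; rewrite in_itv/= => /andP[ax _].
  rewrite derive1E; have /@derive_val -> := dF x (lt_trans a0 ax).
  by rewrite /GRing.scale/= mulrA mulVf// mul1r.
Qed.

Lemma ge0_integral_bigcup_le (F : (set R)^nat) (f : R -> \bar R) (c : \bar R) :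
  {homo F : n m / (n <= m)%N >-> (n <= m)%O} ->
  (forall i, measurable (F i)) -> (forall i, measurable_fun (F i) f) ->
  (forall i x, F i x -> 0 <= f x)%E ->
  (forall i, \int[leb]_(x in F i) f x <= c)%E ->
  (\int[leb]_(x in \bigcup_i F i) f x <= c)%E.
Proof.
move=> nd mF mf f0 le.
have h := ge0_nondecreasing_set_cvg_integral (mu := leb) nd mF mf f0.
rewrite -(cvg_lim _ h)//; apply: lime_le; first by apply/cvg_ex; eexists; exact: h.
exact: nearW.
Qed.

Definition gamma_fun (z t : R) : R := t `^ (z - 1) * expR (- t).

Lemma measurable_gamma_fun z : measurable_fun setT (gamma_fun z).
Proof.
apply: measurable_funM; first exact: measurable_powR.
apply: measurableT_comp; [exact: measurable_expR|exact: measurable_funN].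
Qed.

Lemma gamma_fun_ge0 z t : 0 <= gamma_fun z t.
Proof. by rewrite mulr_ge0 ?powR_ge0 ?expR_ge0. Qed.

(** Here exp (- t) <= 1, and t^(z - 1) has integral at most 1/z. *)
Lemma integral_gamma_near0 (z : R) : 0 < z ->
  (\int[leb]_(t in `]0%R, 1%R]) (gamma_fun z t)%:E < +oo)%E.
Proof.
move=> z0.
have U : `]0, 1]%classic = \bigcup_n `[(n.+2%:R^-1 : R), 1]%classic.
  apply/seteqP; split => [x/=|x [n _]/=]; rewrite !in_itv/=.
    move=> /andP[x0 x1]; exists (Num.truncn x^-1) => //=.
    rewrite in_itv/= x1 andbT -[leRHS]invrK lef_pV2 ?posrE ?invr_gt0//.
    have := truncnS_gt x^-1; move=> /ltW /le_trans; apply.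
    by rewrite ler_nat.
  move=> /andP[nx ->]; rewrite andbT; apply: lt_le_trans nx.
  by rewrite invr_gt0.
rewrite U; apply: (@le_lt_trans _ _ (z^-1)%:E); last by rewrite ltry.
apply: ge0_integral_bigcup_le.
- move=> n m nm; apply/subsetPset => x/=; rewrite !in_itv/= => /andP[nx ->].
  rewrite andbT; apply: le_trans nx.
  by rewrite lef_pV2 ?posrE// ler_nat !ltnS.
- by move=> i; exact: measurable_itv.
- by move=> i; apply: (@measurable_funS _ _ _ _ setT) => //; apply/measurable_EFinP;
    exact: measurable_gamma_fun.
- by move=> i x _; rewrite lee_fin gamma_fun_ge0.
- move=> n; apply: (@le_trans _ _ (\int[leb]_(t in `[n.+2%:R^-1%R, 1%R]) (t `^ (z - 1))%:E)%E).
    apply: ge0_le_integral => //=.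
    + by move=> x _; rewrite lee_fin gamma_fun_ge0.
    + by apply: (@measurable_funS _ _ _ _ setT) => //; apply/measurable_EFinP;
        exact: measurable_gamma_fun.
    + by apply: (@measurable_funS _ _ _ _ setT) => //; apply/measurable_EFinP;
        exact: measurable_powR.
    + move=> x; rewrite in_itv/= => /andP[nx _].
      have x0 : 0 < x by apply: lt_le_trans nx; rewrite invr_gt0.
      by rewrite lee_fin ler_piMr ?powR_ge0// expR_le1 oppr_le0 ltW.
  have n0 : 0 < n.+2%:R^-1 :> R by rewrite invr_gt0.
  have n1 : n.+2%:R^-1 < 1 :> R by rewrite invf_lt1// ltr1n.
  rewrite (integral_powR_itv n0 n1 (lt0r_neq0 z0)).
  by rewrite lee_fin ler_pdivrMr// mulVf ?gt_eqF// powR1 lerBlDr lerDl powR_ge0.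
Qed.

(** The exponential dominates t^(z + 1), so the integrand is at most a multiple of
    t^(-2). *)
Lemma integral_gamma_nearoo (z : R) : 0 < z ->
  (\int[leb]_(t in `[1%R, +oo[) (gamma_fun z t)%:E < +oo)%E.
Proof.
move=> z0.
have U : `[1, +oo[%classic = \bigcup_n `[(1 : R), n.+2%:R]%classic.
  apply/seteqP; split => [x/=|x [n _]/=]; rewrite !in_itv/=.
    rewrite andbT => x1; exists (Num.truncn x) => //=.
    rewrite in_itv/= x1/=.
    by have := truncnS_gt x; move=> /ltW /le_trans; apply; rewrite ler_nat.
  by move=> /andP[-> _].
pose n := Num.truncn (z + 1); pose K : R := (n.+1)`!%:R.
have K0 : 0 <= K by rewrite ler0n.
have bnd t : 1 <= t -> gamma_fun z t <= K * t `^ (-1 - 1).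
  move=> t1; have t0 : 0 < t by exact: lt_le_trans t1.
  rewrite /gamma_fun expRN.
  have -> : t `^ (z - 1) = t `^ (z + 1) * t `^ (-1 - 1).
    by rewrite -powRD; [congr (_ `^ _); ring|rewrite (gt_eqF t0) implybT].
  rewrite mulrAC ler_wpM2r ?powR_ge0// ler_pdivrMr ?expR_gt0//.
  apply: (@le_trans _ _ (t ^+ n.+1)).
    rewrite -powR_mulrn ?(ltW t0)//; apply: ler_powR => //.
    by apply: ltW; exact: truncnS_gt.
  have := expR_ge1Dxn n (ltW t0) => /(le_trans _) h.
  rewrite -ler_pdivrMl ?ltr0n ?fact_gt0// mulrC; apply: h.
  by rewrite lerDr.
rewrite U; apply: (@le_lt_trans _ _ K%:E); last by rewrite ltry.
apply: ge0_integral_bigcup_le.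
- move=> i j ij; apply/subsetPset => x/=; rewrite !in_itv/= => /andP[-> nx]/=.
  by apply: le_trans nx _; rewrite ler_nat !ltnS.
- by move=> i; exact: measurable_itv.
- by move=> i; apply: (@measurable_funS _ _ _ _ setT) => //; apply/measurable_EFinP;
    exact: measurable_gamma_fun.
- by move=> i x _; rewrite lee_fin gamma_fun_ge0.
- move=> k; apply: (@le_trans _ _ (\int[leb]_(t in `[1%R, k.+2%:R%R])
    (K%:E * (t `^ (-1 - 1))%:E))%E).
    apply: ge0_integral_mono => x /=.
      by rewrite lee_fin gamma_fun_ge0.
    by rewrite in_itv/= => /andP[x1 _]; rewrite -EFinM lee_fin bnd.
  rewrite ge0_integralZl_EFin//; last 2 first.
    by move=> x _; rewrite lee_fin powR_ge0.
    by apply: (@measurable_funS _ _ _ _ setT) => //; apply/measurable_EFinP; exact: measurable_powR.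
  rewrite integral_powR_itv ?ltr1n ?oppr_eq0 ?oner_eq0// -EFinM lee_fin.
  rewrite ler_piMr// powR1 invrN invr1 mulrN1 opprB lerBlDr lerDl.
  exact: powR_ge0.
Qed.

(** A real-valued integral is 0 when it diverges, so positivity includes
    convergence; the lower bound comes from the interval [1, 2]. *)
Lemma Gamma_fun_gt0 (z : R) : 0 < z -> 0 < Gamma_fun z.
Proof.
move=> z0; rewrite /Gamma_fun /Rintegral.
have mg D : measurable_fun D (fun t => (gamma_fun z t)%:E).
  by apply: (@measurable_funS _ _ _ _ setT) => //; apply/measurable_EFinP;
    exact: measurable_gamma_fun.
apply: fine_gt0; apply/andP; split; last first.
  rewrite (@itv_bndbnd_setU _ _ (BRight 0) (BRight 1) +oo%O) ?bnd_simp//.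
  apply: le_lt_trans (_ : \int[leb]_(t in `]0%R, 1%R]) (gamma_fun z t)%:E +
    \int[leb]_(t in `[1%R, +oo[) (gamma_fun z t)%:E < +oo)%E; last first.
    by rewrite lte_add_pinfty// ?integral_gamma_near0// integral_gamma_nearoo.
  have dj : [disjoint `]0%R, 1%R]%classic & `]1%R, +oo[%classic : set R].
    rewrite disj_set2E; apply/eqP; rewrite -subset0 => x/= [].
    rewrite !in_itv/= => /andP[_ x1]; rewrite andbT => /lt_le_trans/(_ x1).
    by rewrite ltxx.
  rewrite ge0_integral_setU//=; last 2 first.
    exact: mg.
    by move=> x _; rewrite lee_fin gamma_fun_ge0.
  rewrite leeD2l//; apply: ge0_subset_integral => //; first exact: mg.
    by move=> x _; rewrite lee_fin gamma_fun_ge0.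
  by move=> x/=; rewrite !in_itv/= !andbT; exact: ltW.
pose c : R := expR (- (`|z - 1| * ln 2)) * expR (- 2).
have c0 : 0 < c by rewrite mulr_gt0 ?expR_gt0.
apply: (@lt_le_trans _ _ (\int[leb]_(t in `[1%R, 2%R]) c%:E)%E).
  by rewrite integral_cst//= lebesgue_measure_itv/=
    lte_fin ltr1n -EFinB -EFinM lte_fin mulr_gt0// subr_gt0 ltr1n.
apply: (@le_trans _ _ (\int[leb]_(t in `[1%R, 2%R]) (gamma_fun z t)%:E)%E).
  apply: ge0_integral_mono => x /=; rewrite in_itv/= => /andP[x1 x2].
    by rewrite lee_fin ltW.
  have x0 : 0 < x by exact: lt_le_trans x1.
  rewrite lee_fin ler_pM ?expR_ge0//; last by rewrite ler_expR lerN2.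
  rewrite /powR gt_eqF// ler_expR.
  have l0 : 0 <= ln x by exact: ln_ge0.
  have l2 : ln x <= ln 2 by rewrite ler_ln ?posrE.
  rewrite lerNl -mulNr.
  apply: (@le_trans _ _ (`|z - 1| * ln x)); last by rewrite ler_wpM2l.
  by rewrite ler_wpM2r// -normrN ler_norm.
apply: ge0_subset_integral => //; first exact: mg.
  by move=> x _; rewrite lee_fin gamma_fun_ge0.
by move=> x/=; rewrite !in_itv/= andbT => /andP[/(lt_le_trans ltr01)].
Qed.

Lemma C_Ns_gt0 (N : nat) (s : R) : 0 < s < 1 -> 0 < @C_Ns R N s.
Proof.
move=> /andP[s0 s1]; rewrite /C_Ns.
apply: divr_gt0; apply: mulr_gt0.
- by rewrite mulr_gt0// powR_gt0.
- apply: Gamma_fun_gt0; rewrite divr_gt0// ltr_wpDr// mulr_gt0//.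
- by rewrite powR_gt0// pi_gt0.
- by apply: Gamma_fun_gt0; rewrite subr_gt0.
Qed.

End gamma.

(** * Open sets and cubes in Euclidean space *)
Section euclid.
Context (R : realType) (N : nat).
Local Notation V := 'rV[R]_N.

Lemma measurable_rV_box n (B : 'I_n -> set R) : (forall i, measurable (B i)) ->
  measurable [set v : 'rV[R]_n | forall i, B i (v ord0 i)].
Proof.
move=> mB.
have -> : [set v : 'rV[R]_n | forall i, B i (v ord0 i)] =
    \bigcap_(i in [set: 'I_n]) ((fun v : 'rV[R]_n => v ord0 i) @^-1` B i).
  by apply/seteqP; split => [v vB i _|v vB i]; [exact: vB|exact: (vB i I)].
apply: fin_bigcap_measurable => // i _.
rewrite -[X in measurable X]setTI.
exact: (@measurable_coord _ _ n i).
Qed.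

(** The sigma-algebra of row vectors is generated by the coordinates, so an open
    set is written as a countable union of boxes with rational centres. *)
Lemma open_measurable_rV (A : set V) : open A -> measurable A.
Proof.
move=> oA.
pose box (u : 'rV[rat]_N * nat) : set V := [set v | forall i,
  ball (ratr (u.1 ord0 i) : R) u.2.+1%:R^-1 (v ord0 i)].
pose F u := [set v | box u v /\ box u `<=` A].
have -> : A = \bigcup_u F u.
  apply/seteqP; split => [x Ax|x [u _ [xu]]]; last exact.
  have /nbhs_ballP[e /= e0 eA] : nbhs x A by exact: open_nbhs_nbhs.
  pose k := Num.truncn (2 / e).
  have k0 : 0 < k.+1%:R^-1 :> R by rewrite invr_gt0.
  have ke : k.+1%:R^-1 + k.+1%:R^-1 <= e.
    have := truncnS_gt (2 / e); rewrite -/k ltr_pdivrMr// => h.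
    have : 2 / k.+1%:R <= e by rewrite ler_pdivrMr// mulrC ltW.
    by rewrite mulrDl mul1r.
  have qP i : exists q : rat, ball (x ord0 i) k.+1%:R^-1 (ratr q : R).
    have [|q] := @rat_in_itvoo R (x ord0 i) (x ord0 i + k.+1%:R^-1).
      by rewrite ltrDl.
    rewrite in_itv/= => /andP[q1 q2]; exists q.
    by rewrite /ball/= distrC ger0_norm ?subr_ge0 ?ltW// ltrBlDl.
  have [q qx] := choice qP.
  exists (\row_i q i, k) => //; split => /=.
    by move=> i; rewrite /= mxE; apply: ball_sym.
  move=> v vB; apply: eA; split => //= i j; rewrite ord1.
  apply: (@le_ball _ _ _ _ _ ke).
  apply: ball_triangle (qx j) _.
  by have := vB j; rewrite /= mxE.
apply: countable_bigcupT_measurable => [|u]; first exact: countableP.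
have [uA|uA] := pselect (box u `<=` A).
  have -> : F u = box u by apply/seteqP; split => [v []|v].
  apply: (@measurable_rV_box N (fun i => ball (ratr (u.1 ord0 i) : R) u.2.+1%:R^-1)) => i.
  exact: measurable_ball.
have -> : F u = set0 by apply/seteqP; split => [v []|v].
exact: measurable0.
Qed.

Lemma lebesgue_rV_cube n (a b : R) : a <= b ->
  lebesgue_rV R n [set v : 'rV[R]_n | forall i, a <= v ord0 i <= b] = ((b - a) ^+ n)%:E.
Proof.
move=> ab; elim: n => [|n IHn].
  rewrite /= /dirac/= indicE mem_set// => -[] //.
rewrite /= /cons_measure /pushforward.
have -> : @cons_rV R n @^-1` [set v : 'rV[R]_n.+1 | forall i, a <= v ord0 i <= b] =
    `[a, b]%classic `*` [set v : 'rV[R]_n | forall i, a <= v ord0 i <= b].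
  apply/seteqP; split => [[t v] /= H|[t v] /= [H1 H2] i].
    have E := cons_rVK (t, v); rewrite /uncons_rV in E.
    have Et : cons_rV (t, v) ord0 ord0 = t by case: E.
    have Ev j : cons_rV (t, v) ord0 (lift ord0 j) = v ord0 j.
      by case: E => _ /rowP/(_ j); rewrite mxE.
    split; first by rewrite in_itv/= -Et; exact: H.
    by move=> j; rewrite -Ev; exact: H.
  have E := cons_rVK (t, v); rewrite /uncons_rV in E.
  have Et : cons_rV (t, v) ord0 ord0 = t by case: E.
  have Ev j : cons_rV (t, v) ord0 (lift ord0 j) = v ord0 j.
    by case: E => _ /rowP/(_ j); rewrite mxE.
  case: (unliftP ord0 i) => [j|] ->; first by rewrite Ev; exact: H2.
  by rewrite Et; move: H1; rewrite in_itv.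
rewrite product_measure1E//; last first.
  apply: (@measurable_rV_box n (fun=> `[a, b]%classic)) => i; exact: measurable_itv.
have L : (@lebesgue_measure R `[a, b]%classic = (b - a)%:E)%E.
  rewrite lebesgue_measure_itv/= lte_fin; case: ifPn => //; rewrite -leNgt => ba.
  have -> : b = a by apply/eqP; rewrite eq_le ba ab.
  by rewrite subrr.
by rewrite exprS EFinM; congr (_ * _)%E.
Qed.

End euclid.

(** * The Gagliardo form and the Poincare inequality *)
Section gagliardo.
Context (R : realType) (N : nat).
Local Notation V := 'rV[R]_N.
Local Notation mu := (lebesgue_rV R N).

(** A name for the product measure, to which a sigma-finite structure can be
    attached. *)
Definition mu2 : set (V * V) -> \bar R := (mu \x mu)%E.
HB.instance Definition _ := Measure.on mu2.
HB.instance Definition _ := Measure_isSigmaFinite.Build _ _ _ mu2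
  (product_measure_sigma_finite mu mu).

Lemma measurable_enorm_sub :
  measurable_fun setT (fun p : V * V => enorm (p.1 - p.2)).
Proof.
rewrite /enorm /dotv; apply: measurableT_comp.
  by apply: continuous_measurable_fun; exact: sqrt_continuous.
apply: measurable_sum => i.
have mi : measurable_fun setT (fun p : V * V => (p.1 - p.2) ord0 i).
  rewrite (_ : (fun _ => _) = (fun p : V * V => p.1 ord0 i - p.2 ord0 i)); last first.
    by apply/funext => p; rewrite !mxE.
  apply: measurable_funB.
  - exact: (measurableT_comp (@measurable_coord _ _ N i) measurable_fst).
  - exact: (measurableT_comp (@measurable_coord _ _ N i) measurable_snd).
exact: measurable_funM.
Qed.

Lemma enorm_gt0 (x : V) i : x ord0 i != 0 -> 0 < enorm x.
Proof.
move=> xi; rewrite sqrtr_gt0 /dotv (bigD1 i)//=; apply: ltr_pwDl.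
  by rewrite lt_def -expr2 sqr_ge0 sqrf_eq0 xi.
by apply: sumr_ge0 => j _; rewrite -expr2 sqr_ge0.
Qed.

Lemma enorm_le (x : V) (c : R) : (forall i, `|x ord0 i| <= c) ->
  enorm x <= Num.sqrt (N%:R * c ^+ 2).
Proof.
move=> xc; rewrite ler_sqrt; last by rewrite mulr_ge0// sqr_ge0.
rewrite /dotv.
apply: (@le_trans _ _ (\sum_(i < N) c ^+ 2)).
  apply: ler_sum => i _.
  by rewrite -expr2 -[leLHS]real_normK ?num_real// lerXn2r ?nnegrE// (le_trans _ (xc i)).
by rewrite sumr_const card_ord mulr_natl.
Qed.

Variable s : R.
Hypothesis hs : 0 < s < 1.
Let s0 : 0 < s. Proof. by case/andP: hs. Qed.

(** The difference quotient D v of the Gagliardo form: with it, the form is an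
    inner product in L^2 over pairs of points, see [Fform_gq]. *)
Definition gq (v : V -> R) (p : V * V) : R :=
  (v p.1 - v p.2) / enorm (p.1 - p.2) `^ (N%:R / 2 + s).

Lemma measurable_gq v : measurable_fun setT v -> measurable_fun setT (gq v).
Proof.
move=> mv; apply: measurable_funM.
  apply: measurable_funB.
  - exact: (measurableT_comp mv measurable_fst).
  - exact: (measurableT_comp mv measurable_snd).
rewrite (_ : (fun _ => _) = (fun p : V * V => enorm (p.1 - p.2) `^ (- (N%:R / 2 + s)))).
  apply: (measurableT_comp (measurable_powR _)); exact: measurable_enorm_sub.
by apply/funext => p; rewrite powRN.
Qed.

Lemma gqM a b p : gq a p * gq b p =
  (a p.1 - a p.2) * (b p.1 - b p.2) / enorm (p.1 - p.2) `^ (N%:R + 2 * s).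
Proof.
rewrite /gq mulrACA -invfM -powRD; last first.
  have p0 : 0 < N%:R / 2 + s by rewrite ltr_wpDl// divr_ge0.
  by rewrite gt_eqF ?implybT// addr_gt0.
by congr (_ * _^-1); congr (_ `^ _); lra.
Qed.

Lemma gqE v p : gq v p ^+ 2 = (v p.1 - v p.2) ^+ 2 / enorm (p.1 - p.2) `^ (N%:R + 2 * s).
Proof. by rewrite !expr2 gqM. Qed.

Lemma gq_lin a v w p : gq (fun x => a * v x + w x) p = a * gq v p + gq w p.
Proof. by rewrite /gq; ring. Qed.

Lemma gqB v w p : gq (fun x => v x - w x) p = gq v p - gq w p.
Proof. by rewrite /gq; ring. Qed.

Lemma HsP v : Hs s v <-> [/\ measurable_fun setT v, (sqint mu v < +oo)%E &
  (sqint mu2 (gq v) < +oo)%E].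
Proof.
split.
  by move=> [/Lfun2P[mv vf] /Lfun2P[_ qf]].
move=> [mv vf qf]; split; first exact/Lfun2P.
by apply/(@Lfun2P _ _ R mu2); split => //; exact: measurable_gq.
Qed.

Lemma Fform_gq a b : Fform s a b =
  @C_Ns R N s / 2 * \int[mu2]_p (gq a p * gq b p).
Proof.
rewrite /Fform; congr (_ * _); rewrite /Rintegral; congr fine.
by apply: eq_integral => p _; rewrite gqM.
Qed.

Lemma Fform_sq a : Fform s a a = @C_Ns R N s / 2 * fine (sqint mu2 (gq a)).
Proof.
by rewrite Fform_gq.
Qed.

Let C2 : 0 < @C_Ns R N s / 2.
Proof. by rewrite divr_gt0// C_Ns_gt0. Qed.

Lemma Hs0_norm_sq a : Hs0_norm s a ^+ 2 = @C_Ns R N s / 2 * fine (sqint mu2 (gq a)).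
Proof.
rewrite sqr_sqrtr Fform_sq// mulr_ge0 ?(ltW C2)//.
by rewrite fine_ge0// sqint_ge0.
Qed.

Lemma Hs_lin c (v w : V -> R) : Hs s v -> Hs s w -> Hs s (fun x => c * v x + w x).
Proof.
move=> /HsP[mv vf qv] /HsP[mw wf qw].
have mcv : measurable_fun setT (fun x => c * v x) by apply: measurable_funM.
have cZ d (X : measurableType d) (m : {measure set X -> \bar R}) (f : X -> R) :
    measurable_fun setT f -> (sqint m f < +oo -> sqint m (fun x => c * f x)%R < +oo)%E.
  move=> mf ff; rewrite /sqint.
  rewrite (eq_integral (fun x => (c ^+ 2)%:E * (f x ^+ 2)%:E)%E); last first.
    by move=> x _; rewrite exprMn EFinM.
  rewrite ge0_integralZl_EFin ?sqr_ge0//; last 2 first.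
    by move=> x _; rewrite lee_fin sqr_ge0.
    exact: measurable_sqr.
  by rewrite lte_mul_pinfty// lee_fin sqr_ge0.
apply/HsP; split.
- exact: measurable_funD.
- by apply: sqintD_lty => //; exact: cZ.
- rewrite (_ : gq _ = (fun p => c * gq v p + gq w p)); last by apply/funext => p; rewrite gq_lin.
  apply: sqintD_lty; [|exact: measurable_gq| |by []].
    by apply: measurable_funM => //; exact: measurable_gq.
  by apply: cZ => //; exact: measurable_gq.
Qed.

Lemma Hs0_lin (Om : set V) c (v w : V -> R) : Hs0 s Om v -> Hs0 s Om w ->
  Hs0 s Om (fun x => c * v x + w x).
Proof.
move=> [Hv v0] [Hw w0]; split; first exact: Hs_lin.
by apply: filterS2 v0 w0 => x vx wx nx; rewrite vx// wx// mulr0 addr0.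
Qed.

Lemma Hs0B (Om : set V) (v w : V -> R) : Hs0 s Om v -> Hs0 s Om w -> Hs0 s Om (v - w).
Proof.
move=> Hv Hw; rewrite (_ : v - w = (fun x => (-1) * w x + v x)); first exact: Hs0_lin.
by apply/funext => x; rewrite mulN1r addrC.
Qed.

End gagliardo.

Section poincare.
Context (R : realType) (N : nat) (s : R).
Hypothesis hs : 0 < s < 1.
Hypothesis hN : (1 <= N)%N.
Local Notation V := 'rV[R]_N.
Local Notation mu := (lebesgue_rV R N).
Variable Om : set V.
Hypothesis Om_bounded : bounded_set Om.

Lemma bounded_coord : exists2 B : R, 0 < B & forall x i, Om x -> `|x ord0 i| <= B.
Proof.
have [M [Mr MP]] := Om_bounded.
exists (Num.max 1 (M + 1)); first by rewrite lt_max ltr01.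
move=> x i Ox; apply: le_trans (MP (Num.max 1 (M + 1)) _ x Ox); last first.
  by rewrite lt_max ltrDl ltr01 orbT.
rewrite /Num.norm/= mx_normrE.
exact: (@le_bigmax _ _ _ 0 (fun ij => `|x ij.1 ij.2|) (ord0, i)).
Qed.

Lemma bounded_measure_lty : measurable Om -> (mu Om < +oo)%E.
Proof.
have [B B0 OB] := bounded_coord => mO.
apply: (@le_lt_trans _ _ (mu [set v : V | forall i, - B <= v ord0 i <= B])); last first.
  have BB : - B <= B by lra.
  by rewrite (lebesgue_rV_cube N BB) ltry.
apply: le_measure; rewrite ?inE//; last first.
  by move=> x Ox i; rewrite -ler_norml; exact: OB.
have -> : [set v : V | forall i, - B <= v ord0 i <= B] =
  [set v : V | forall i, `[-B, B]%classic (v ord0 i)].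
  by apply/seteqP; split => v /= vB i; have := vB i; rewrite in_itv.
by apply: (@measurable_rV_box _ N (fun=> `[-B, B]%classic)) => i; exact: measurable_itv.
Qed.

(** A unit cube is placed outside Om, at bounded distance from it. There v
    vanishes, so for x in Om the integral of (gq v (x, y))^2 over y in this cube is
    at least v(x)^2 / D^(N + 2s), where D bounds the distances involved. *)
Lemma poincare : exists2 K : R, 0 < K & forall v : V -> R, measurable_fun setT v ->
  {ae mu, forall x, ~ Om x -> v x = 0} ->
  (sqint mu v <= K%:E * sqint (@mu2 R N) (gq s v))%E.
Proof.
have [B B0 OB] := bounded_coord.
pose Bx := [set y : V | forall i, B + 1 <= y ord0 i <= B + 2].
have mBx : measurable Bx.
  have -> : Bx = [set v : V | forall i, `[B + 1, B + 2]%classic (v ord0 i)].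
    by apply/seteqP; split => v /= vB i; have := vB i; rewrite in_itv.
  by apply: (@measurable_rV_box _ N (fun=> `[B + 1, B + 2]%classic)) => i; exact: measurable_itv.
have muBx : mu Bx = 1%E.
  rewrite lebesgue_rV_cube; first by rewrite (_ : _ - _ = 1) ?expr1n//; lra.
  by rewrite lerD2l ler1n.
pose D := Num.sqrt (N%:R * (2 * B + 2) ^+ 2).
have i0 : 'I_N by exact: Ordinal hN.
have sep x y : Om x -> Bx y -> 0 < enorm (x - y) <= D.
  move=> Ox By; apply/andP; split.
    apply: (@enorm_gt0 _ _ _ i0); rewrite !mxE.
    have := OB x i0 Ox; have /andP[] := By i0; rewrite ler_norml.
    by move=> + _ /andP[_]; move=> h1 h2; apply/eqP; lra.
  apply: enorm_le => i; rewrite !mxE.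
  have := OB x i Ox; have /andP[] := By i; rewrite !ler_norml.
  by move=> h1 h2 /andP[h3 h4]; apply/andP; split; lra.
have D0 : 0 < D.
  rewrite sqrtr_gt0 mulr_gt0 ?ltr0n// exprn_gt0//; lra.
pose e : R := N%:R + 2 * s.
have e0 : 0 <= e by rewrite addr_ge0// mulr_ge0//; case/andP: hs => /ltW.
have De : 0 < D `^ e by exact: powR_gt0.
exists (D `^ e) => // v mv v0.
have msec x : measurable_fun setT (fun y => (gq s v (x, y) ^+ 2)%:E : \bar R).
  apply: measurable_sqr.
  exact: (measurableT_comp (measurable_gq s mv) (pair1_measurable x)).
have mg : measurable_fun setT (fun p => (gq s v p ^+ 2)%:E : \bar R).
  by apply: measurable_sqr; exact: measurable_gq.
have g0 p : (0 <= (gq s v p ^+ 2)%:E :> \bar R)%E by rewrite lee_fin sqr_ge0.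
have key x : (~ Om x -> v x = 0) ->
    ((v x ^+ 2)%:E <= (D `^ e)%:E * \int[mu]_y (gq s v (x, y) ^+ 2)%:E)%E.
  move=> vx; have [Ox|nOx] := pselect (Om x); last first.
    rewrite vx// expr0n/= mule_ge0//; first by rewrite lee_fin ltW.
    by apply: integral_ge0.
  rewrite -ge0_integralZl_EFin//; last exact: ltW.
  have -> : ((v x ^+ 2)%:E = \int[mu]_y ((v x ^+ 2)%:E * (\1_Bx y)%:E))%E.
    rewrite ge0_integralZl_EFin ?sqr_ge0//; last first.
      by apply/measurable_EFinP; exact: measurable_indic.
    rewrite -[LHS]mule1; congr (_ * _)%E.
    by rewrite integral_indic// setIT; exact/esym.
  apply: ae_ge0_le_integral => //.
  - by move=> y _; rewrite -EFinM lee_fin mulr_ge0// sqr_ge0.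
  - by apply: measurable_funeM; apply/measurable_EFinP; exact: measurable_indic.
  - by move=> y _; rewrite mule_ge0// lee_fin ltW.
  - exact: measurable_funeM.
  - apply: filterS v0 => y vy _; rewrite -!EFinM lee_fin indicE.
    case: (boolP (y \in Bx)) => yB; last by rewrite mulr0 mulr_ge0 ?sqr_ge0// ltW.
    move: yB; rewrite inE => yB; rewrite mulr1 gqE//=.
    rewrite vy ?subr0; last first.
      move=> Oy; have := OB y i0 Oy; have /andP[+ _] := yB i0; rewrite ler_norml.
      by move=> h1 /andP[_ h2]; lra.
    have /andP[e1 e2] := sep x y Ox yB.
    rewrite mulrCA ler_peMr ?sqr_ge0// ler_pdivlMr ?powR_gt0// mul1r.
    by apply: ge0_ler_powR; rewrite ?nnegrE ?(ltW e1) ?(ltW D0).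
apply: (@le_trans _ _ (\int[mu]_x ((D `^ e)%:E * fubini_F mu (fun p => (gq s v p ^+ 2)%:E) x))%E).
  apply: ae_ge0_le_integral => //.
  - by move=> y _; rewrite lee_fin sqr_ge0.
  - exact: measurable_sqr.
  - by move=> y _; rewrite mule_ge0 ?lee_fin ?(ltW De)//; apply: integral_ge0.
  - apply: measurable_funeM; exact: measurable_fun_fubini_tonelli_F.
  - by apply: filterS v0 => x vx _; exact: key.
rewrite ge0_integralZl_EFin//; last 3 first.
- by move=> y _; apply: integral_ge0.
- exact: measurable_fun_fubini_tonelli_F.
- exact: ltW.
by rewrite /sqint /mu2 fubini_tonelli1.
Qed.

End poincare.

(** * Steklov averages in one variable *)
Section primitive.
Context (R : realType).
Local Notation leb := (@lebesgue_measure R).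
Implicit Types (g : R -> R) (T h t : R).

Lemma lebesgue_measure_itv_lty (i : interval R) (a b : R) : [set` i] `<=` `[a, b]%classic ->
  (leb [set` i] < +oo)%E.
Proof.
move=> iab; apply: (@le_lt_trans _ _ (leb `[a, b]%classic)).
  by apply: le_measure; rewrite ?inE; first exact: measurable_itv.
by rewrite lebesgue_measure_itv/=; case: ifP => _; rewrite ?ltry// -EFinB ltry.
Qed.

Lemma lebesgue_measure_itv_oc (a b : R) : a <= b -> leb `]a, b]%classic = (b - a)%:E.
Proof.
rewrite lebesgue_measure_itv/= lte_fin le_eqVlt => /predU1P[->|->//].
by rewrite ltxx subrr.
Qed.

Definition bdsupp T g := [/\ measurable_fun setT g, (exists c, forall t, `|g t| <= c) &
  forall t, ~ (0 < t < T) -> g t = 0].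

Lemma bdsupp_integrable T g : bdsupp T g -> leb.-integrable setT (EFin \o g).
Proof.
move=> [mg [c gc] g0].
have -> : EFin \o g = (EFin \o g) \_ `]0, T[%classic.
  apply/funext => t; rewrite patchE; case: ifPn => //.
  by rewrite notin_setE/= in_itv/= => /g0 ->.
have mI : measurable (`]0, T[%classic : set (measurableTypeR R)) by exact: measurable_itv.
apply: (iffLR (integrable_mkcond (mu := leb) (EFin \o g) mI)).
apply: measurable_bounded_integrable; first exact: measurable_itv.
- by apply: (@lebesgue_measure_itv_lty _ 0 T); exact: subset_itv_oo_cc.
- exact: measurable_funS mg.
- exists c; split; first exact: num_real.
  by move=> x cx t _ /=; exact: le_trans (gc t) (ltW cx).
Qed.

Lemma bdsupp_sqint T g : bdsupp T g -> (sqint leb g < +oo)%E.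
Proof.
move=> [mg [c gc] g0].
have /bdsupp_integrable/integrableP[_] : bdsupp T (fun t => g t ^+ 2).
  split; first exact: measurable_funX.
    by exists (c ^+ 2) => t; rewrite normrX lerXn2r ?nnegrE// (le_trans _ (gc t)).
  by move=> t /g0 ->; rewrite expr0n.
apply: le_lt_trans; apply: ge0_integral_mono => t _ /=; first by rewrite lee_fin sqr_ge0.
by rewrite lee_fin ler_norm.
Qed.

Definition prim g t := \int[leb]_(u in `]-oo, t]) g u.

(** The forward Steklov average, the mean of g over [t, t + h]. *)
Definition avg h g t := (prim g (t + h) - prim g t) / h.

Lemma prim_sub g t' t : leb.-integrable setT (EFin \o g) -> t' <= t ->
  prim g t - prim g t' = \int[leb]_(u in `]t', t]) g u.
Proof.
move=> ig tt; rewrite /prim Rintegral_itvB//.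
by apply: (integrableS measurableT) => //; exact: measurable_itv.
Qed.

(** Cauchy-Schwarz on the interval between t' and t. *)
Lemma prim_holder g t' t : leb.-integrable setT (EFin \o g) ->
  (sqint leb g < +oo)%E ->
  (prim g t - prim g t') ^+ 2 <= `|t - t'| * fine (sqint leb g).
Proof.
move=> ig sg.
have mg : measurable_fun setT g by apply/measurable_EFinP; exact: measurable_int ig.
wlog tt : t t' / t' <= t.
  move=> W; have [|] := leP t' t; first exact: W.
  by move=> /ltW/W; rewrite -sqrrN opprB distrC.
rewrite prim_sub//.
have lE := lebesgue_measure_itv_oc tt.
have := sqr_Rintegral_le (m := leb) (measurable_itv `]t', t]) lE mg sg.
by rewrite ger0_norm// subr_ge0.
Qed.

Lemma prim_le g t' t : leb.-integrable setT (EFin \o g) -> (forall u, 0 <= g u) ->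
  t' <= t -> prim g t' <= prim g t.
Proof.
by move=> ig g0 tt; rewrite -subr_ge0 prim_sub//; apply: Rintegral_ge0.
Qed.

Lemma prim_bdsupp_le0 T g t : bdsupp T g -> t <= 0 -> prim g t = 0.
Proof.
move=> [_ _ g0] t0; rewrite /prim.
rewrite (@eq_Rintegral _ _ _ leb _ (fun=> 0)); last first.
  move=> u; rewrite inE/= in_itv/= => ut; apply: g0 => /andP[u0 _].
  by have := lt_le_trans u0 (le_trans ut t0); rewrite ltxx.
by rewrite /Rintegral integral0.
Qed.

Lemma prim_bdsupp_geT T g t : bdsupp T g -> T <= t -> prim g t = prim g T.
Proof.
move=> bg Tt; have ig := bdsupp_integrable bg; have [_ _ g0] := bg.
apply/eqP; rewrite -subr_eq0 prim_sub//.
rewrite (@eq_Rintegral _ _ _ leb _ (fun=> 0)); last first.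
  move=> u; rewrite inE/= in_itv/= => /andP[Tu _]; apply: g0 => /andP[_ uT].
  by have := lt_trans uT Tu; rewrite ltxx.
by rewrite /Rintegral integral0.
Qed.

(** Cauchy-Schwarz on each window [t, t + h], then Fubini: the windows that
    contain a given u start in an interval of length h. *)
Lemma avg_sqint T g h : bdsupp T g -> 0 < h ->
  (\int[leb]_t (avg h g t ^+ 2)%:E <= sqint leb g)%E.
Proof.
move=> bg h0; have ig := bdsupp_integrable bg; have sg := bdsupp_sqint bg.
have [mg _ _] := bg.
pose k (p : R * R) : R := if (p.1 < p.2) && (p.2 <= p.1 + h) then g p.2 ^+ 2 else 0.
have k0 p : 0 <= k p by rewrite /k; case: ifP => _; rewrite ?sqr_ge0.
have mk : measurable_fun setT (EFin \o k).
  apply/measurable_EFinP; apply: measurable_fun_ifT.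
  - apply: measurable_and.
    + by apply: measurable_fun_ltr; [exact: measurable_fst|exact: measurable_snd].
    + apply: measurable_fun_ler; first exact: measurable_snd.
      by apply: measurable_funD => //; exact: measurable_fst.
  - by apply: measurable_funX; apply: measurableT_comp => //; exact: measurable_snd.
  - exact: measurable_cst.
have step t : ((avg h g t ^+ 2)%:E <= (h^-1)%:E * \int[leb]_u (k (t, u))%:E)%E.
  have tth : t <= t + h by rewrite lerDl ltW.
  pose A := `]t, (t + h)]%classic.
  have mA : measurable A by exact: measurable_itv.
  have mgA : measurable_fun setT (g \_ A).
    by apply/(measurable_restrictT _ _).1 => //; exact: measurable_funS mg.
  have kE : sqint leb (g \_ A) = (\int[leb]_u (k (t, u))%:E)%E.
    apply: eq_integral => u _; rewrite /k/= patchE.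
    have -> : (u \in A) = (t < u) && (u <= t + h) by rewrite mem_setE in_itv/=.
    by case: ifP => //; rewrite expr0n.
  have sA : (sqint leb (g \_ A) < +oo)%E.
    apply: le_lt_trans sg; apply: le_sqint => u; rewrite patchE; case: ifP => //.
    by rewrite normr0.
  have lA : leb A = h%:E.
    by rewrite lebesgue_measure_itv_oc//; congr (_%:E); lra.
  have le := sqr_Rintegral_le (m := leb) mA lA mgA sA; rewrite -kE.
  rewrite /avg prim_sub// exprMn.
  have -> : \int[leb]_(u in `]t, (t + h)]) g u = \int[leb]_(u in A) (g \_ A) u.
    by apply: eq_Rintegral => u uA; rewrite patchE uA.
  rewrite -[sqint _ _]fineK ?ge0_fin_numE ?sqint_ge0// -EFinM lee_fin.
  rewrite mulrC expr2 -mulrA ler_pM2l ?invr_gt0//.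
  by rewrite mulrC ler_pdivrMr// mulrC.
apply: (@le_trans _ _ (\int[leb]_t ((h^-1)%:E * \int[leb]_u (k (t, u))%:E))%E).
  apply: ge0_integral_mono => t _; first by rewrite lee_fin sqr_ge0.
  exact: step.
rewrite ge0_integralZl_EFin//; last 3 first.
- by move=> t _; apply: integral_ge0 => u _; rewrite lee_fin.
- by apply: (measurable_fun_fubini_tonelli_F (m2 := leb) _ mk) => p; rewrite lee_fin.
- by rewrite invr_ge0 ltW.
rewrite (@fubini_tonelli _ _ _ _ _ leb leb (EFin \o k))//=.
have E u : (\int[leb]_t (k (t, u))%:E = h%:E * (g u ^+ 2)%:E)%E.
  transitivity (\int[leb]_t ((g u ^+ 2)%:E * (\1_(`[(u - h)%R, u[%classic) t)%:E))%E.
    apply: eq_integral => t _; rewrite /k/= indicE.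
    have -> : (t \in `[(u - h), u[%classic) = (t < u) && (u <= t + h).
      by rewrite mem_setE in_itv/= lerBlDr andbC.
    by case: ifP => _; rewrite ?mule1// mule0.
  rewrite ge0_integralZl_EFin ?sqr_ge0//; last first.
    by apply/measurable_EFinP; exact: measurable_indic.
  rewrite integral_indic//= setIT muleC; congr (_ * _)%E.
  by rewrite lebesgue_measure_itv/= lte_fin ltrBlDr ltrDl h0 -EFinB; congr (_%:E); lra.
under eq_integral do rewrite E.
rewrite ge0_integralZl_EFin ?(ltW h0)//; last 2 first.
- by move=> t _; rewrite lee_fin sqr_ge0.
- exact: measurable_sqr.
by rewrite muleA -EFinM mulVf ?gt_eqF// mul1e.
Qed.

(** Lebesgue's differentiation theorem, along a sequence of steps. *)
Lemma avg_cvg T g : bdsupp T g ->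
  {ae leb, forall t, avg n.+1%:R^-1 g t @[n --> \oo] --> g t}.
Proof.
move=> bg; have ig := bdsupp_integrable bg; have [mg _ _] := bg.
have ly : locally_integrable setT g.
  by have := integrable_locally_restrict measurableT ig; rewrite patch_setT.
have iy y : leb.-integrable `]-oo, y] (EFin \o g).
  by apply: (integrableS measurableT).
have := FTC1Ny iy ly.
apply: filterS; first exact: (ae_filter_ringOfSetsType leb).
move=> t [dt gt].
have cvd : (h^-1 *: (prim g (h *: (1 : R) + t) - prim g t)) @[h --> 0^'] --> g t.
  by rewrite -gt derive1E; exact: dt.
have := cvg_dnbhs_at_right cvd => /cvg_at_rightP/(_ (@harmonic R)).
have hh : (forall n, 0 < @harmonic R n) /\ (@harmonic R) n @[n --> \oo] --> (0 : R).
  by split; [exact: harmonic_gt0|exact: cvg_harmonic].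
move=> /(_ hh); rewrite /avg /harmonic/=.
under eq_fun do rewrite /GRing.scale/= mulr1 mulrC [_ + t]addrC.
by [].
Qed.

End primitive.

(** * The weak derivative of a Steklov average *)
Section integration_by_parts.
Context (R : realType).
Local Notation leb := (@lebesgue_measure R).
Implicit Types (g eta : R -> R) (T h t : R).

Lemma prim_shift g h t : leb.-integrable setT (EFin \o g) ->
  prim g (t + h) = prim (fun u => g (u + h)) t.
Proof.
move=> ig; rewrite /prim [LHS]Rintegral_mkcond [RHS]Rintegral_mkcond.
rewrite -(Rintegral_shift h).
  apply: eq_Rintegral => u _; rewrite !patchE.
  by rewrite !mem_setE !in_itv/= lerD2r.
have -> : EFin \o g \_ `]-oo, (t + h)] = (EFin \o g) \_ `]-oo, (t + h)].
  by apply/funext => u; rewrite /= !patchE; case: ifP.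
apply: (iffLR (integrable_mkcond (mu := leb) _ (measurable_itv `]-oo, (t + h)]))).
by apply: (integrableS measurableT).
Qed.

Lemma cc_integrable (f : R -> R) (a b : R) : continuous f ->
  (forall t, ~ (a <= t <= b) -> f t = 0) -> leb.-integrable setT (EFin \o f).
Proof.
move=> cf f0.
have -> : EFin \o f = (EFin \o f) \_ `[a, b]%classic.
  apply/funext => t; rewrite patchE; case: ifPn => //.
  by rewrite notin_setE/= in_itv/= => /f0 ->.
have mI : measurable (`[a, b]%classic : set (measurableTypeR R)) by exact: measurable_itv.
apply: (iffLR (integrable_mkcond (mu := leb) (EFin \o f) mI)).
apply: continuous_compact_integrable; first exact: segment_compact.
by apply: continuous_in_subspaceT => x _; exact: cf.
Qed.

Lemma test_functionP T eta : test_function T eta -> exists a b, [/\ 0 < a, b < T,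
  (forall t, ~ (a <= t <= b) -> eta t = 0 /\ derive1 eta t = 0),
  continuous (derive1 eta) & (forall t, derivable eta t 1)].
Proof.
move=> [deta [a [b [a0 bT ab]]]]; exists a, b; split=> //.
- move=> t tab; split; first exact: ab.
  rewrite derive1E.
  have : \forall u \near t, eta u = cst 0 u.
    have [ta|at_] := ltP t a.
      by near=> u; apply: ab => /andP[au _]; have := lt_le_trans (_ : u < a) au;
        rewrite ltxx => /(_ _)/negP; apply => //; near: u; exact: lt_nbhsl.
    have bt : b < t by rewrite ltNge; apply/negP => tb; apply: tab; rewrite at_.
    near=> u; apply: ab => /andP[_ ub].
    have : b < u by near: u; exact: lt_nbhsr.
    by move=> /lt_le_trans/(_ ub); rewrite ltxx.
  by move=> /near_eq_derive ->//; rewrite ?derive_cst// oner_eq0.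
- move=> t; apply: differentiable_continuous; apply/derivable1_diffP.
  by have := deta 1%N t.
- by move=> t; exact: (deta 0%N t).
Unshelve. all: by end_near. Qed.

Lemma integral_test_tail T eta t : test_function T eta ->
  (\int[leb]_(u in `[t, +oo[) (derive1 eta u)%:E = (- eta t)%:E)%E.
Proof.
move=> /test_functionP[a [b [a0 bT ab ceta' deta]]].
pose b' := Num.max b t + 1.
have tb' : t < b' by rewrite /b' ltr_pwDr// le_max lexx orbT.
have bb' : b < b' by rewrite /b' ltr_pwDr// le_max lexx.
have ceta x : {for x, continuous eta}.
  by apply: differentiable_continuous; exact/derivable1_diffP.
transitivity (\int[leb]_(u in `[t, b']) (derive1 eta u)%:E)%E.
  rewrite [LHS]integral_mkcond [RHS]integral_mkcond; apply: eq_integral => u _.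
  rewrite !patchE !mem_setE !in_itv/= andbT.
  have [tu|//] := leP t u; have [//|ub] := leP u b'.
  rewrite (ab u _).2// => /andP[_ ub2].
  by have := lt_trans bb' ub; rewrite ltNge ub2.
have ceta'tb : {within `[t, b'], continuous (derive1 eta)}.
  by apply: continuous_in_subspaceT => x _; exact: ceta'.
have detatb : derivable_oo_LRcontinuous eta t b'.
  split; [by move=> x _; exact: deta| |].
  + by apply: cvg_at_right_filter; exact: ceta.
  + by apply: cvg_at_left_filter; exact: ceta.
apply: (etrans (continuous_FTC2 tb' ceta'tb detatb (fun x _ => erefl))).
rewrite (ab b' _).1 ?sub0e// => /andP[_].
by rewrite leNgt bb'.
Qed.

(** Fubini on the half-plane u <= t: integrating eta' over [u, +oo[ gives
    - eta u. *)
Lemma prim_test T eta g : test_function T eta -> leb.-integrable setT (EFin \o g) ->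
  \int[leb]_t (derive1 eta t * prim g t) = - \int[leb]_t (eta t * g t).
Proof.
move=> Heta ig; have tail t := integral_test_tail t Heta.
have [a [b [a0 bT ab ceta' deta]]] := test_functionP Heta.
have ieta : leb.-integrable setT (EFin \o derive1 eta).
  exact (cc_integrable ceta' (fun t nt => (ab t nt).2)).
have mg : measurable_fun setT g by apply/measurable_EFinP; exact: measurable_int ig.
have meta : measurable_fun setT (derive1 eta) by apply/measurable_EFinP; exact: measurable_int ieta.
pose k (p : R * R) : R := (if p.2 <= p.1 then g p.2 else 0) * derive1 eta p.1.
have mk : measurable_fun setT (EFin \o k).
  apply/measurable_EFinP; apply: measurable_funM.
    apply: measurable_fun_ifT.
    - by apply: measurable_fun_ler; [exact: measurable_snd|exact: measurable_fst].
    - by apply: measurableT_comp => //; exact: measurable_snd.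
    - exact: measurable_cst.
  by apply: measurableT_comp => //; exact: measurable_fst.
have Ig : (\int[leb]_u `|(g u)%:E| < +oo)%E by case/integrableP: ig.
have Ieta : (\int[leb]_u `|(derive1 eta u)%:E| < +oo)%E by case/integrableP: ieta.
pose I := fine (\int[leb]_u `|(g u)%:E|)%E.
have IE : (\int[leb]_u `|(g u)%:E| = I%:E)%E.
  by rewrite fineK// ge0_fin_numE//; apply: integral_ge0.
have I0 : 0 <= I by rewrite fine_ge0//; exact: integral_ge0.
have step t : (\int[leb]_u `|(EFin \o k) (t, u)| <= I%:E * `|(derive1 eta t)%:E|)%E.
  rewrite muleC -IE.
  have <- : (\int[leb]_u (`|(derive1 eta t)%:E| * `|(g u)%:E|) =
      `|(derive1 eta t)%:E| * \int[leb]_u `|(g u)%:E|)%E.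
    rewrite ge0_integralZl//.
    by apply: measurableT_comp => //; exact/measurable_EFinP.
  apply: ge0_integral_mono => // u _; rewrite -abseM lee_fin /k/= !normrM mulrC.
  by apply: ler_wpM2l => //; case: ifP => //; rewrite normr0.
have ik : (leb \x leb)%E.-integrable setT (EFin \o k).
  apply: (iffRL (integrable12ltyP leb leb mk)).
  apply: (@le_lt_trans _ _ (\int[leb]_t (I%:E * `|(derive1 eta t)%:E|))%E).
    by apply: ge0_integral_mono => t _; [apply: integral_ge0|exact: step].
  rewrite ge0_integralZl_EFin//; last by apply: measurableT_comp => //; exact/measurable_EFinP.
  by rewrite lte_mul_pinfty// lee_fin.
have E1 : (\int[leb]_t \int[leb]_u (EFin \o k) (t, u) =
  \int[leb]_t (derive1 eta t * prim g t)%:E)%E.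
  apply: eq_integral => t _; rewrite mulrC EFinM.
  have gt : leb.-integrable setT (fun u => ((g \_ `]-oo, t]) u)%:E).
    rewrite (_ : (fun _ => _) = (EFin \o g) \_ `]-oo, t]); last first.
      by apply/funext => u; rewrite /= !patchE; case: ifP.
    apply: (iffLR (integrable_mkcond (mu := leb) _ (measurable_itv `]-oo, t]))).
    by apply: (integrableS measurableT).
  transitivity (\int[leb]_u (((g \_ `]-oo, t]) u)%:E * (derive1 eta t)%:E))%E.
    apply: eq_integral => u _; rewrite /k/= EFinM patchE mem_setE in_itv/=.
    by [].
  rewrite integralZr//; congr (_ * _)%E.
  rewrite /prim Rintegral_mkcond /Rintegral fineK//.
  exact: integrable_fin_num.
have E2 : (\int[leb]_u \int[leb]_t (EFin \o k) (t, u) = \int[leb]_u (- (eta u * g u))%:E)%E.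
  apply: eq_integral => u _.
  transitivity (\int[leb]_t ((g u)%:E * (((derive1 eta) \_ `[u, +oo[) t)%:E))%E.
    apply: eq_integral => t _; rewrite /k/= -EFinM patchE mem_setE in_itv/= andbT.
    by case: ifP; rewrite ?mulr0// mul0r.
  have iu : leb.-integrable setT (fun t => ((derive1 eta \_ `[u, +oo[) t)%:E).
    rewrite (_ : (fun _ => _) = (EFin \o derive1 eta) \_ `[u, +oo[); last first.
      by apply/funext => t; rewrite /= !patchE; case: ifP.
    apply: (iffLR (integrable_mkcond (mu := leb) _ (measurable_itv `[u, +oo[))).
    by apply: (integrableS measurableT).
  rewrite integralZl//.
  have tl := tail u.
  transitivity ((g u)%:E * (- eta u)%:E)%E.
    congr (_ * _)%E; rewrite -[RHS]tl [RHS]integral_mkcond; apply: eq_integral => t _.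
    by rewrite !patchE; case: ifP.
  by rewrite -EFinM mulrN mulrC.
have E := etrans (esym E1) (etrans (Fubini ik) E2).
have eta_bnd u : `|eta u| <= fine (\int[leb]_u `|(derive1 eta u)%:E|)%E.
  rewrite -lee_fin fineK; last by rewrite ge0_fin_numE//; exact: integral_ge0.
  have -> : (`|eta u|%:E = `|\int[leb]_(u in `[u, +oo[) (derive1 eta u)%:E|)%E.
    by rewrite tail abse_EFin normrN.
  have mD D : measurable_fun D (fun u : measurableTypeR R => (derive1 eta u)%:E).
    by apply: (measurable_funS measurableT) => //; exact/measurable_EFinP.
  apply: (@le_trans _ _ (\int[leb]_(u in `[u, +oo[) `|(derive1 eta u)%:E|)%E).
    by apply: le_abse_integral => //; exact: mD.
  apply: ge0_subset_integral => //.
  by apply: measurableT_comp => //; exact: mD.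
have meta0 : measurable_fun setT eta.
  by apply: continuous_measurable_fun => u; apply: differentiable_continuous;
    exact/derivable1_diffP.
have ieg : leb.-integrable setT (EFin \o (fun u => eta u * g u)).
  rewrite (_ : _ \o _ = ((EFin \o eta) \* (EFin \o g))%E); last first.
    by apply/funext => u /=; rewrite EFinM.
  apply: integrableMr => //.
  exists (fine (\int[leb]_u `|(derive1 eta u)%:E|)%E); split; first exact: num_real.
  by move=> x cx u _ /=; apply: le_trans (eta_bnd u) (ltW cx).
rewrite -mulN1r -RintegralZl// /Rintegral E; congr fine.
by apply: eq_integral => u _; rewrite mulN1r.
Qed.

(** A Steklov average is the primitive of a difference quotient, so [prim_test]
    applies. *)
Lemma avg_test T eta g h : test_function T eta -> leb.-integrable setT (EFin \o g) ->
  \int[leb]_(t in `]0, T[) (derive1 eta t * avg h g t) =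
  - \int[leb]_(t in `]0, T[) (eta t * ((g (t + h) - g t) / h)).
Proof.
move=> Heta ig.
have [a [b [a0 bT ab ceta' deta]]] := test_functionP Heta.
have out t : t \notin `]0, T[%classic -> eta t = 0 /\ derive1 eta t = 0.
  rewrite mem_setE in_itv/= => tT; apply: ab => /andP[at_ tb].
  by move/negP: tT; apply; rewrite (lt_le_trans a0 at_) (le_lt_trans tb bT).
pose gh t := (g (t + h) - g t) / h.
have igS : leb.-integrable setT (EFin \o (fun u => g (u + h))) by exact: integrable_shift.
have ig' : leb.-integrable setT (EFin \o (fun u => g (u + h) - g u)).
  have -> : EFin \o (fun u => g (u + h) - g u) =
      ((EFin \o (fun u => g (u + h)%R)) \- (EFin \o g))%E.
    by apply/funext => t /=; rewrite EFinB.
  exact: integrableB.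
have igh : leb.-integrable setT (EFin \o gh).
  have -> : EFin \o gh = (fun t => (h^-1)%:E * (g (t + h)%R - g t)%:E)%E.
    by apply/funext => t /=; rewrite /gh mulrC EFinM.
  exact: integrableZl.
have avgE t : avg h g t = prim gh t.
  rewrite /avg prim_shift// /prim.
  rewrite -RintegralB//; last 2 first.
    by apply: (integrableS measurableT).
    by apply: (integrableS measurableT).
  rewrite mulrC -RintegralZl//; last first.
    by apply: (integrableS measurableT).
  by apply: eq_Rintegral => u _; rewrite mulrC.
have := prim_test Heta igh => E.
transitivity (\int[leb]_t (derive1 eta t * prim gh t)).
  rewrite [LHS]Rintegral_mkcond; apply: eq_Rintegral => t _; rewrite patchE.
  by case: ifPn; rewrite ?avgE// => /out[_ ->]; rewrite mul0r.
rewrite E; congr (- _).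
rewrite [RHS]Rintegral_mkcond; apply: eq_Rintegral => t _; rewrite patchE.
by case: ifPn => // /out[-> _]; rewrite mul0r.
Qed.

End integration_by_parts.

(** * Strong measurability and the dual space *)
Section simple_maps.
Context (R : realType).

(** The part of [bochner_simple] that does not mention a vector space; it is
    stable under composition with arbitrary maps. *)
Definition simple_map (A : Type) (u : R -> A) : Prop :=
  finite_set (range u) /\
  forall c, measurable (u @^-1` [set c] : set (measurableTypeR R)).

Lemma simple_map_preimage A (u : R -> A) (C : set A) : simple_map u ->
  measurable (u @^-1` C : set (measurableTypeR R)).
Proof.
move=> [fu mu].
have -> : u @^-1` C = \bigcup_(c in range u `&` C) (u @^-1` [set c]).
  apply/seteqP; split => [t Ct|t [c [_ Cc] utc]].
  by exists (u t).
  by rewrite /preimage /= utc.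
apply: fin_bigcup_measurable => //.
exact: finite_setIl.
Qed.

Lemma simple_map_comp A B (F : A -> B) (u : R -> A) : simple_map u ->
  simple_map (fun t => F (u t)).
Proof.
move=> su; split; last by move=> c; exact: (simple_map_preimage (F @^-1` [set c]) su).
have -> : range (fun t => F (u t)) = F @` range u by rewrite image_comp.
by apply: finite_image; case: su.
Qed.

Lemma simple_map_pair A B (u : R -> A) (v : R -> B) : simple_map u -> simple_map v ->
  simple_map (fun t => (u t, v t)).
Proof.
move=> su sv; split.
  apply: (@sub_finite_set _ _ (range u `*` range v)).
    by move=> _ [t _ <-]; split; exists t.
  by apply: finite_setX; [case: su|case: sv].
move=> [a b].
have -> : (fun t => (u t, v t)) @^-1` [set (a, b)] = u @^-1` [set a] `&` v @^-1` [set b].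
  by apply/seteqP; split => t /= [] -> ->.
by apply: measurableI; exact: simple_map_preimage.
Qed.

Lemma simple_map_shift A (u : R -> A) h : simple_map u -> simple_map (fun t => u (t + h)).
Proof.
move=> su; split.
  apply: (@sub_finite_set _ _ (range u)); last by case: su.
  by move=> _ [t _ <-]; exists (t + h).
move=> c; rewrite -[X in measurable X]setTI.
by apply: (@measurable_shift R h _ (u @^-1` [set c])) => //; exact: simple_map_preimage.
Qed.

Lemma simple_map_indic (D : set R) : measurable (D : set (measurableTypeR R)) ->
  simple_map (fun t => t \in D).
Proof.
move=> mD; split.
  by apply: (@sub_finite_set _ _ [set true; false]) => // b _; case: b; [left|right].
case.
  rewrite (_ : _ @^-1` _ = D)//.
  by apply/seteqP; split => t; [exact: set_mem|exact: mem_set].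
rewrite (_ : _ @^-1` _ = ~` D); first exact: measurableC.
apply/seteqP; split => t; first by move=> tD Dt; move: tD; rewrite /preimage/= mem_set.
by move=> nD; apply/negbTE; rewrite notin_setE.
Qed.

Import HBNNSimple.

(** Simple approximations of time itself. Composed with a continuous curve, they
    give simple approximations of the curve. *)
Lemma simple_map_grid (T : R) : exists e : nat -> R -> R, (forall n, simple_map (e n)) /\
  forall t, 0 < t < T -> e n t @[n --> \oo] --> t.
Proof.
have mI : measurable (`]0, T[%classic : set (measurableTypeR R)) by exact: measurable_itv.
have mid : measurable_fun (`]0, T[%classic : set (measurableTypeR R)) (fun t : R => t%:E : \bar R).
  by apply: (measurable_funS measurableT) => //; apply/measurable_EFinP; exact: measurable_id.
exists (fun n => nnsfun_approx mI mid n); split.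
  move=> n; split; first exact: (fimfunP (nnsfun_approx mI mid n)).
  by move=> c; exact: (measurable_sfunP (nnsfun_approx mI mid n)).
move=> t t0T.
have id0 u : (`]0, T[%classic : set R) u -> (0 <= u%:E :> \bar R)%E.
  by rewrite /= in_itv/= lee_fin => /andP[/ltW].
have := cvg_nnsfun_approx mI mid id0 (x := t).
have tI : (`]0, T[%classic : set R) t by rewrite /= in_itv.
by move=> /(_ tI); exact: fine_cvg.
Qed.

Lemma strongly_measurable_holder (U : zmodType) (D : set U) (nrm : U -> \bar R)
    (T c : R) (u : R -> U) : (forall t, D (u t)) -> (forall x, 0 <= nrm x)%E ->
  (forall t t', nrm (u t - u t')%R <= (c * Num.sqrt `|t - t'|)%:E)%E ->
  strongly_measurable D nrm `]0, T[ u.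
Proof.
move=> Du nrm0 H; have [e [se ecvg]] := simple_map_grid T.
exists (fun n t => u (e n t)); split.
  move=> n; have [] := simple_map_comp u (se n) => h1 h2; split => //.
  by move=> _ [t _ <-].
apply: aeW => t /=; rewrite in_itv/= => tT.
have h1 : (c * Num.sqrt `|e n t - t|)%:E @[n --> \oo] --> 0%E.
  rewrite -[0%E]/((0 : R)%:E); apply: cvg_EFin; first exact: nearW.
  have -> : (0 : R) = c * Num.sqrt `|t - t| by rewrite subrr normr0 sqrtr0 mulr0.
  apply: cvgMr.
  apply: (@continuous_cvg _ _ _ _ _ _ Num.sqrt); first exact: sqrt_continuous.
  apply: cvg_norm; apply: cvgB; [exact: ecvg|exact: cvg_cst].
apply: squeeze_cvge h1; last first.
  exact: cvg_cst.
by apply: nearW => n; rewrite nrm0 H.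
Qed.

End simple_maps.

Section dual.
Context (R : realType) (N : nat) (s : R).
Hypothesis hs : 0 < s < 1.
Hypothesis hN : (1 <= N)%N.
Local Notation V := 'rV[R]_N.
Local Notation mu := (lebesgue_rV R N).
Variable Om : set V.
Hypothesis Om_bounded : bounded_set Om.
Hypothesis mOm : measurable Om.

Lemma L2_le_Hs0_norm : exists2 c : R, 0 < c & forall v : V -> R, Hs0 s Om v ->
  Num.sqrt (fine (sqint mu v)) <= c * Hs0_norm s v.
Proof.
have [K K0 HK] := poincare hs hN Om_bounded.
have C0 := C_Ns_gt0 N hs; set C := C_Ns s in C0.
have KC : 0 < K * (C / 2)^-1 by rewrite mulr_gt0// invr_gt0 divr_gt0.
exists (Num.sqrt (K * (C / 2)^-1)); first by rewrite sqrtr_gt0.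
move=> v [/HsP[mv vf qf] v0].
rewrite -sqrtrM ?(ltW KC)// ler_wsqrtr// Fform_sq//.
have := HK v mv v0.
rewrite -[sqint mu v]fineK ?ge0_fin_numE ?sqint_ge0//.
rewrite -[sqint (@mu2 R N) _]fineK ?ge0_fin_numE ?sqint_ge0// -EFinM lee_fin.
by rewrite -/C mulrA mulfVK// mulf_neq0 ?gt_eqF// invr_gt0.
Qed.

Lemma Hs0_L2 (v : V -> R) : Hs0 s Om v -> measurable_fun setT v /\ (sqint mu v < +oo)%E.
Proof. by move=> [/HsP[]]. Qed.

Lemma sqint_restrict_le (k : V -> R) : (sqint mu (k \_ Om) <= sqint mu k)%E.
Proof. by apply: le_sqint => x; rewrite patchE; case: ifP; rewrite ?normr0. Qed.

Lemma inner_L2_cs (k v : V -> R) : measurable_fun setT k -> (sqint mu k < +oo)%E ->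
  measurable_fun setT v -> (sqint mu v < +oo)%E ->
  mu.-integrable Om (fun x => (k x * v x)%:E) /\
  `|inner_L2 Om k v| <= Num.sqrt (fine (sqint mu k)) * Num.sqrt (fine (sqint mu v)).
Proof.
move=> mk kf mv vf.
have mkO : measurable_fun setT (k \_ Om).
  by apply: (iffLR (measurable_restrictT _ mOm)); exact: measurable_funS mk.
have kOf := le_lt_trans (sqint_restrict_le k) kf.
have [int le] := cauchy_schwarz mkO mv kOf vf.
have E : (fun x => ((k \_ Om) x * v x)%:E) = (fun x => (k x * v x)%:E) \_ Om.
  by apply/funext => x; rewrite !patchE; case: ifP => //; rewrite mul0r.
split; first by rewrite E in int; exact: (iffRL (integrable_mkcond _ mOm)).
have IE : inner_L2 Om k v = \int[mu]_x ((k \_ Om) x * v x).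
  by rewrite /inner_L2 /Rintegral integral_mkcond E.
rewrite IE -sqrtrM ?fine_ge0 ?sqint_ge0//.
rewrite -[leLHS]sqrtr_sqr ler_wsqrtr// -[leLHS]real_normK ?num_real//.
apply: le_trans le _; rewrite ler_wpM2r ?fine_ge0 ?sqint_ge0//.
by rewrite fine_le ?sqint_restrict_le// ge0_fin_numE ?sqint_ge0.
Qed.

(** By the Poincare inequality H^s_0 embeds in L^2, hence L^2 in the dual of
    H^s_0. *)
Lemma inner_L2_dual : exists2 c : R, 0 < c & forall k : V -> R,
  measurable_fun setT k -> (sqint mu k < +oo)%E ->
  [/\ Hs0_dual s Om (inner_L2 Om k),
     (dual_norm s Om (inner_L2 Om k) <= (c * Num.sqrt (fine (sqint mu k)))%:E)%E &
     forall k' : V -> R, measurable_fun setT k' -> (sqint mu k' < +oo)%E ->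
      (dual_norm s Om (inner_L2 Om k - inner_L2 Om k')%R <=
       (c * Num.sqrt (fine (sqint mu (fun x => k x - k' x)%R)))%:E)%E].
Proof.
have [c c0 Hc] := L2_le_Hs0_norm.
have bnd (k v : V -> R) : measurable_fun setT k -> (sqint mu k < +oo)%E -> Hs0 s Om v ->
    Hs0_norm s v <= 1 -> `|inner_L2 Om k v| <= c * Num.sqrt (fine (sqint mu k)).
  move=> mk kf Hv v1; have [mv vf] := Hs0_L2 Hv.
  have [_ /le_trans] := inner_L2_cs mk kf mv vf; apply.
  rewrite mulrC ler_wpM2r//; apply: le_trans (Hc v Hv) _.
  by rewrite ler_piMr// ltW.
exists c => // k mk kf.
have dn : (dual_norm s Om (inner_L2 Om k) <= (c * Num.sqrt (fine (sqint mu k)))%:E)%E.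
  apply: ge_ereal_sup => _ [v [Hv v1] <-]; rewrite lee_fin; exact: bnd.
split => //.
- split; last by apply: le_lt_trans dn _; rewrite ltry.
  move=> a v w /Hs0_L2[mv vf] /Hs0_L2[mw wf].
  have [iv _] := inner_L2_cs mk kf mv vf; have [iw _] := inner_L2_cs mk kf mw wf.
  rewrite /inner_L2 -RintegralZl// -RintegralD//; last first.
    by rewrite (_ : _ \o _ = (fun x => a%:E * (k x * v x)%:E)%E)//; exact: integrableZl.
  by apply: eq_Rintegral => x _; ring.
- move=> k' mk' kf'; apply: ge_ereal_sup => _ [v [Hv v1] <-]; rewrite lee_fin.
  have [mv vf] := Hs0_L2 Hv.
  have [iv _] := inner_L2_cs mk kf mv vf; have [iw _] := inner_L2_cs mk' kf' mv vf.
  have -> : (inner_L2 Om k - inner_L2 Om k') v = inner_L2 Om (fun x => k x - k' x) v.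
    transitivity (inner_L2 Om k v - inner_L2 Om k' v) => //.
    rewrite /inner_L2 -RintegralB//.
    by apply: eq_Rintegral => x _; ring.
  apply: bnd => //; first exact: measurable_funB.
  have := @sqintD_lty _ _ _ mu k (fun x => - k' x) mk.
  apply => //; first exact: measurableT_comp.
  by rewrite /sqint; under eq_integral do rewrite sqrrN.
Qed.

End dual.

(** * Steklov averages of space-time functions *)
Section avg_holder.
Context (R : realType).
Local Notation leb := (@lebesgue_measure R).

Lemma avg_holder (g : R -> R) (h t t' : R) : 0 < h -> leb.-integrable setT (EFin \o g) ->
  (sqint leb g < +oo)%E ->
  (avg h g t - avg h g t') ^+ 2 <= 4 / h ^+ 2 * `|t - t'| * fine (sqint leb g).
Proof.
move=> h0 ig sg.
have := prim_holder (t' + h) (t + h) ig sg; have := prim_holder t' t ig sg.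
rewrite (_ : t + h - (t' + h) = t - t'); last by lra.
rewrite /avg; set F := fine _.
set a := prim g (t + h); set b := prim g (t' + h).
set c := prim g t; set d := prim g t' => h1 h2.
have -> : (a - c) / h - (b - d) / h = ((a - b) - (c - d)) / h by ring.
have -> : 4 / h ^+ 2 * `|t - t'| * F = (4 * (`|t - t'| * F)) / h ^+ 2 by ring.
rewrite exprMn exprVn ler_pM2r ?invr_gt0 ?exprn_gt0//.
have : 0 <= ((a - b) + (c - d)) ^+ 2 by exact: sqr_ge0.
move: h1 h2; rewrite !expr2; lra.
Qed.

End avg_holder.

Section test_function_space.
Context (R : realType) (N : nat) (s : R).
Hypothesis hs : 0 < s < 1.
Local Notation V := 'rV[R]_N.
Local Notation mu := (lebesgue_rV R N).
Local Notation leb := (@lebesgue_measure R).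
Variable Om : set V.
Hypothesis mOm : measurable Om.
Hypothesis Omfin : (mu Om < +oo)%E.
Variables (T c : R) (w : V * R -> R).
Hypothesis T0 : 0 < T.
Hypothesis mw : measurable_fun setT w.
Hypothesis w_bnd : forall p, 0 <= w p <= c.
Hypothesis w_supp : forall p, ~ (Om p.1 /\ 0 < p.2 < T) -> w p = 0.

Lemma measurable_at_time (z : V * R -> R) t : measurable_fun setT z ->
  measurable_fun setT (at_time z t).
Proof. by move=> mz; exact: (measurableT_comp mz (pair2_measurable t)). Qed.

Definition gqt (z : V * R -> R) (p : V * V) : R -> R := fun t => gq s (at_time z t) p.

Lemma measurable_gqt z : measurable_fun setT z ->
  measurable_fun setT (fun q : (V * V) * R => gqt z q.1 q.2).
Proof.
move=> mz; rewrite /gqt /gq /at_time.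
have m1 : measurable_fun setT (fun q : (V * V) * R => (q.1.1, q.2)).
  apply: measurable_fun_pair; last exact: measurable_snd.
  exact: (measurableT_comp measurable_fst measurable_fst).
have m2 : measurable_fun setT (fun q : (V * V) * R => (q.1.2, q.2)).
  apply: measurable_fun_pair; last exact: measurable_snd.
  exact: (measurableT_comp measurable_snd measurable_fst).
apply: measurable_funM.
  apply: measurable_funB; first exact: (measurableT_comp mz m1).
  exact: (measurableT_comp mz m2).
rewrite (_ : (fun _ => _) = (fun p : V * V => enorm (p.1 - p.2) `^ (- (N%:R / 2 + s))) \o fst);
  last first.
  by apply/funext => q /=; rewrite powRN.
apply: measurableT_comp => //.
apply: (measurableT_comp (measurable_powR _)); exact: measurable_enorm_sub.
Qed.

Lemma w_bdsupp x : bdsupp T (fun t => w (x, t)).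
Proof.
split.
- exact: (measurableT_comp mw (pair1_measurable x)).
- by exists c => t; have /andP[w0 wc] := w_bnd (x, t); rewrite ger0_norm.
- by move=> t nt; apply: w_supp => -[].
Qed.

Lemma gqt_bdsupp p : bdsupp T (gqt w p).
Proof.
split.
- exact: (measurableT_comp (measurable_gqt mw) (pair1_measurable p)).
- exists (c / enorm (p.1 - p.2) `^ (N%:R / 2 + s)) => t.
  rewrite /gqt /gq normrM normfV [`|_ `^ _|]ger0_norm ?powR_ge0//.
  rewrite ler_wpM2r ?invr_ge0 ?powR_ge0// /at_time.
  have := w_bnd (p.1, t); have := w_bnd (p.2, t).
  by rewrite ler_norml => /andP[a1 a2] /andP[a3 a4]; apply/andP; split; lra.
- by move=> t nt; rewrite /gqt /gq /at_time !w_supp ?subrr ?mul0r// => -[].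
Qed.

Lemma sqint_w_lty t : (sqint mu (at_time w t) < +oo)%E.
Proof.
have c0 : 0 <= c by have /andP[] := w_bnd (0, 0); exact: le_trans.
apply: (@le_lt_trans _ _ (\int[mu]_x ((c ^+ 2)%:E * (\1_Om x)%:E))%E).
  apply: ge0_integral_mono => x _; first by rewrite lee_fin sqr_ge0.
  rewrite -EFinM lee_fin indicE /at_time.
  have [xO|xO] := boolP (x \in Om).
    have /andP[w0 wc] := w_bnd (x, t).
    by rewrite mulr1 lerXn2r ?nnegrE.
  rewrite w_supp ?expr0n ?mulr0//=.
  by move: xO; rewrite notin_setE => xO [].
rewrite ge0_integralZl_EFin ?sqr_ge0//; last by apply/measurable_EFinP; exact: measurable_indic.
by rewrite integral_indic// setIT lte_mul_pinfty// ?lee_fin ?sqr_ge0.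
Qed.

Definition D2w := (\int[mu]_x sqint leb (fun t => w (x, t)))%E.

Lemma D2w_lty : (D2w < +oo)%E.
Proof.
have m2 : measurable_fun setT (fun q : V * R => (w q ^+ 2)%:E : \bar R).
  exact: measurable_sqr.
rewrite /D2w /sqint.
rewrite (fubini_tonelli (m1 := mu) (m2 := leb) (fun q : V * R => (w q ^+ 2)%:E))//; last first.
  by move=> q; rewrite lee_fin sqr_ge0.
have c0 : 0 <= c by have /andP[] := w_bnd (0, 0); exact: le_trans.
pose I := ((c ^+ 2)%:E * mu Om)%E.
have IE : I \is a fin_num by rewrite fin_numM// ge0_fin_numE.
have I0 : (0 <= I)%E by rewrite mule_ge0// lee_fin sqr_ge0.
apply: (@le_lt_trans _ _ (\int[leb]_t (I * (\1_(`]0, T[%classic) t)%:E))%E).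
  apply: ge0_integral_mono => t _; first by apply: integral_ge0 => x _; rewrite lee_fin sqr_ge0.
  rewrite indicE mem_setE in_itv/=.
  have [tT|tT] := boolP (0 < t < T); last first.
    rewrite mule0 integral0_eq// => x _.
    by rewrite w_supp ?expr0n// => -[_ /=]; exact/negP.
  rewrite mule1 /I.
  have -> : ((c ^+ 2)%:E * mu Om = \int[mu]_x ((c ^+ 2)%:E * (\1_Om x)%:E))%E.
    rewrite ge0_integralZl_EFin ?sqr_ge0//; last by apply/measurable_EFinP; exact: measurable_indic.
    by rewrite integral_indic// setIT.
  apply: ge0_integral_mono => x _; first by rewrite lee_fin sqr_ge0.
  rewrite -EFinM lee_fin indicE.
  have [xO|xO] := boolP (x \in Om).
    have /andP[w0 wc] := w_bnd (x, t).
    by rewrite mulr1 lerXn2r ?nnegrE.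
  rewrite w_supp ?expr0n ?mulr0//=.
  by move: xO; rewrite notin_setE => xO [].
rewrite ge0_integralZl//; last by apply/measurable_EFinP; exact: measurable_indic.
rewrite integral_indic// setIT lte_mul_pinfty//.
by apply: (@lebesgue_measure_itv_lty _ _ 0 T); exact: subset_itv_oo_cc.
Qed.

Lemma measurable_prim : measurable_fun setT (fun p : V * R => prim (fun t => w (p.1, t)) p.2).
Proof.
pose k (q : (V * R) * R) : R := if q.2 <= q.1.2 then w (q.1.1, q.2) else 0.
have mk : measurable_fun setT (EFin \o k).
  apply/measurable_EFinP; apply: measurable_fun_ifT.
  - apply: measurable_fun_ler; first exact: measurable_snd.
    exact: (measurableT_comp measurable_snd measurable_fst).
  - have m1 : measurable_fun setT (fun q : (V * R) * R => (q.1.1, q.2)).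
      apply: measurable_fun_pair; last exact: measurable_snd.
      exact: (measurableT_comp measurable_fst measurable_fst).
    exact: (measurableT_comp mw m1).
  - exact: measurable_cst.
have k0 q : (0 <= (EFin \o k) q)%E.
  by rewrite lee_fin /k; case: ifP => // _; have /andP[] := w_bnd (q.1.1, q.2).
have := measurable_fun_fubini_tonelli_F (m2 := leb) _ mk k0.
move=> mF; have := measurableT_comp (fine_measurable measurableT) mF.
rewrite (_ : _ \o _ = (fun p : V * R => prim (fun t => w (p.1, t)) p.2))//.
apply/funext => p /=; rewrite /prim [RHS]Rintegral_mkcond /Rintegral /fubini_F; congr fine.
by apply: eq_integral => u _; rewrite /k/= patchE mem_setE in_itv.
Qed.

Variable h : R.
Hypothesis h0 : 0 < h.

(** These functions serve as test functions; they vanish at time T because w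
    vanishes from T on. *)
Definition tphi (p : V * R) : R := avg h (fun t => w (p.1, t)) p.2.

Lemma measurable_tphi : measurable_fun setT tphi.
Proof.
apply: measurable_funM; last exact: measurable_cst.
apply: measurable_funB; last exact: measurable_prim.
have m1 : measurable_fun setT (fun q : V * R => (q.1, q.2 + h)).
  apply: measurable_fun_pair; first exact: measurable_fst.
  by apply: measurable_funD => //; exact: measurable_snd.
exact: (measurableT_comp measurable_prim m1).
Qed.

Lemma tphi_ge0 p : 0 <= tphi p.
Proof.
rewrite /tphi /avg divr_ge0 ?(ltW h0)// subr_ge0 prim_le ?lerDl ?(ltW h0)//.
- exact: bdsupp_integrable (w_bdsupp _).
- by move=> u; have /andP[] := w_bnd (p.1, u).
Qed.

Lemma tphi_out x t : ~ Om x -> tphi (x, t) = 0.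
Proof.
move=> nO; rewrite /tphi /avg/=.
have -> : (fun u => w (x, u)) = cst 0.
  by apply/funext => u; rewrite w_supp// => -[].
by rewrite /prim /Rintegral !integral0 subrr mul0r.
Qed.

Lemma tphi_T x : tphi (x, T) = 0.
Proof.
rewrite /tphi /avg/= (prim_bdsupp_geT (w_bdsupp x)) ?subrr ?mul0r//.
by rewrite lerDl ltW.
Qed.

(** At the time - h the average vanishes, so Hoelder continuity in time turns into
    bounds at every time. *)
Lemma tphi_Nh x : tphi (x, - h) = 0.
Proof.
by rewrite /tphi /avg/= !(prim_bdsupp_le0 (w_bdsupp x)) ?subrr ?mul0r//; move: h0; lra.
Qed.

Lemma gq_prim p t : gq s (fun x => prim (fun u => w (x, u)) t) p = prim (gqt w p) t.
Proof.
have int x : leb.-integrable `]-oo, t] (EFin \o (fun u => w (x, u))).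
  apply: (integrableS measurableT) => //.
  exact: bdsupp_integrable (w_bdsupp _).
rewrite {1}/gq /prim -RintegralB// mulrC -RintegralZl//.
  by apply: eq_Rintegral => u _; rewrite /gqt /gq mulrC.
rewrite (_ : _ \o _ = (EFin \o (fun u => w (p.1, u))) \- (EFin \o (fun u => w (p.2, u))))%E//.
exact: integrableB.
Qed.

(** Averaging in time commutes with taking differences in space. *)
Lemma gq_tphi p t : gq s (at_time tphi t) p = avg h (gqt w p) t.
Proof. by rewrite /avg -!gq_prim /gq /at_time /tphi /avg/=; ring. Qed.

(** The space-time energy of w, without its constant. Time is the inner variable,
    so that one-variable results apply to each pair of points. *)
Definition Dgw := (\int[@mu2 R N]_p sqint leb (gqt w p))%E.

Lemma DgwE : Dgw = (\int[leb]_t sqint (@mu2 R N) (gq s (at_time w t)))%E.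
Proof.
have m2 : measurable_fun setT (fun q : (V * V) * R => (gqt w q.1 q.2 ^+ 2)%:E : \bar R).
  by apply: measurable_sqr; exact: measurable_gqt.
have f0 (q : (V * V) * R) : (0 <= (gqt w q.1 q.2 ^+ 2)%:E :> \bar R)%E by rewrite lee_fin sqr_ge0.
exact: (fubini_tonelli (m1 := @mu2 R N) (m2 := leb) _ m2 f0).
Qed.

Hypothesis Dgw_lty : (Dgw < +oo)%E.

Lemma sqint_avg_holder d (X : measurableType d) (m : {measure set X -> \bar R}) (g : X -> R -> R)
  t t' :
  (forall x, bdsupp T (g x)) ->
  measurable_fun setT (fun x => sqint leb (g x)) ->
  (sqint m (fun x => avg h (g x) t - avg h (g x) t')%R <=
   (4 / h ^+ 2 * `|t - t'|)%:E * \int[m]_x sqint leb (g x))%E.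
Proof.
move=> bg mg; rewrite -ge0_integralZl_EFin//; last 2 first.
- by move=> x _; exact: sqint_ge0.
- by rewrite mulr_ge0// divr_ge0// sqr_ge0.
apply: ge0_integral_mono => x _; first by rewrite lee_fin sqr_ge0.
have fx := bdsupp_sqint (bg x).
rewrite -[sqint _ _]fineK ?ge0_fin_numE ?sqint_ge0// -EFinM lee_fin.
by apply: avg_holder => //; exact: bdsupp_integrable (bg x).
Qed.

Lemma tphi_holder_L2 t t' : (sqint mu (fun x => tphi (x, t) - tphi (x, t'))%R <=
  (4 / h ^+ 2 * `|t - t'|)%:E * D2w)%E.
Proof.
apply: (@sqint_avg_holder _ _ mu (fun x t => w (x, t))); first exact: w_bdsupp.
have m2 : measurable_fun setT (fun q : V * R => (w q ^+ 2)%:E : \bar R).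
  exact: measurable_sqr.
apply: (measurable_fun_fubini_tonelli_F (m2 := leb) _ m2).
by move=> q; rewrite lee_fin sqr_ge0.
Qed.

Lemma tphi_holder_gq t t' :
  (sqint (@mu2 R N) (gq s (at_time tphi t - at_time tphi t')%R) <=
  (4 / h ^+ 2 * `|t - t'|)%:E * Dgw)%E.
Proof.
rewrite (_ : gq s _ = (fun p => avg h (gqt w p) t - avg h (gqt w p) t')); last first.
  by apply/funext => p; rewrite -!gq_tphi -gqB.
apply: sqint_avg_holder; first exact: gqt_bdsupp.
have m2 : measurable_fun setT (fun q : (V * V) * R => (gqt w q.1 q.2 ^+ 2)%:E : \bar R).
  by apply: measurable_sqr; exact: measurable_gqt.
apply: (measurable_fun_fubini_tonelli_F (m2 := leb) _ m2).
by move=> q; rewrite lee_fin sqr_ge0.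
Qed.

Lemma at_time_tphi_Nh : at_time tphi (- h) = 0.
Proof. by apply/funext => x; exact: tphi_Nh. Qed.

Lemma sqint_tphi t : (sqint mu (at_time tphi t) < +oo)%E.
Proof.
have := tphi_holder_L2 t (- h).
rewrite (_ : (fun x => _) = at_time tphi t); last first.
  by apply/funext => x; rewrite tphi_Nh subr0.
move=> /le_lt_trans; apply; apply: lte_mul_pinfty; rewrite ?D2w_lty//.
by rewrite lee_fin mulr_ge0// divr_ge0// sqr_ge0.
Qed.

Lemma sqint_gq_tphi t : (sqint (@mu2 R N) (gq s (at_time tphi t)) < +oo)%E.
Proof.
have := tphi_holder_gq t (- h); rewrite at_time_tphi_Nh subr0.
move=> /le_lt_trans; apply; apply: lte_mul_pinfty; rewrite ?Dgw_lty//.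
by rewrite lee_fin mulr_ge0// divr_ge0// sqr_ge0.
Qed.

Lemma tphi_Hs0 t : Hs0 s Om (at_time tphi t).
Proof.
split.
  apply/HsP; split; [exact: measurable_at_time measurable_tphi|exact: sqint_tphi|].
  exact: sqint_gq_tphi.
by apply: aeW => x; exact: tphi_out.
Qed.

Lemma tphi_holder : exists2 k : R, 0 <= k & forall t t',
  Hs0_norm s (at_time tphi t - at_time tphi t') <= k * Num.sqrt `|t - t'|.
Proof.
have C0 := C_Ns_gt0 N hs; set C := C_Ns s in C0.
pose k := C / 2 * (4 / h ^+ 2 * fine Dgw).
have D0 : (0 <= Dgw)%E by apply: integral_ge0 => p _; exact: sqint_ge0.
have k0 : 0 <= k.
  apply: mulr_ge0; first by rewrite divr_ge0// ltW.
  by apply: mulr_ge0; [rewrite divr_ge0// sqr_ge0|exact: fine_ge0].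
exists (Num.sqrt k); first exact: sqrtr_ge0.
move=> t t'; rewrite -sqrtrM// ler_wsqrtr// Fform_sq// -/C /k -[leRHS]mulrA.
apply: ler_wpM2l; first by rewrite divr_ge0// ltW.
have := tphi_holder_gq t t'.
have dfin : Dgw \is a fin_num by rewrite ge0_fin_numE.
rewrite -[Dgw]fineK// -EFinM => Hle.
have sfin : sqint (@mu2 R N) (gq s (at_time tphi t - at_time tphi t')) \is a fin_num.
  by rewrite ge0_fin_numE ?sqint_ge0// (le_lt_trans Hle)// ltry.
rewrite -[sqint _ _]fineK// lee_fin mulrAC in Hle.
exact: Hle.
Qed.

Lemma tphi_L2_Hs0 : L2_Hs0 s Om T tphi.
Proof.
split; first by apply: (measurable_funS measurableT) => //; exact: measurable_tphi.
have [k k0 Hk] := tphi_holder.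
split; first by apply: aeW => t _; exact: tphi_Hs0.
  apply: (@strongly_measurable_holder _ _ _ _ T k); first exact: tphi_Hs0.
    by move=> v; rewrite lee_fin sqrtr_ge0.
  by move=> t t'; rewrite lee_fin Hk.
apply: (@le_lt_trans _ _ (\int[leb]_(t in `]0%R, T[) ((k * Num.sqrt (T + h)) ^+ 2)%:E)%E).
  apply: ge0_integral_mono => t tI; first exact: sqre_ge0.
  have /andP[t0 tT] : 0 < t < T by move: tI; rewrite /= in_itv.
  rewrite [X in (X ^+ 2)%E]/= -EFin_expe lee_fin lerXn2r ?nnegrE ?sqrtr_ge0//.
    by rewrite mulr_ge0// sqrtr_ge0.
  have := Hk t (- h); rewrite at_time_tphi_Nh subr0 => /le_trans; apply.
  rewrite ler_wpM2l// ler_wsqrtr// opprK ger0_norm ?lerD2r ?(ltW tT)//.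
  by rewrite addr_ge0// ltW.
rewrite integral_cst//= lte_mul_pinfty ?lee_fin ?sqr_ge0//.
by apply: (@lebesgue_measure_itv_lty _ _ 0 T); exact: subset_itv_oo_cc.
Qed.

Lemma tphi_continuous_rep : L2_continuous_rep Om T tphi (at_time tphi).
Proof.
split; last by apply: aeW => t _; apply: aeW.
move=> t t0T; split.
  apply/Lfun2P; split.
    apply: (iffLR (measurable_restrictT _ mOm)); apply: (measurable_funS measurableT) => //.
    exact: measurable_at_time measurable_tphi.
  by apply: le_lt_trans (sqint_tphi t); exact: sqint_restrict_le.
have D0 : (0 <= D2w)%E by apply: integral_ge0 => p _; exact: sqint_ge0.
have dfin : D2w \is a fin_num by rewrite ge0_fin_numE ?D2w_lty.
pose k := Num.sqrt (4 / h ^+ 2 * fine D2w).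
have bnd u : (norm_L2 Om (at_time tphi u - at_time tphi t)%R <= (k * Num.sqrt `|u - t|)%:E)%E.
  have k0 : 0 <= 4 / h ^+ 2 * fine D2w by rewrite mulr_ge0 ?divr_ge0 ?sqr_ge0 ?fine_ge0.
  rewrite /norm_L2 Lnorm2E.
  have le : (sqint mu ((at_time tphi u - at_time tphi t) \_ Om)%R <=
      (4 / h ^+ 2 * fine D2w * `|u - t|)%:E)%E.
    apply: le_trans (sqint_restrict_le _ _) _.
    have := tphi_holder_L2 u t; rewrite -[D2w]fineK// -EFinM => /le_trans; apply.
    by rewrite lee_fin mulrAC.
  move: le; have := sqint_ge0 mu ((at_time tphi u - at_time tphi t) \_ Om).
  case: (sqint _ _) => [q||]//= q0; rewrite !lee_fin in q0 * => le.
  by rewrite /k -sqrtrM// ler_wsqrtr.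
apply: (@squeeze_cvge _ _ _ _ (cst 0%E) _ (fun u => (k * Num.sqrt `|u - t|)%:E)).
- by apply: nearW => u; rewrite bnd andbT; exact: Lnorm_ge0.
- exact: cvg_cst.
rewrite -[0%E]/((0 : R)%:E); apply: cvg_EFin; first exact: nearW.
have H : (fun u : R => k * Num.sqrt `|u - t|) @ t --> (0 : R).
  have -> : (0 : R) = k * Num.sqrt `|t - t| by rewrite subrr normr0 sqrtr0 mulr0.
  apply: cvgMr.
  apply: (@continuous_cvg _ _ _ _ _ _ Num.sqrt); first exact: sqrt_continuous.
  by apply: cvg_norm; apply: cvgB; [exact: cvg_id|exact: cvg_cst].
apply: cvg_trans H; apply: cvg_app; exact: cvg_within.
Qed.

End test_function_space.

(** * The time derivative of a Steklov average *)
Section test_function_derivative.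
Context (R : realType) (N : nat) (s : R).
Hypothesis hs : 0 < s < 1.
Hypothesis hN : (1 <= N)%N.
Local Notation V := 'rV[R]_N.
Local Notation mu := (lebesgue_rV R N).
Local Notation leb := (@lebesgue_measure R).
Variable Om : set V.
Hypothesis Om_bounded : bounded_set Om.
Hypothesis mOm : measurable Om.
Let Omfin : (mu Om < +oo)%E := bounded_measure_lty Om_bounded mOm.
Variables (T c : R) (w : V * R -> R).
Hypothesis T0 : 0 < T.
Hypothesis mw : measurable_fun setT w.
Hypothesis w_bnd : forall p, 0 <= w p <= c.
Hypothesis w_supp : forall p, ~ (Om p.1 /\ 0 < p.2 < T) -> w p = 0.
Variable h : R.
Hypothesis h0 : 0 < h.
Let c0 : 0 <= c. Proof. by have /andP[] := w_bnd (0, 0); exact: le_trans. Qed.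

Definition dq (z : V * R -> R) (t : R) (x : V) : R := (z (x, t + h) - z (x, t)) / h.

(** The time derivative of [tphi] is a difference quotient of w, an L^2 function
    viewed as a functional. *)
Definition dtphi (t : R) : (V -> R) -> R := inner_L2 Om (dq w t).

Lemma measurable_dq t : measurable_fun setT (dq w t).
Proof.
apply: measurable_funM => //; apply: measurable_funB.
  exact: (measurableT_comp mw (pair2_measurable (t + h))).
exact: (measurableT_comp mw (pair2_measurable t)).
Qed.

Lemma sqint_dq t : (sqint mu (dq w t) <= ((c / h) ^+ 2 * fine (mu Om))%:E)%E.
Proof.
have IE : mu Om \is a fin_num by rewrite ge0_fin_numE.
apply: (@le_trans _ _ (\int[mu]_x (((c / h) ^+ 2)%:E * (\1_Om x)%:E))%E); last first.
  rewrite ge0_integralZl_EFin ?sqr_ge0//; last by apply/measurable_EFinP; exact: measurable_indic.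
  by rewrite integral_indic// setIT [leRHS]EFinM fineK.
apply: ge0_integral_mono => x _; first by rewrite lee_fin sqr_ge0.
rewrite -EFinM lee_fin indicE /dq.
have [xO|xO] := boolP (x \in Om); last first.
  rewrite mulr0 !w_supp ?subrr ?mul0r ?expr0n//.
    by move: xO; rewrite notin_setE => xO [].
  by move: xO; rewrite notin_setE => xO [].
rewrite mulr1 !exprMn ler_wpM2r ?sqr_ge0//.
rewrite -[leLHS]real_normK ?num_real// lerXn2r ?nnegrE//.
have /andP[a1 a2] := w_bnd (x, t); have /andP[a3 a4] := w_bnd (x, t + h).
by rewrite ler_norml; apply/andP; split; lra.
Qed.

Lemma sqint_dq_lty t : (sqint mu (dq w t) < +oo)%E.
Proof. by apply: le_lt_trans (sqint_dq t) _; rewrite ltry. Qed.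

Hypothesis Dgw_lty : (Dgw s w < +oo)%E.

Lemma Hs0_0 : Hs0 s Om (0 : V -> R).
Proof.
have := tphi_Hs0 mOm Omfin mw w_bnd w_supp h0 Dgw_lty (- h).
by rewrite (at_time_tphi_Nh mw w_bnd w_supp h0).
Qed.

Lemma dual_norm_ge0 (l : (V -> R) -> R) : (0 <= dual_norm s Om l)%E.
Proof.
apply: (@le_trans _ _ `|l 0|%:E); first by rewrite lee_fin.
apply: ereal_sup_ubound; exists 0 => //; split; first exact: Hs0_0.
rewrite /Hs0_norm Fform_sq//.
have -> : sqint (@mu2 R N) (gq s 0) = 0%E.
  by apply: integral0_eq => p _; rewrite /gq subrr mul0r expr0n.
by rewrite mulr0 sqrtr0.
Qed.

Variable k_ : nat -> R -> V -> R.
Hypothesis simple_k : forall n, simple_map (k_ n).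
Hypothesis k_L2 : forall n t, measurable_fun setT (k_ n t) /\ (sqint mu (k_ n t) < +oo)%E.
Hypothesis k_cvg : {ae leb, forall t,
  fine (sqint mu (fun x => k_ n t x - w (x, t))) @[n --> \oo] --> (0 : R)}.

(** Simple approximations k_ of w in L^2 give simple approximations of its
    difference quotients in L^2, hence in the dual space. *)
Lemma dtphi_L2_dual : L2_dual s Om T dtphi.
Proof.
have [K K0 HK] := inner_L2_dual hs hN Om_bounded mOm.
split.
- apply: aeW => t _.
  by have [] := HK _ (measurable_dq t) (sqint_dq_lty t).
- pose kq n (q : (V -> R) * (V -> R)) : V -> R := fun x => (q.1 x - q.2 x) / h.
  pose kk n t : V -> R := fun x => (k_ n (t + h) x - k_ n t x) / h.
  have kk_L2 n t : measurable_fun setT (kk n t) /\ (sqint mu (kk n t) < +oo)%E.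
    have [m1 f1] := k_L2 n (t + h); have [m2 f2] := k_L2 n t.
    split.
      by apply: measurable_funM => //; exact: measurable_funB.
    apply: le_lt_trans (sqint_quot _ _ m1 m2) _.
    by rewrite lte_mul_pinfty ?lee_fin ?divr_ge0 ?sqr_ge0// lte_add_pinfty.
  exists (fun n t => inner_L2 Om (kk n t)); split.
    move=> n; have sp := simple_map_pair (simple_map_shift h (simple_k n)) (simple_k n).
    have [f1 f2] := simple_map_comp (fun q : (V -> R) * (V -> R) =>
      inner_L2 Om (fun x => (q.1 x - q.2 x) / h)) sp.
    split => //.
    by move=> _ [t _ <-]; have [m1 m2] := kk_L2 n t; have [] := HK _ m1 m2.
  have := ae_shift h k_cvg; have := k_cvg.
  apply: filterS2; first exact: (ae_filter_ringOfSetsType leb).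
  move=> t c1 c2 _.
  pose e n u := fine (sqint mu (fun x => k_ n u x - w (x, u))).
  have bnd n : (dual_norm s Om (inner_L2 Om (kk n t) - dtphi t)%R <=
      (K * Num.sqrt (2 / h ^+ 2 * (e n (t + h) + e n t)))%:E)%E.
    have [m1 f1] := kk_L2 n t.
    have [_ _ /(_ _ (measurable_dq t) (sqint_dq_lty t))] := HK _ m1 f1.
    move=> /le_trans; apply; rewrite lee_fin ler_wpM2l ?(ltW K0)// ler_wsqrtr//.
    have mkw u : measurable_fun setT (fun x => k_ n u x - w (x, u)) /\
        (sqint mu (fun x => k_ n u x - w (x, u))%R < +oo)%E.
      have [mk fk] := k_L2 n u.
      have mwu : measurable_fun setT (fun x => w (x, u))
        by exact: (measurableT_comp mw (pair2_measurable u)).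
      split; first exact: measurable_funB.
      have := sqint_quot mu 1 mk mwu.
      under [sqint _ _]eq_integral do rewrite divr1.
      move=> /le_lt_trans; apply.
      rewrite lte_mul_pinfty ?lee_fin ?divr_ge0 ?sqr_ge0// lte_add_pinfty//.
      exact: (sqint_w_lty mOm Omfin w_bnd w_supp u).
    have [ma fa] := mkw (t + h); have [mb fb] := mkw t.
    have := sqint_quot mu h ma mb.
    rewrite -[sqint mu (fun x => k_ n (t + h) x - _)]fineK ?ge0_fin_numE ?sqint_ge0//.
    rewrite -[sqint mu (fun x => k_ n t x - _)]fineK ?ge0_fin_numE ?sqint_ge0//.
    rewrite -EFinD -EFinM => Hle.
    have E : sqint mu (fun x => kk n t x - dq w t x) =
      sqint mu (fun x => (k_ n (t + h) x - w (x, t + h) - (k_ n t x - w (x, t))) / h).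
      by apply: eq_integral => x _; congr ((_ ^+ 2)%:E); rewrite /kk /dq; ring.
    rewrite E -lee_fin fineK//.
    by rewrite ge0_fin_numE ?sqint_ge0// (le_lt_trans Hle)// ltry.
  have H : (fun n => K * Num.sqrt (2 / h ^+ 2 * (e n (t + h) + e n t))) @ \oo --> (0 : R).
    have -> : (0 : R) = K * Num.sqrt (2 / h ^+ 2 * (0 + 0)) by rewrite addr0 mulr0 sqrtr0 mulr0.
    apply: cvgMr.
    apply: (@continuous_cvg _ _ _ _ _ _ Num.sqrt); first exact: sqrt_continuous.
    by apply: cvgMr; apply: cvgD; [exact: c2|exact: c1].
  apply: (@squeeze_cvge _ _ _ _ (cst 0%E) _ (fun n =>
    (K * Num.sqrt (2 / h ^+ 2 * (e n (t + h) + e n t)))%:E)).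
  + by apply: nearW => n; rewrite bnd andbT; exact: dual_norm_ge0.
  + exact: cvg_cst.
  + by rewrite -[0%E]/((0 : R)%:E); apply: cvg_EFin; [exact: nearW|exact: H].
- pose B := (c / h) ^+ 2 * fine (mu Om).
  apply: (@le_lt_trans _ _ (\int[leb]_(t in `]0%R, T[) ((K * Num.sqrt B) ^+ 2)%:E)%E).
    apply: ge0_integral_mono => t _; first exact: sqre_ge0.
    have [_ Hle _] := HK _ (measurable_dq t) (sqint_dq_lty t).
    have Hle2 : (dual_norm s Om (dtphi t) <= (K * Num.sqrt B)%:E)%E.
      apply: le_trans Hle _; rewrite lee_fin ler_wpM2l ?(ltW K0)// ler_wsqrtr//.
      rewrite -lee_fin fineK; first exact: sqint_dq.
      by rewrite ge0_fin_numE ?sqint_ge0// sqint_dq_lty.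
    move: Hle2 (dual_norm_ge0 (dtphi t)); case: (dual_norm _ _ _) => [q||]//.
    rewrite !lee_fin => q1 q0.
    by rewrite -expr2 lerXn2r ?nnegrE// (le_trans q0).
  rewrite integral_cst//= lte_mul_pinfty ?lee_fin ?sqr_ge0//.
  by apply: (@lebesgue_measure_itv_lty _ _ 0 T); exact: subset_itv_oo_cc.
Qed.

Lemma inner_L2_setT (k v : V -> R) : (forall x, ~ Om x -> k x = 0) ->
  inner_L2 Om k v = \int[mu]_x (k x * v x).
Proof.
move=> kO; rewrite /inner_L2 [LHS]Rintegral_mkcond; apply: eq_Rintegral => x _.
by rewrite patchE; case: ifPn => //; rewrite notin_setE => /kO ->; rewrite mul0r.
Qed.

(** Paired with v, the average of w becomes the one-variable average of the inner
    product of w and v, which reduces the claim to [avg_test]. *)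
Lemma tphi_time_derivative : is_time_derivative s Om T (tphi w h) dtphi.
Proof.
move=> eta v Heta Hv; have [mv vf] := Hs0_L2 Hv.
pose F (p : V * R) : R := w p * v p.1.
have D2 := D2w_lty mOm Omfin mw w_bnd w_supp.
(* F is the product of the square integrable functions w and v1. *)
pose v1 (p : V * R) : R := v p.1 * \1_(`]0, T[%classic : set R) p.2.
have mvp : measurable_fun setT (fun p : V * R => v p.1)
  by exact: (measurableT_comp mv measurable_fst).
have m1p : measurable_fun setT (fun p : V * R => \1_(`]0, T[%classic : set R) p.2 : R).
  by apply: measurableT_comp; [exact: measurable_indic|exact: measurable_snd].
have mv1 : measurable_fun setT v1 by exact: measurable_funM.
have w2 : (sqint (mu \x leb)%E w < +oo)%E.
  by have := D2; rewrite /D2w -(sqint_prod1 mu mw).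
have v2 : (sqint (mu \x leb)%E v1 < +oo)%E.
  rewrite (sqint_prod1 mu mv1).
  have lT : leb `]0, T[%classic = T%:E.
    by rewrite lebesgue_measure_itv/= lte_fin T0 sube0.
  rewrite (_ : (\int[mu]_x _)%E = (\int[mu]_x (T%:E * (v x ^+ 2)%:E))%E); last first.
    apply: eq_integral => x _; rewrite /sqint.
    transitivity (\int[leb]_t ((v x ^+ 2)%:E * (\1_(`]0%R, T[%classic) t)%:E))%E.
      apply: eq_integral => t _; rewrite /v1/= -EFinM exprMn; congr (_ * _)%:E.
      by rewrite indicE; case: (_ \in _); rewrite ?expr1n ?expr0n.
    rewrite ge0_integralZl_EFin ?sqr_ge0//; last by apply/measurable_EFinP; exact: measurable_indic.
    by rewrite integral_indic// setIT muleC; congr (_ * _)%E.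
  rewrite ge0_integralZl_EFin ?(ltW T0)//; last 2 first.
    by move=> x _; rewrite lee_fin sqr_ge0.
    exact: measurable_sqr.
  by rewrite lte_mul_pinfty// lee_fin ltW.
have iF : (mu \x leb)%E.-integrable setT (EFin \o F).
  have [i1 _] := cauchy_schwarz (m := (mu \x leb)%E) mw mv1 w2 v2.
  rewrite (_ : _ \o _ = (fun p => (w p * v1 p)%:E))//.
  apply/funext => -[x t] /=; rewrite /F /v1/= indicE mem_setE in_itv/=.
  have [tT|tT] := boolP (0 < t < T); first by rewrite mulr1.
  by rewrite mulr0 w_supp ?mul0r// => -[_ /=]; exact/negP.
pose gv t := inner_L2 Om (at_time w t) v.
have wO t x : ~ Om x -> at_time w t x = 0 by move=> nO; apply: w_supp => -[].
have iwv t : mu.-integrable setT (fun x => (at_time w t x * v x)%:E).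
  have mwt : measurable_fun setT (at_time w t) by exact: measurable_at_time.
  by have [] := cauchy_schwarz mwt mv (sqint_w_lty mOm Omfin w_bnd w_supp t) vf.
have gvE t : (gv t)%:E = fubini_G mu (EFin \o F) t.
  rewrite /gv inner_L2_setT; last exact: wO.
  by rewrite /Rintegral fineK//; apply: integrable_fin_num => //; exact: iwv.
have igv : leb.-integrable setT (EFin \o gv).
  rewrite (_ : _ \o _ = fubini_G mu (EFin \o F)); last by apply/funext.
  exact: integrable_fubini_G.
have prim_gv t : \int[mu]_x (prim (fun u => w (x, u)) t * v x) = prim gv t.
  pose Ft := (EFin \o F) \_ ([set: V] `*` `]-oo, t]%classic).
  have mD : measurable ([set: V] `*` (`]-oo, t]%classic : set (measurableTypeR R))).
    by apply: measurableX => //; exact: measurable_itv.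
  have iFt : (mu \x leb)%E.-integrable setT Ft.
    apply: (iffLR (integrable_mkcond _ mD)).
    by apply: (integrableS measurableT).
  have FtE x u : Ft (x, u) = ((EFin \o (fun u => F (x, u))) \_ `]-oo, t]) u.
    rewrite /Ft !patchE; congr (if _ then _ else _).
    by apply/idP/idP; rewrite !inE => // -[].
  have := Fubini iFt.
  have -> : (\int[mu]_x \int[leb]_u Ft (x, u) = \int[mu]_x (prim (fun u => w (x, u)) t * v x)%:E)%E.
    apply: eq_integral => x _; under eq_integral do rewrite FtE.
    rewrite -integral_mkcond.
    have ix : leb.-integrable `]-oo, t] (EFin \o (fun u => w (x, u))).
      apply: (integrableS measurableT) => //.
      exact: bdsupp_integrable (w_bdsupp mw w_bnd w_supp x).
    rewrite (_ : (\int[leb]_(u in _) _)%E = (\int[leb]_(u in `]-oo, t])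
      ((w (x, u))%:E * (v x)%:E))%E)//.
    rewrite integralZr// EFinM; congr (_ * _)%E; rewrite /prim /Rintegral fineK//.
    exact: integrable_fin_num.
  have -> : (\int[leb]_u \int[mu]_x Ft (x, u) = \int[leb]_(u in `]-oo, t]) (gv u)%:E)%E.
    rewrite [RHS]integral_mkcond; apply: eq_integral => u _.
    under eq_integral do rewrite FtE.
    rewrite patchE mem_setE in_itv/=.
    case: ifP => ut.
      rewrite gvE /fubini_G; apply: eq_integral => x _.
      by rewrite patchE mem_setE in_itv/= ut.
    rewrite integral0_eq// => x _.
    by rewrite patchE mem_setE in_itv/= ut.
  by move=> E; rewrite /Rintegral E.
(* The primitive at t is h' times the average over a window that starts before 0. *)
have int_prim t : mu.-integrable setT (fun x => (prim (fun u => w (x, u)) t * v x)%:E).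
  pose h' := `|t| + 1.
  have h'0 : 0 < h' by rewrite ltr_wpDl.
  have mt : measurable_fun setT (at_time (tphi w h') (t - h')).
    by apply: measurable_at_time; exact: measurable_tphi mw w_bnd _.
  have [i1 _] := cauchy_schwarz mt mv (sqint_tphi mOm Omfin mw w_bnd w_supp h'0 (t - h')) vf.
  have -> : (fun x => (prim (fun u => w (x, u)) t * v x)%:E) =
      (fun x => h'%:E * (at_time (tphi w h') (t - h') x * v x)%:E)%E.
    apply/funext => x; rewrite -EFinM mulrA; congr (_ * _)%:E.
    rewrite /at_time /tphi /avg/= subrK (prim_bdsupp_le0 (t := t - h')
      (w_bdsupp mw w_bnd w_supp x)).
      by rewrite subr0 mulrC divfK// gt_eqF.
    by rewrite subr_le0 /h' (le_trans (ler_norm t))// lerDl.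
  exact: integrableZl.
have phiE t : inner_L2 Om (at_time (tphi w h) t) v = avg h gv t.
  rewrite inner_L2_setT; last by move=> x nO; exact: (tphi_out w_supp).
  rewrite /avg -!prim_gv -RintegralB; [|by []|exact: int_prim|exact: int_prim].
  rewrite mulrC -RintegralZl//; last first.
    exact: (integrableB _ (int_prim (t + h)) (int_prim t)).
  by apply: eq_Rintegral => x _; rewrite /tphi /at_time /avg/=; ring.
have dphiE t : dtphi t v = (gv (t + h) - gv t) / h.
  have dO x : ~ Om x -> dq w t x = 0.
    by move=> nO; rewrite /dq !w_supp ?subrr ?mul0r// => -[].
  rewrite /dtphi (inner_L2_setT _ dO) /gv (inner_L2_setT _ (wO (t + h))) (inner_L2_setT _ (wO t)).
  rewrite -RintegralB; [|by []|exact: iwv|exact: iwv].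
  rewrite mulrC -RintegralZl//; last first.
    exact: (integrableB _ (iwv (t + h)) (iwv t)).
  by apply: eq_Rintegral => x _; rewrite /dq /at_time; ring.
under eq_Rintegral do rewrite phiE.
rewrite (avg_test h Heta igv); congr (- _).
by under [RHS]eq_Rintegral do rewrite dphiE.
Qed.

Lemma tphi_HQ : HQ s Om T (tphi w h) dtphi (at_time (tphi w h)).
Proof.
split.
- split.
  + exact: (tphi_L2_Hs0 hs mOm Omfin mw w_bnd w_supp h0 Dgw_lty).
  + exact: dtphi_L2_dual.
  + exact: tphi_time_derivative.
- exact: (tphi_continuous_rep mOm Omfin mw w_bnd w_supp h0).
- by apply: aeW => x _; exact: (tphi_T mw w_bnd w_supp h0).
Qed.

End test_function_derivative.

(** * Truncation above a level *)
Section truncation.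
Context (R : realType) (M : R).
Hypothesis M0 : 0 <= M.

(** The cap at 1 makes the test function bounded. *)
Definition beta (a : R) : R := Num.min (Num.max (a - M) 0) 1.

(** The primitive of beta, written as c (a - M) - c^2 / 2 at c = beta a, where this
    expression is largest among c in [0, 1]: a maximum of affine functions of a. *)
Definition Beta (a : R) : R := beta a * (a - M) - beta a ^+ 2 / 2.

Lemma betaP a : [\/ a - M <= 0 /\ beta a = 0, 0 <= a - M <= 1 /\ beta a = a - M |
  1 <= a - M /\ beta a = 1].
Proof.
rewrite /beta; have [aM|aM] := leP (a - M) 0.
  by constructor 1; split => //; rewrite min_l.
have [a1|a1] := leP (a - M) 1; first by constructor 2; rewrite ltW.
by constructor 3; rewrite ltW.
Qed.

Lemma beta_ge0 a : 0 <= beta a.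
Proof. by case: (betaP a) => -[h ->] //; case/andP: h. Qed.

Lemma beta_le1 a : beta a <= 1.
Proof. by case: (betaP a) => -[h ->] //; case/andP: h. Qed.

Lemma beta_lipschitz a b : `|beta a - beta b| <= `|a - b|.
Proof.
wlog ab : a b / b <= a.
  move=> W; have [|] := leP b a; first exact: W.
  by move=> /ltW/W; rewrite distrC [leRHS]distrC.
rewrite [leRHS]ger0_norm ?subr_ge0// ler_norml.
case: (betaP a) => -[h1 ->]; case: (betaP b) => -[h2 ->]; move: h1 h2 => /=;
  try (move=> /andP[? ?]); try (move=> ? /andP[? ?]); move=> *; apply/andP; split; lra.
Qed.

Lemma beta0 : beta 0 = 0.
Proof. by rewrite /beta sub0r max_r ?oppr_le0// min_l. Qed.

Lemma beta_le_norm a : `|beta a| <= `|a|.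
Proof. by have := beta_lipschitz a 0; rewrite beta0 !subr0. Qed.

Lemma Beta_ge0 a : 0 <= Beta a.
Proof. by rewrite /Beta; case: (betaP a) => -[h ->]; rewrite ?expr2; move: h => /=;
  try (case/andP => ? ?); nra. Qed.

(** The subgradient inequality: c = beta a is a competitor in the maximum that
    defines Beta b. *)
Lemma Beta_convex a b : Beta a - Beta b <= beta a * (a - b).
Proof.
have : beta a * (b - M) - beta a ^+ 2 / 2 <= Beta b.
  have := beta_ge0 a; have := beta_le1 a; rewrite /Beta.
  move: (beta a) => p p1 p0.
  case: (betaP b) => -[h ->]; move: h; set B := b - M => h; rewrite !expr2.
  - have : p * B <= 0 by rewrite mulr_ge0_le0.
    have : 0 <= p * p by rewrite mulr_ge0.
    by move=> *; lra.
  - have : 0 <= (B - p) * (B - p) by rewrite -expr2 sqr_ge0.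
    by move=> *; lra.
  - have : 0 <= (1 - p) * (B - 1) by rewrite mulr_ge0 ?subr_ge0.
    have : 0 <= (1 - p) * (1 - p) by rewrite -expr2 sqr_ge0.
    by move=> *; lra.
have -> : beta a * (a - b) = beta a * (a - M) - beta a * (b - M) by ring.
by rewrite {2}/Beta; lra.
Qed.

Lemma Beta0 : Beta 0 = 0.
Proof. by rewrite /Beta beta0 mul0r expr0n/= mul0r subr0. Qed.

Lemma Beta_le a : Beta a <= beta a * (a - M).
Proof. by rewrite /Beta gerBl// divr_ge0// sqr_ge0. Qed.

Lemma Beta_le_norm a : Beta a <= `|a|.
Proof.
apply: le_trans (Beta_le a) _.
case: (betaP a) => -[h ->]; first by rewrite mul0r.
  case/andP: h => h1 h2; apply: (@le_trans _ _ (a - M)); first by rewrite -[leRHS]mul1r ler_wpM2r.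
  by rewrite (le_trans _ (ler_norm a))// gerBl.
by rewrite mul1r (le_trans _ (ler_norm a))// gerBl.
Qed.

Lemma Beta_eq0 a : Beta a = 0 -> a <= M.
Proof.
rewrite /Beta; case: (betaP a) => -[h ->]; rewrite ?expr2 => e.
- by rewrite -subr_le0.
- case/andP: h => h1 h2; have : (a - M) * (a - M) = 0 by lra.
  by move=> /eqP; rewrite mulf_eq0 orbb subr_eq0 => /eqP ->.
- by move: h e => *; lra.
Qed.

Lemma beta_mono a b : 0 <= (a - b) * (beta a - beta b).
Proof.
wlog ab : a b / b <= a.
  move=> W; have [|] := leP b a; first exact: W.
  by move=> /ltW/W; rewrite -[a - b]opprB -[beta a - beta b]opprB mulrNN.
rewrite mulr_ge0 ?subr_ge0//.
case: (betaP a) => -[h1 ->]; case: (betaP b) => -[h2 ->]; move: h1 h2 => /=;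
  try (move=> /andP[? ?]); try (move=> ? /andP[? ?]); move=> *; lra.
Qed.

Lemma measurable_beta : measurable_fun setT beta.
Proof.
apply: measurable_minr; last exact: measurable_cst.
apply: measurable_maxr; last exact: measurable_cst.
by apply: measurable_funB.
Qed.

End truncation.

(** * The solution extended by zero *)
Section extraction.
Context (R : realType) (N : nat) (s : R).
Hypothesis hs : 0 < s < 1.
Hypothesis hN : (1 <= N)%N.
Local Notation V := 'rV[R]_N.
Local Notation mu := (lebesgue_rV R N).
Local Notation leb := (@lebesgue_measure R).
Variable Om : set V.
Hypothesis Om_bounded : bounded_set Om.
Hypothesis mOm : measurable Om.
Variable T : R.

Lemma ae_mu2 (A : V -> Prop) : {ae mu, forall x, A x} ->
  {ae @mu2 R N, forall p, A p.1 /\ A p.2}.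
Proof.
move=> [Z [mZ Z0 HZ]].
exists ((Z `*` setT) `|` (setT `*` Z)); split.
- by apply: measurableU; exact: measurableX.
- apply/eqP; rewrite -measure_le0; apply: le_trans (measureU2 _ _ _) _; try exact: measurableX.
  have E1 : @mu2 R N (Z `*` setT) = 0%E.
    rewrite /mu2 product_measure1E//.
    by rewrite [X in (X * _)%E](_ : _ = 0%E) ?mul0e//; exact: Z0.
  have E2 : @mu2 R N (setT `*` Z) = 0%E.
    rewrite /mu2 product_measure1E//.
    by rewrite [X in (_ * X)%E](_ : _ = 0%E) ?mule0//; exact: Z0.
  by rewrite [X in (X + _)%E](_ : _ = 0%E)// [X in (_ + X)%E](_ : _ = 0%E)// adde0.
- move=> p /= nA; apply: contrapT => nZ; apply: nA; split; apply: contrapT => nA; apply: nZ.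
    by left; split => //; exact: HZ.
  by right; split => //; exact: HZ.
Qed.

Lemma gq_ae (v v' : V -> R) : {ae mu, forall x, v x = v' x} ->
  {ae @mu2 R N, forall p, gq s v p = gq s v' p}.
Proof.
move=> /ae_mu2; apply: filterS => p [e1 e2].
by rewrite /gq e1 e2.
Qed.

Lemma Fform_ae (v v' k : V -> R) : measurable_fun setT v -> measurable_fun setT v' ->
  measurable_fun setT k -> {ae mu, forall x, v x = v' x} -> Fform s v k = Fform s v' k.
Proof.
move=> mv mv' mk vv; rewrite !Fform_gq//; congr (_ * _); rewrite /Rintegral; congr fine.
apply: ae_eq_integral => //.
- by apply/measurable_EFinP; apply: measurable_funM; exact: measurable_gq.
- by apply/measurable_EFinP; apply: measurable_funM; exact: measurable_gq.
- by apply: filterS (gq_ae vv) => p -> _.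
Qed.

Variable rho : V * R -> R.
Hypothesis Hrho : L2_Hs0 s Om T rho.

(** Unlike rho, its extension by zero is jointly measurable on the whole of
    space-time and vanishes at every point off the cylinder. *)
Definition cut : V * R -> R := rho \_ (cylinder Om T).

Lemma measurable_cylinder : measurable (cylinder Om T : set (V * measurableTypeR R)).
Proof. by apply: measurableX => //; exact: measurable_itv. Qed.

Lemma measurable_cut : measurable_fun setT cut.
Proof.
apply: (iffLR (measurable_restrictT _ measurable_cylinder)).
case: Hrho => mrho _; apply: (measurable_funS _ _ mrho).
  by apply: measurableX => //; exact: measurable_itv.
by move=> [x t] [].
Qed.

Lemma cut_supp p : ~ (Om p.1 /\ 0 < p.2 < T) -> cut p = 0.
Proof.
move=> nO; rewrite /cut patchE; case: ifPn => //; rewrite inE => -[/= O1]; rewrite in_itv/= => O2.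
by exfalso; apply: nO.
Qed.

Lemma cutE x t : Om x -> 0 < t < T -> cut (x, t) = rho (x, t).
Proof.
move=> Ox tT; rewrite /cut patchE mem_set//; split => //=.
Qed.

Lemma cut_ae t : 0 < t < T -> Hs0 s Om (at_time rho t) ->
  {ae mu, forall x, at_time rho t x = at_time cut t x}.
Proof.
move=> tT [_ Hae]; apply: filterS Hae => x nO; rewrite /at_time.
have [Ox|nOx] := pselect (Om x); first by rewrite cutE.
by rewrite cut_supp; [exact: nO|case].
Qed.

Lemma cut_Hs0 t : 0 < t < T -> Hs0 s Om (at_time rho t) -> Hs0 s Om (at_time cut t).
Proof.
move=> tT HH; have vv := cut_ae tT HH; move: HH => [/HsP[mv vf qf] v0].
have mc : measurable_fun setT (at_time cut t) by apply: measurable_at_time; exact: measurable_cut.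
split.
  apply/HsP; split => //.
    by rewrite -(sqint_ae mv mc vv).
  by rewrite -(sqint_ae (measurable_gq s mv) (measurable_gq s mc) (gq_ae vv)).
by apply: aeW => x nO; apply: cut_supp => -[].
Qed.

Lemma good_times : {ae leb, forall t, 0 < t < T -> Hs0 s Om (at_time rho t)}.
Proof.
case: Hrho => _ [H _ _]; move: H; apply: filterS; first exact: (ae_filter_ringOfSetsType leb).
by move=> t H tT; apply: H; rewrite /= in_itv.
Qed.

Lemma Dgw_cut_lty : (Dgw s cut < +oo)%E.
Proof.
rewrite (DgwE _ measurable_cut).
have C0 : 0 < @C_Ns R N s / 2 by rewrite divr_gt0// C_Ns_gt0.
set C := C_Ns s / 2 in C0.
case: (Hrho) => _ [_ _ Hfin].
pose I : R -> \bar R := (fun t => (EFin \o Hs0_norm s) (at_time rho t) ^+ 2)%E \_ `]0, T[.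
have m2 : measurable_fun setT (fun q : R * (V * V) => (gqt s cut q.2 q.1 ^+ 2)%:E : \bar R).
  apply: measurable_sqr.
  have msw : measurable_fun setT (fun q : R * (V * V) => (q.2, q.1)).
    by apply: measurable_fun_pair; [exact: measurable_snd|exact: measurable_fst].
  exact: (measurableT_comp (measurable_gqt s measurable_cut) msw).
have ms : measurable_fun setT (fun t => sqint (@mu2 R N) (gq s (at_time cut t))).
  apply: (measurable_fun_fubini_tonelli_F (m2 := @mu2 R N) _ m2).
  by move=> q; rewrite lee_fin sqr_ge0.
have I0 t : (0 <= I t)%E by rewrite /I patchE; case: ifP => // _; exact: sqre_ge0.
have le : (\int[leb]_t (C%:E * sqint (@mu2 R N) (gq s (at_time cut t))) <= \int[leb]_t I t)%E.
  apply: ae_ge0_integral_mono => //.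
    by move=> t; rewrite mule_ge0 ?sqint_ge0// lee_fin ltW.
  move: good_times; apply: filterS; first exact: (ae_filter_ringOfSetsType leb).
  move=> t Ht; rewrite /I patchE mem_setE in_itv/=.
  have [tT|tT] := boolP (0 < t < T); last first.
    rewrite [X in (C%:E * X)%E](_ : _ = 0%E) ?mule0//.
    apply: integral0_eq => p _; rewrite /gq /at_time !cut_supp ?subrr ?mul0r ?expr0n//.
      by move=> [_ /=]; exact/negP.
    by move=> [_ /=]; exact/negP.
  have HH := Ht tT; have vv := cut_ae tT HH.
  have [/HsP[mv vf qf] _] := HH.
  have mc : measurable_fun setT (at_time cut t) by apply: measurable_at_time; exact: measurable_cut.
  rewrite -(sqint_ae (measurable_gq s mv) (measurable_gq s mc) (gq_ae vv)).
  rewrite -[sqint _ _]fineK ?ge0_fin_numE ?sqint_ge0// -EFinM.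
  rewrite [leRHS](_ : _ = (Hs0_norm s (at_time rho t) ^+ 2)%:E)//.
  by rewrite lee_fin Hs0_norm_sq.
rewrite ge0_integralZl_EFin ?(ltW C0)// in le; last by move=> t _; exact: sqint_ge0.
have fin : (\int[leb]_t I t < +oo)%E by rewrite /I -integral_mkcond.
rewrite ltey; apply/eqP => D; move: le fin; rewrite D mulry gtr0_sg// mul1e.
by rewrite leye_eq => /eqP ->.
Qed.

Lemma cut_poincare : exists2 K : R, 0 < K & forall t,
  (sqint mu (at_time cut t) <= K%:E * sqint (@mu2 R N) (gq s (at_time cut t)))%E.
Proof.
have [K K0 HK] := poincare hs hN Om_bounded.
exists K => // t; apply: HK; first by apply: measurable_at_time; exact: measurable_cut.
by apply: aeW => x nO; apply: cut_supp => -[].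
Qed.

Lemma cut_sqint_lty : (\int[leb]_t sqint mu (at_time cut t) < +oo)%E.
Proof.
have [K K0 HK] := cut_poincare.
have m2 : measurable_fun setT (fun q : R * (V * V) => (gqt s cut q.2 q.1 ^+ 2)%:E : \bar R).
  apply: measurable_sqr.
  have msw : measurable_fun setT (fun q : R * (V * V) => (q.2, q.1)).
    by apply: measurable_fun_pair; [exact: measurable_snd|exact: measurable_fst].
  exact: (measurableT_comp (measurable_gqt s measurable_cut) msw).
have ms : measurable_fun setT (fun t => sqint (@mu2 R N) (gq s (at_time cut t))).
  apply: (measurable_fun_fubini_tonelli_F (m2 := @mu2 R N) _ m2).
  by move=> q; rewrite lee_fin sqr_ge0.
apply: (@le_lt_trans _ _ (\int[leb]_t (K%:E * sqint (@mu2 R N) (gq s (at_time cut t))))%E).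
  by apply: ge0_integral_mono => t _; [exact: sqint_ge0|exact: HK].
rewrite ge0_integralZl_EFin ?(ltW K0)//; last by move=> t _; exact: sqint_ge0.
rewrite lte_mul_pinfty ?lee_fin ?(ltW K0)//.
by have := Dgw_cut_lty; rewrite (DgwE _ measurable_cut).
Qed.

Lemma cut_sqint_prod : (sqint (mu \x leb)%E cut < +oo)%E.
Proof.
rewrite /sqint fubini_tonelli2//; last 2 first.
- exact: measurable_sqr measurable_cut.
- by move=> q; rewrite lee_fin sqr_ge0.
exact: cut_sqint_lty.
Qed.

(** The Bochner approximations of rho converge in H^s_0, hence in L^2 by the
    Poincare inequality. *)
Lemma simple_approx : exists u_ : nat -> R -> V -> R,
  [/\ forall n, simple_map (u_ n), forall n t, Hs0 s Om (u_ n t) &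
   {ae leb, forall t, 0 < t < T ->
     fine (sqint mu (fun x => u_ n t x - cut (x, t))) @[n --> \oo] --> (0 : R)}].
Proof.
case: (Hrho) => _ [_ [u_ [su cu]] _].
exists u_; split.
- by move=> n; have [f1 f2 f3] := su n; split.
- by move=> n t; have [_ f2 _] := su n; apply: f2; exists t.
have [c c0 Hc] := L2_le_Hs0_norm hs hN Om_bounded.
move: cu good_times; apply: filterS2; first exact: (ae_filter_ringOfSetsType leb).
move=> t cvt Ht tT; have HH := Ht tT; have vv := cut_ae tT HH.
have {cvt}cvt : (Hs0_norm s (u_ n t - at_time rho t)) @[n --> \oo] --> (0 : R).
  have tI : (`]0, T[%classic : set R) t by rewrite /= in_itv.
  exact: (fine_cvg (cvt tI)).
have mc : measurable_fun setT (at_time cut t) by apply: measurable_at_time; exact: measurable_cut.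
have bnd n : fine (sqint mu (fun x => u_ n t x - cut (x, t))) <=
    (c * Hs0_norm s (u_ n t - at_time rho t)) ^+ 2.
  have Hu : Hs0 s Om (u_ n t) by have [_ f2 _] := su n; apply: f2; exists t.
  have Hd := Hs0B Hu HH.
  have [mu_ _] := Hs0_L2 Hu; have [md df] := Hs0_L2 Hd.
  have -> : sqint mu (fun x => u_ n t x - cut (x, t)) = sqint mu (u_ n t - at_time rho t).
    apply: sqint_ae => //; first exact: measurable_funB.
    apply: filterS vv => x e.
    by rewrite -[cut (x, t)]/(at_time cut t x) -e.
  have := Hc _ Hd => le.
  rewrite -[leLHS]sqr_sqrtr ?fine_ge0 ?sqint_ge0//.
  by rewrite lerXn2r ?nnegrE ?sqrtr_ge0// mulr_ge0 ?sqrtr_ge0// ltW.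
apply: (@squeeze_cvgr _ _ _ _ (cst 0) (fun n => (c * Hs0_norm s (u_ n t - at_time rho t)) ^+ 2)).
- by apply: nearW => n; rewrite bnd fine_ge0 ?sqint_ge0.
- exact: cvg_cst.
- have -> : (0 : R) = (c * 0) * (c * 0) by rewrite mulr0 mul0r.
  under eq_fun do rewrite expr2.
  by apply: cvgM; apply: cvgMr.
Qed.

End extraction.

(** * The truncated solution as a test function *)
Section truncated_test.
Context (R : realType) (N : nat) (s : R).
Hypothesis hs : 0 < s < 1.
Hypothesis hN : (1 <= N)%N.
Local Notation V := 'rV[R]_N.
Local Notation mu := (lebesgue_rV R N).
Local Notation leb := (@lebesgue_measure R).
Variable Om : set V.
Hypothesis Om_bounded : bounded_set Om.
Hypothesis mOm : measurable Om.
Variable T : R.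
Hypothesis T0 : 0 < T.
Variable rho : V * R -> R.
Hypothesis Hrho : L2_Hs0 s Om T rho.
Variable M : R.
Hypothesis M0 : 0 <= M.

Local Notation r := (cut Om T rho).
Let r_supp p : ~ (Om p.1 /\ 0 < p.2 < T) -> r p = 0.
Proof. exact: cut_supp. Qed.
Let mr : measurable_fun setT r.
Proof. have H := @measurable_cut R N s Om mOm T rho Hrho. exact H. Qed.

(** The weight is at least T on the cylinder and drops by exactly h over a time
    step h. *)
Definition wtest (p : V * R) : R := (2 * T - p.2) * beta M (r p).

Lemma measurable_wtest : measurable_fun setT wtest.
Proof.
apply: measurable_funM.
  by apply: measurable_funB; [exact: measurable_cst|exact: measurable_snd].
exact: (measurableT_comp (measurable_beta M) mr).
Qed.

Lemma wtest_supp p : ~ (Om p.1 /\ 0 < p.2 < T) -> wtest p = 0.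
Proof. by move=> nO; rewrite /wtest r_supp// beta0// mulr0. Qed.

Lemma wtest_bnd p : 0 <= wtest p <= 2 * T.
Proof.
have [[_ /andP[t0 tT]]|nO] := pselect (Om p.1 /\ 0 < p.2 < T); last first.
  by rewrite wtest_supp// lexx mulr_ge0// ltW.
have b0 := beta_ge0 M (r p); have b1 := beta_le1 M (r p).
apply/andP; split; first by rewrite mulr_ge0//; move: t0 tT T0; lra.
rewrite -[leRHS]mulr1; apply: ler_pM => //; move: t0 tT T0; lra.
Qed.

Lemma wtest_lipschitz x y t :
  `|wtest (x, t) - wtest (y, t)| <= 2 * T * `|r (x, t) - r (y, t)|.
Proof.
have T2 : 0 <= 2 * T by rewrite mulr_ge0// ltW.
have [/andP[t0 tT]|nT] := boolP (0 < t < T); last first.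
  have z u : wtest (u, t) = 0 by apply: wtest_supp => -[_]; exact/negP.
  by rewrite !z subrr normr0 mulr_ge0.
rewrite /wtest/= -mulrBr normrM; apply: ler_pM => //; last exact: beta_lipschitz.
by rewrite ger0_norm; move: t0 tT T0; lra.
Qed.

Lemma sqint_gqt_wtest p :
  (sqint leb (gqt s wtest p) <= ((2 * T) ^+ 2)%:E * sqint leb (gqt s r p))%E.
Proof.
rewrite -ge0_integralZl_EFin ?sqr_ge0//; last 2 first.
- by move=> t _; rewrite lee_fin sqr_ge0.
- apply: measurable_sqr.
  exact: (measurableT_comp (measurable_gqt s mr) (pair1_measurable p)).
apply: ge0_integral_mono => t _; first by rewrite lee_fin sqr_ge0.
rewrite -EFinM lee_fin -exprMn -[leLHS]real_normK ?num_real// -[leRHS]real_normK ?num_real//.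
rewrite lerXn2r ?nnegrE// /gqt /gq /at_time mulrA !normrM ler_wpM2r//.
apply: le_trans (wtest_lipschitz p.1 p.2 t) _.
by rewrite -normrM [`|2 * T|]ger0_norm// mulr_ge0// ltW.
Qed.

Lemma Dgw_wtest_lty : (Dgw s wtest < +oo)%E.
Proof.
have m2 : measurable_fun setT (fun q : (V * V) * R => (gqt s r q.1 q.2 ^+ 2)%:E : \bar R).
  by apply: measurable_sqr; exact: measurable_gqt.
apply: (@le_lt_trans _ _ (\int[@mu2 R N]_p (((2 * T) ^+ 2)%:E * sqint leb (gqt s r p)))%E).
  by apply: ge0_integral_mono => p _; [exact: sqint_ge0|exact: sqint_gqt_wtest].
rewrite ge0_integralZl_EFin ?sqr_ge0//; last 2 first.
- by move=> p _; exact: sqint_ge0.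
- apply: (measurable_fun_fubini_tonelli_F (m2 := leb) _ m2).
  by move=> q; rewrite lee_fin sqr_ge0.
have D0 := Dgw_cut_lty hs mOm Hrho.
by rewrite lte_mul_pinfty// lee_fin sqr_ge0.
Qed.

(** Weight and truncation are applied to simple approximations of time and of rho;
    the limit is controlled because beta is Lipschitz. *)
Lemma wtest_approx : exists k_ : nat -> R -> V -> R,
  [/\ forall n, simple_map (k_ n),
    forall n t, measurable_fun setT (k_ n t) /\ (sqint mu (k_ n t) < +oo)%E &
    {ae leb, forall t, fine (sqint mu (fun x => k_ n t x - wtest (x, t))) @[n --> \oo] -->
      (0 : R)}].
Proof.
have [u_ [su Hu cu]] := simple_approx hs hN Om_bounded mOm Hrho.
have [e [se ce]] := simple_map_grid T.
pose K (b : bool) (a : R) (v : V -> R) : V -> R :=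
  fun x => if b then (2 * T - a) * beta M (v x) else 0.
pose k_ n t := K (t \in `]0, T[%classic) (e n t) (u_ n t).
exists k_; split.
- move=> n.
  have mI : measurable (`]0, T[%classic : set (measurableTypeR R)) by exact: measurable_itv.
  have := simple_map_pair (simple_map_pair (simple_map_indic mI) (se n)) (su n).
  exact: (simple_map_comp (fun q => K q.1.1 q.1.2 q.2)).
- move=> n t; have [mv vf] := Hs0_L2 (Hu n t).
  rewrite /k_ /K; case: (_ \in _); last first.
    split; first exact: measurable_cst.
    by rewrite /sqint integral0_eq// => x _; rewrite expr0n.
  split.
    apply: measurable_funM => //.
    exact: (measurableT_comp (measurable_beta M) mv).
  apply: le_lt_trans (_ : (2 * (2 * T - e n t) ^+ 2)%:E * sqint mu (u_ n t) + (2 * 0 ^+ 2)%:E *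
    sqint mu (u_ n t) < +oo)%E.
    apply: sqint_lincomb => // x.
    by rewrite mul0r normr0 addr0 !normrM ler_wpM2l// beta_le_norm.
  by rewrite expr0n mulr0 mul0e adde0 lte_mul_pinfty// lee_fin mulr_ge0// sqr_ge0.
have gt := good_times Hrho.
move: cu gt; apply: filterS2; first exact: (ae_filter_ringOfSetsType leb).
move=> t cut_ gt.
have [tT|tT] := boolP (0 < t < T); last first.
  rewrite [X in X @ _ --> _](_ : _ = cst 0); first exact: cvg_cst.
  apply/funext => n; rewrite /sqint integral0_eq// => x _.
  rewrite /k_ /K mem_setE in_itv/= (negbTE tT) wtest_supp ?subrr ?expr0n//.
  by move=> [_ /=]; exact/negP.
have := cut_ tT => {}cut_.
have [mrt rf] := Hs0_L2 (cut_Hs0 mOm Hrho tT (gt tT)).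
have bnd n : fine (sqint mu (fun x => k_ n t x - wtest (x, t))) <=
    2 * (2 * T - e n t) ^+ 2 * fine (sqint mu (fun x => u_ n t x - r (x, t))) +
    2 * (e n t - t) ^+ 2 * fine (sqint mu (at_time r t)).
  have [mv vf] := Hs0_L2 (Hu n t).
  have md : measurable_fun setT (fun x => u_ n t x - r (x, t)) by exact: measurable_funB.
  have df : (sqint mu (fun x => u_ n t x - r (x, t))%R < +oo)%E.
    have := sqint_quot mu 1 mv mrt.
    under [sqint _ _]eq_integral do rewrite divr1.
    move=> /le_lt_trans; apply.
    by rewrite lte_mul_pinfty ?lee_fin ?divr_ge0 ?sqr_ge0// lte_add_pinfty.
  have := @sqint_lincomb _ _ _ mu (fun x => u_ n t x - r (x, t)) (at_time r t)
    (fun x => k_ n t x - wtest (x, t)) (2 * T - e n t) (e n t - t) md mrt.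
  move=> /(_ _)/wrap[].
    move=> x; rewrite /k_ /K mem_setE in_itv/= tT /wtest/= /at_time.
    have -> : (2 * T - e n t) * beta M (u_ n t x) - (2 * T - t) * beta M (r (x, t)) =
      (2 * T - e n t) * (beta M (u_ n t x) - beta M (r (x, t))) - (e n t - t) * beta M (r (x, t))
        by ring.
    apply: le_trans (ler_normB _ _) _; rewrite !normrM; apply: lerD.
      by rewrite ler_wpM2l// beta_lipschitz.
    by rewrite ler_wpM2l// beta_le_norm.
  move=> Hle.
  rewrite -[sqint mu (fun x => u_ n t x - r (x, t))]fineK ?ge0_fin_numE ?sqint_ge0// in Hle.
  rewrite -[sqint mu (at_time r t)]fineK ?ge0_fin_numE ?sqint_ge0// -!EFinM -EFinD in Hle.
  rewrite -lee_fin fineK//.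
  by rewrite ge0_fin_numE ?sqint_ge0// (le_lt_trans Hle)// ltry.
pose B n := 2 * (2 * T - e n t) ^+ 2 * fine (sqint mu (fun x => u_ n t x - r (x, t))) +
    2 * (e n t - t) ^+ 2 * fine (sqint mu (at_time r t)).
apply: (@squeeze_cvgr _ _ _ _ (cst 0) B).
- by apply: nearW => n; rewrite bnd fine_ge0 ?sqint_ge0.
- exact: cvg_cst.
have cet := ce t tT.
have -> : (0 : R) = 2 * ((2 * T - t) * (2 * T - t)) * 0 + 2 * ((t - t) * (t - t)) *
  fine (sqint mu (at_time r t)).
  by rewrite subrr !mulr0 mul0r addr0.
rewrite /B; under eq_fun do rewrite !expr2.
apply: cvgD; apply: cvgM => //; try exact: cvg_cst.
  by apply: cvgMr; apply: cvgM; (apply: cvgB; [exact: cvg_cst|exact: cet]).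
by apply: cvgMr; apply: cvgM; (apply: cvgB; [exact: cet|exact: cvg_cst]).
Qed.

Lemma wtest_HQ h : 0 < h -> HQ s Om T (tphi wtest h) (dtphi Om wtest h) (at_time (tphi wtest h)).
Proof.
move=> h0; have [k_ [sk kL ck]] := wtest_approx.
exact: (tphi_HQ hs hN Om_bounded mOm T0 measurable_wtest wtest_bnd wtest_supp h0
  Dgw_wtest_lty sk kL ck).
Qed.

End truncated_test.

(** * Convexity in time *)
Section energy.
Context (R : realType) (N : nat) (s : R).
Hypothesis hs : 0 < s < 1.
Hypothesis hN : (1 <= N)%N.
Local Notation V := 'rV[R]_N.
Local Notation mu := (lebesgue_rV R N).
Local Notation leb := (@lebesgue_measure R).
Local Notation P := (mu \x leb)%E.
Variable Om : set V.
Hypothesis Om_bounded : bounded_set Om.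
Hypothesis mOm : measurable Om.
Variable T : R.
Hypothesis T0 : 0 < T.
Variable rho : V * R -> R.
Hypothesis Hrho : L2_Hs0 s Om T rho.
Variable M : R.
Hypothesis M0 : 0 <= M.
Let Omfin : (mu Om < +oo)%E := bounded_measure_lty Om_bounded mOm.

Local Notation r := (cut Om T rho).
Local Notation w := (wtest Om T rho M).
Let mr : measurable_fun setT r.
Proof. have H := @measurable_cut R N s Om mOm T rho Hrho. exact H. Qed.
Let mw : measurable_fun setT w.
Proof. have H := @measurable_wtest R N s Om mOm T rho Hrho M. exact H. Qed.
Let w_bnd p : 0 <= w p <= 2 * T.
Proof. exact: wtest_bnd. Qed.
Let w_supp p : ~ (Om p.1 /\ 0 < p.2 < T) -> w p = 0.
Proof. exact: wtest_supp. Qed.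
Let r_supp p : ~ (Om p.1 /\ 0 < p.2 < T) -> r p = 0.
Proof. exact: cut_supp. Qed.

Lemma measure_cylinder_lty : (P (cylinder Om T) < +oo)%E.
Proof.
have mI : measurable (`]0, T[%classic : set (measurableTypeR R)) by exact: measurable_itv.
rewrite /cylinder product_measure1E//.
rewrite lte_mul_pinfty ?ge0_fin_numE//.
by apply: (@lebesgue_measure_itv_lty _ _ 0 T); exact: subset_itv_oo_cc.
Qed.

Lemma integrable_cut : P.-integrable setT (EFin \o r).
Proof.
have mC := measurable_cylinder mOm T.
have s1 : (sqint P (\1_(cylinder Om T) : V * R -> R) < +oo)%E.
  by rewrite (sqint_indic P mC); exact: measure_cylinder_lty.
have [i1 _] := cauchy_schwarz (m := P) mr (measurable_indic mC)
  (cut_sqint_prod hs hN Om_bounded mOm Hrho) s1.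
rewrite (_ : _ \o _ = (fun p => (r p * \1_(cylinder Om T) p)%:E))//.
apply/funext => p /=; rewrite indicE; case: (boolP (p \in _)) => pC; rewrite ?mulr1// mulr0.
rewrite r_supp// => -[p1 p2]; move: pC; rewrite notin_setE => nC; apply: nC; split => //=.
Qed.

Variable h : R.
Hypothesis h0 : 0 < h.
Hypothesis hT : h <= T.

(** This is the weighted subgradient inequality for Beta, between r (x, t) and
    r (x, t - h). For t <= h the second value is 0 instead of an earlier value of
    the solution; there Beta a <= beta a (a - M) is used, and the term with M
    appears, which absorbs the initial datum in [weak_energy]. *)
Lemma pointwise_energy x t :
  (2 * T - t) * Beta M (r (x, t)) - (2 * T - t) * Beta M (r (x, t - h)) <=
  w (x, t) * r (x, t) - w (x, t) * r (x, t - h) - M * (if t <= h then w (x, t) else 0).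
Proof.
have rz u : ~ (0 < u < T) -> r (x, u) = 0 by move=> nu; apply: r_supp => -[].
have wz u : ~ (0 < u < T) -> w (x, u) = 0 by move=> nu; apply: w_supp => -[].
have B0 a := Beta_ge0 M a.
have [t0|t0] := leP t 0.
  rewrite (rz t); last by move=> /andP[]; move: t0; lra.
  rewrite (rz (t - h)); last by move=> /andP[]; move: t0 h0; lra.
  rewrite (wz t); last by move=> /andP[]; move: t0; lra.
  by rewrite if_same !mul0r !mulr0 !subrr.
have [tT|Tt] := ltP t T; last first.
  rewrite (rz t); last by move=> /andP[]; move: Tt; lra.
  rewrite (wz t); last by move=> /andP[]; move: Tt; lra.
  rewrite if_same !mul0r mulr0 !subrr Beta0// mulr0 sub0r oppr_le0.
  have [tTh|tTh] := ltP (t - h) T; first by rewrite mulr_ge0//; move: tTh hT; lra.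
  by rewrite rz ?Beta0 ?mulr0// => /andP[]; move: tTh; lra.
have th0 : 0 <= 2 * T - t by move: tT T0; lra.
rewrite -!mulrBr {1}/wtest/=.
have [th|th] := leP t h.
  rewrite [r (x, t - h)]rz; last by move=> /andP[]; move: th; lra.
  rewrite Beta0// !subr0.
  have -> : (2 * T - t) * beta M (r (x, t)) * r (x, t) - M * w (x, t) =
    (2 * T - t) * (beta M (r (x, t)) * (r (x, t) - M)) by rewrite /wtest/=; ring.
  by rewrite ler_wpM2l// Beta_le.
rewrite mulr0 subr0 -mulrA ler_wpM2l//.
exact: Beta_convex.
Qed.

Let thetaG (p : V * R) : R := (2 * T - p.2) * Beta M (r p).

Lemma measurable_Beta : measurable_fun setT (Beta M).
Proof.
have mb := measurable_beta M.
apply: measurable_funB.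
  by apply: measurable_funM => //; apply: measurable_funB.
by apply: measurable_funM => //; exact: measurable_funX.
Qed.

Lemma integrable_Beta_cut : P.-integrable setT (fun p => (Beta M (r p))%:E).
Proof.
apply: (integrable_dominated (c := 1) integrable_cut);
  first exact: (measurableT_comp measurable_Beta mr).
by move=> p; rewrite mul1r ger0_norm ?Beta_ge0// Beta_le_norm.
Qed.

Lemma integrable_thetaG : P.-integrable setT (EFin \o thetaG).
Proof.
apply: (integrable_dominated (c := 2 * T) integrable_cut).
  apply: measurable_funM; first by apply: measurable_funB;
    [exact: measurable_cst|exact: measurable_snd].
  exact: (measurableT_comp measurable_Beta mr).
move=> p; rewrite /thetaG normrM.
have [[_ /andP[t0 tT]]|nO] := pselect (Om p.1 /\ 0 < p.2 < T); last first.
  by rewrite r_supp// Beta0// normr0 !mulr0.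
apply: ler_pM => //; last by rewrite ger0_norm ?Beta_ge0// Beta_le_norm.
by rewrite ger0_norm; move: t0 tT T0; lra.
Qed.

Lemma integrable_w_mul (k : V * R -> R) : P.-integrable setT (EFin \o k) ->
  P.-integrable setT (fun p => (w p * k p)%:E).
Proof.
move=> ik; apply: (integrable_dominated (c := 2 * T) ik).
  apply: measurable_funM; first exact mw.
  by apply/measurable_EFinP; exact: measurable_int ik.
move=> p; rewrite normrM; apply: ler_wpM2r => //.
by have /andP[a b] := w_bnd p; rewrite ger0_norm.
Qed.

(** Its integral over time is h times the value at time 0 of the Steklov average
    of w. *)
Definition wcut (p : V * R) : R := if p.2 <= h then w p else 0.

Lemma integrable_w : P.-integrable setT (EFin \o w).
Proof.
apply: (integrable_dominated (c := 2 * T) integrable_cut); first exact mw.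
move=> p; have [[_ /andP[t0 tT]]|nO] := pselect (Om p.1 /\ 0 < p.2 < T); last first.
  by rewrite w_supp// r_supp// normr0 mulr0.
rewrite /wtest normrM; apply: ler_pM => //; last exact: beta_le_norm.
by rewrite ger0_norm; move: t0 tT T0; lra.
Qed.

Lemma integrable_wcut : P.-integrable setT (EFin \o wcut).
Proof.
apply: (integrable_dominated (c := 1) integrable_w).
  apply: measurable_fun_ifT.
  - by apply: measurable_fun_ler; [exact: measurable_snd|exact: measurable_cst].
  - exact mw.
  - exact: measurable_cst.
by move=> p; rewrite mul1r /wcut; case: ifP => //; rewrite normr0.
Qed.

(** After a translation by h in time the two terms with Beta in [pointwise_energy]
    differ by the decrement h of the weight. *)
Lemma integral_energy :
  h * \int[P]_p Beta M (r p) <=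
  - (\int[P]_p ((w (p.1, p.2 + h) - w p) * r p)) - M * \int[P]_p wcut p.
Proof.
have iG := integrable_thetaG; have iB := integrable_Beta_cut.
have ir := integrable_cut; have iw := integrable_w; have iwc := integrable_wcut.
pose h' := - h.
have [irs _] := integrable_prod_shift h' ir.
have iwr := integrable_w_mul ir.
have iwrs := integrable_w_mul irs.
pose k1 (p : V * R) := w (p.1, p.2 + h) * r p.
have ik1 : P.-integrable setT (EFin \o k1).
  apply: (integrable_dominated (c := 2 * T) ir).
    apply: measurable_funM; last exact mr.
    exact: (measurableT_comp mw (measurable_sh h)).
  move=> p; rewrite /k1 normrM; apply: ler_wpM2r => //.
  by have /andP[a b] := w_bnd (p.1, p.2 + h); rewrite ger0_norm.
have [_ E1] := integrable_prod_shift h' ik1.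
pose k2 (p : V * R) := (2 * T - (p.2 + h)) * Beta M (r p).
have ik2 : P.-integrable setT (EFin \o k2).
  have E : EFin \o k2 = (EFin \o thetaG \- (fun p => h%:E * (Beta M (r p))%:E))%E.
    by apply/funext => p; rewrite /k2 /thetaG/=; congr (_%:E); ring.
  rewrite E; apply: integrableB => //; exact: integrableZl.
have [ik2s E2] := integrable_prod_shift h' ik2.
have [ik1s _] := integrable_prod_shift h' ik1.
have ineq : \int[P]_p (thetaG p - k2 (p.1, p.2 + h')) <=
    \int[P]_p (w p * r p - k1 (p.1, p.2 + h') - M * wcut p).
  apply: le_Rintegral => //.
  - rewrite (_ : _ \o _ = ((EFin \o thetaG) \- (fun p => (k2 (p.1, p.2 + h')%R)%:E))%E)//.
    exact: integrableB.
  - rewrite (_ : _ \o _ = (((fun p => (w p * r p)%:E) \- (fun p => (k1 (p.1, p.2 + h')%R)%:E)) \-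
      (fun p => M%:E * (wcut p)%:E))%E)//.
    apply: integrableB => //; first exact: integrableB.
    exact: integrableZl.
  - move=> [x t] _; rewrite /k2 /k1 /h' /wcut /thetaG/= !subrK.
    exact: pointwise_energy.
have I1 : \int[P]_p (thetaG p - k2 (p.1, p.2 + h')) = h * \int[P]_p Beta M (r p).
  rewrite RintegralB//; rewrite E2 -RintegralB// -RintegralZl//.
  by apply: eq_Rintegral => p _; rewrite /thetaG /k2; ring.
have I2 : \int[P]_p (w p * r p - k1 (p.1, p.2 + h') - M * wcut p) =
  - (\int[P]_p ((w (p.1, p.2 + h) - w p) * r p)) - M * \int[P]_p wcut p.
  rewrite RintegralB//; last 2 first.
    rewrite (_ : _ \o _ = ((fun p => (w p * r p)%:E) \- (fun p => (k1 (p.1, p.2 + h')%R)%:E))%E)//.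
    exact: integrableB.
    exact: (integrableZl measurableT M iwc).
  rewrite RintegralB// E1 RintegralZl//; congr (_ - _).
  rewrite -opprB; congr (- _); rewrite -RintegralB//.
  by apply: eq_Rintegral => p _; rewrite /k1; ring.
by rewrite -I1 -I2.
Qed.

End energy.

(** * The energy inequality *)
Section weak_energy.
Context (R : realType) (N : nat) (s : R).
Hypothesis hs : 0 < s < 1.
Hypothesis hN : (1 <= N)%N.
Local Notation V := 'rV[R]_N.
Local Notation mu := (lebesgue_rV R N).
Local Notation leb := (@lebesgue_measure R).
Local Notation P := (mu \x leb)%E.
Local Notation P2 := (@mu2 R N \x leb)%E.
Variable Om : set V.
Hypothesis Om_bounded : bounded_set Om.
Hypothesis mOm : measurable Om.
Variable T : R.
Hypothesis T0 : 0 < T.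
Variable rho : V * R -> R.
Hypothesis Hrho : L2_Hs0 s Om T rho.
Variable M : R.
Hypothesis M0 : 0 <= M.
Variable f : V * R -> R.
Hypothesis f_le0 : {ae P, forall p, cylinder Om T p -> f p <= 0}.
Variable rho0 : V -> R.
Hypothesis rho0_le : {ae mu, forall x, Om x -> rho0 x <= M}.

Local Notation r := (cut Om T rho).
Local Notation w := (wtest Om T rho M).
Let mr : measurable_fun setT r.
Proof. have H := @measurable_cut R N s Om mOm T rho Hrho. exact H. Qed.
Let mw : measurable_fun setT w.
Proof. have H := @measurable_wtest R N s Om mOm T rho Hrho M. exact H. Qed.
Let w_bnd p : 0 <= w p <= 2 * T.
Proof. exact: wtest_bnd. Qed.
Let w_supp p : ~ (Om p.1 /\ 0 < p.2 < T) -> w p = 0.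
Proof. exact: wtest_supp. Qed.
Let r_supp p : ~ (Om p.1 /\ 0 < p.2 < T) -> r p = 0.
Proof. exact: cut_supp. Qed.

Variable h : R.
Hypothesis h0 : 0 < h.
Hypothesis hT : h <= T.
Local Notation phi := (tphi w h).

Lemma dtphi_term : \int[leb]_(t in `]0, T[) dtphi Om w h t (at_time rho t) =
  h^-1 * \int[P]_p ((w (p.1, p.2 + h) - w p) * r p).
Proof.
pose F (p : V * R) := (w (p.1, p.2 + h) - w p) * r p.
have ir := integrable_cut hs hN Om_bounded mOm Hrho.
have iF : P.-integrable setT (EFin \o F).
  apply: (integrable_dominated (c := 2 * T) ir).
    apply: measurable_funM; last exact mr.
    apply: measurable_funB; last exact mw.
    exact: (measurableT_comp mw (measurable_sh h)).
  move=> p; rewrite /F normrM; apply: ler_wpM2r => //.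
  have /andP[a b] := w_bnd (p.1, p.2 + h); have /andP[a' b'] := w_bnd p.
  by rewrite ler_norml; apply/andP; split; lra.
rewrite -RintegralZl//.
have iF' : P.-integrable setT (EFin \o (fun p => h^-1 * F p))
  by exact: (integrableZl measurableT h^-1 iF).
have [i2 <-] := Rintegral_prod2 iF'.
rewrite [LHS]Rintegral_mkcond.
apply: eq_Rintegral => t _; rewrite patchE mem_setE in_itv/=.
have [tT|tT] := boolP (0 < t < T); last first.
  rewrite (@eq_Rintegral _ _ _ mu _ (fun=> 0)) ?/Rintegral ?integral0//.
  by move=> x _; rewrite /F r_supp ?mulr0// => -[_ /=]; exact/negP.
have dO x : ~ Om x -> dq h w t x = 0.
  by move=> nO; rewrite /dq !w_supp ?subrr ?mul0r// => -[].
transitivity (inner_L2 Om (dq h w t) (at_time r t)).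
  rewrite /dtphi /inner_L2; apply: eq_Rintegral => x; rewrite inE => Ox.
  by rewrite /at_time cutE.
rewrite (inner_L2_setT _ dO).
by apply: eq_Rintegral => x _; rewrite /dq /F /at_time/=; ring.
Qed.

Lemma forcing_term : \int[P]_(p in cylinder Om T) (f p * phi p) <= 0.
Proof.
rewrite Rintegral_mkcond.
have i0 : P.-integrable setT (EFin \o (cst 0 : V * R -> R)) by exact: integrable0.
have <- : \int[P]_p (cst 0 p : R) = 0 by rewrite /Rintegral integral0.
apply: (Rintegral_ae_le (g := cst 0)) => //.
move: f_le0; apply: filterS; first exact: (ae_filter_ringOfSetsType P).
move=> p fp; rewrite patchE; case: ifPn => // /set_mem pC.
by rewrite mulr_le0_ge0 ?fp//; exact: (tphi_ge0 mw w_bnd w_supp h0).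
Qed.

(** The test function at time 0 is a mean of w, and rho0 <= M. *)
Lemma initial_term : \int[mu]_(x in Om) (rho0 x * at_time phi 0 x) <=
  h^-1 * (M * \int[P]_p wcut Om T rho M h p).
Proof.
have iwc := integrable_wcut hs hN Om_bounded mOm T0 Hrho M0 h.
have phi0E x : at_time phi 0 x = h^-1 * \int[leb]_t wcut Om T rho M h (x, t).
  rewrite /at_time /tphi /avg/= add0r (prim_bdsupp_le0 (t := 0) (w_bdsupp mw w_bnd w_supp x))//
    subr0 mulrC.
  congr (_ * _); rewrite /prim Rintegral_mkcond; apply: eq_Rintegral => t _.
  by rewrite patchE mem_setE in_itv.
have [i1 E1] := Rintegral_prod1 iwc.
rewrite -E1 mulrCA -RintegralZl// -RintegralZl//; last exact: (integrableZl measurableT h^-1 i1).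
rewrite [leLHS]Rintegral_mkcond.
apply: Rintegral_ae_le.
- move=> x; rewrite -phi0E mulr_ge0//; exact: (tphi_ge0 mw w_bnd w_supp h0).
- exact: (integrableZl measurableT M (integrableZl measurableT h^-1 i1)).
apply: filterS rho0_le => x rx; rewrite patchE -phi0E.
have p0 : 0 <= at_time phi 0 x by exact: (tphi_ge0 mw w_bnd w_supp h0).
by case: ifPn => [/set_mem Ox|_]; [rewrite ler_wpM2r// rx|rewrite mulr_ge0].
Qed.

Lemma sqint_gqt_cut : sqint P2 (fun q => gqt s r q.1 q.2) = Dgw s r.
Proof. by rewrite (sqint_prod1 (@mu2 R N) (measurable_gqt s mr)). Qed.

Lemma measurable_gqt_phi : measurable_fun setT (fun q : (V * V) * R => gqt s phi q.1 q.2).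
Proof. by apply: measurable_gqt; exact: (measurable_tphi mw w_bnd). Qed.

Lemma sqint_gqt_phi : (sqint P2 (fun q => gqt s phi q.1 q.2) <= Dgw s w)%E.
Proof.
rewrite (sqint_prod1 (@mu2 R N) measurable_gqt_phi).
apply: ge0_integral_mono => p _; first exact: sqint_ge0.
have := avg_sqint (gqt_bdsupp s mw w_bnd w_supp p) h0; apply: le_trans.
rewrite le_eqVlt; apply/orP; left; apply/eqP; apply: eq_integral => t _.
by rewrite /gqt/= (gq_tphi s mw w_bnd w_supp).
Qed.

Lemma integrable_form : P2.-integrable setT
  (fun q => (gqt s r q.1 q.2 * gqt s phi q.1 q.2)%:E).
Proof.
have Dr := Dgw_cut_lty hs mOm Hrho.
have Dw := Dgw_wtest_lty hs mOm T0 Hrho M0.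
have [] := cauchy_schwarz (m := P2) (measurable_gqt s mr) measurable_gqt_phi.
- exact (eq_ind_r (fun e => (e < +oo)%E) Dr sqint_gqt_cut).
- exact: le_lt_trans sqint_gqt_phi Dw.
by [].
Qed.

Lemma form_term : \int[leb]_(t in `]0, T[) Fform s (at_time rho t) (at_time phi t) =
  C_Ns (N := N) s / 2 * \int[P2]_q (gqt s r q.1 q.2 * gqt s phi q.1 q.2).
Proof.
have [i2 <-] := Rintegral_prod2 integrable_form.
rewrite -(RintegralZl _ measurableT i2) [LHS]Rintegral_mkcond /Rintegral; congr fine.
apply: ae_eq_integralT.
have := good_times Hrho; apply: filterS; first exact: (ae_filter_ringOfSetsType leb).
move=> t Ht; congr (_%:E); rewrite patchE mem_setE in_itv/=.
have [tT|tT] := boolP (0 < t < T); last first.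
  rewrite (_ : (\int[_]_x _)%E = 0%E) ?mulr0//.
  apply: integral0_eq => p _; rewrite /gqt /gq /at_time !(r_supp (p := (_, t))) ?subrr ?mul0r//.
    by move=> [_ /=]; exact/negP.
  by move=> [_ /=]; exact/negP.
have HH := Ht tT; have vv := cut_ae tT HH; have [mv _] := Hs0_L2 HH.
have mc : measurable_fun setT (at_time r t) by exact: measurable_at_time mr.
have mp : measurable_fun setT (at_time phi t).
  by apply: measurable_at_time; exact: (measurable_tphi mw w_bnd).
by rewrite (Fform_ae hs mv mc mp vv) Fform_gq.
Qed.

Hypothesis Hweak : forall phi dphi c, HQ s Om T phi dphi c ->
  - (\int[leb]_(t in `]0, T[) dphi t (at_time rho t))
  + (\int[leb]_(t in `]0, T[) Fform s (at_time rho t) (at_time phi t))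
  = (\int[P]_(p in cylinder Om T) (f p * phi p))
    + (\int[mu]_(x in Om) (rho0 x * c 0 x)).

(** The weak formulation with the test function [tphi]: the term with M in
    [integral_energy] cancels against the bound of [initial_term]. *)
Lemma weak_energy :
  C_Ns (N := N) s / 2 * \int[P2]_q (gqt s r q.1 q.2 * gqt s phi q.1 q.2) +
  \int[P]_p Beta M (r p) <= 0.
Proof.
have := Hweak (wtest_HQ hs hN Om_bounded mOm T0 Hrho M0 h0).
rewrite dtphi_term form_term.
have := forcing_term; have := initial_term.
have := integral_energy hs hN Om_bounded mOm T0 Hrho M0 h0 hT.
set A := \int[P]_p ((w _ - w _) * _); set W := \int[P]_p wcut _ _ _ _ _ p.
set G := \int[P]_p Beta M _; set H := _ / 2 * _.
set I := \int[mu]_(x in Om) _; set J := \int[P]_(p in _) _.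
move=> e1 e2 e3 e4.
have e5 : G <= h^-1 * (- A - M * W) by rewrite ler_pdivlMl.
by move: e5; rewrite mulrBr mulrN; lra.
Qed.

End weak_energy.

(** * The limit of vanishing averaging step *)
Section maximum_principle.
Context (R : realType) (N : nat) (s : R).
Hypothesis hs : 0 < s < 1.
Hypothesis hN : (1 <= N)%N.
Local Notation V := 'rV[R]_N.
Local Notation mu := (lebesgue_rV R N).
Local Notation leb := (@lebesgue_measure R).
Local Notation P := (mu \x leb)%E.
Local Notation P2 := (@mu2 R N \x leb)%E.
Variable Om : set V.
Hypothesis Om_bounded : bounded_set Om.
Hypothesis mOm : measurable Om.
Variable T : R.
Hypothesis T0 : 0 < T.
Variable rho : V * R -> R.
Hypothesis Hrho : L2_Hs0 s Om T rho.
Variable M : R.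
Hypothesis M0 : 0 <= M.
Variable f : V * R -> R.
Hypothesis f_le0 : {ae P, forall p, cylinder Om T p -> f p <= 0}.
Variable rho0 : V -> R.
Hypothesis rho0_le : {ae mu, forall x, Om x -> rho0 x <= M}.
Hypothesis Hweak : forall phi dphi c, HQ s Om T phi dphi c ->
  - (\int[leb]_(t in `]0, T[) dphi t (at_time rho t))
  + (\int[leb]_(t in `]0, T[) Fform s (at_time rho t) (at_time phi t))
  = (\int[P]_(p in cylinder Om T) (f p * phi p))
    + (\int[mu]_(x in Om) (rho0 x * c 0 x)).

Local Notation r := (cut Om T rho).
Local Notation w := (wtest Om T rho M).
Let mr : measurable_fun setT r.
Proof. have H := @measurable_cut R N s Om mOm T rho Hrho. exact H. Qed.
Let mw : measurable_fun setT w.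
Proof. have H := @measurable_wtest R N s Om mOm T rho Hrho M. exact H. Qed.
Let w_bnd p : 0 <= w p <= 2 * T.
Proof. exact: wtest_bnd. Qed.
Let w_supp p : ~ (Om p.1 /\ 0 < p.2 < T) -> w p = 0.
Proof. exact: wtest_supp. Qed.
Let r_supp p : ~ (Om p.1 /\ 0 < p.2 < T) -> r p = 0.
Proof. exact: cut_supp. Qed.
Let Dr : (Dgw s r < +oo)%E := Dgw_cut_lty hs mOm Hrho.
Let Dw : (Dgw s w < +oo)%E := Dgw_wtest_lty hs mOm T0 Hrho M0.
Let C0 : 0 < @C_Ns R N s / 2.
Proof. by rewrite divr_gt0// C_Ns_gt0. Qed.

(** The truncation is nondecreasing and the weight does not depend on space. *)
Lemma gqt_cut_wtest_ge0 p t : 0 <= gqt s r p t * gqt s w p t.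
Proof.
rewrite /gqt gqM//; apply: mulr_ge0; last by rewrite invr_ge0 powR_ge0.
rewrite /at_time; have [/andP[t0 tT]|nT] := boolP (0 < t < T); last first.
  rewrite !(r_supp (p := (_, t))) ?subrr ?mul0r//.
    by move=> [_ /=]; exact/negP.
  by move=> [_ /=]; exact/negP.
rewrite /wtest/= -mulrBr mulrCA mulr_ge0 ?beta_mono//.
by move: tT t0 T0; lra.
Qed.

(** Instead of passing to a weak limit in the form term, one bounds the integral of
    (gqt r + gqt phi_n)^2, from above by [weak_energy] and from below, in the limit,
    by Fatou's lemma and [gqt_cut_wtest_ge0]. Both bounds contain the energies E of r
    and D of w, which cancel. *)
Lemma Beta_integral_le0 : \int[P]_p Beta M (r p) <= 0.
Proof.
(* The steps 1 / (n + n0 + 1) are at most T from n = 0 on. *)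
pose n0 := Num.truncn T^-1.
pose h_ n : R := (n + n0).+1%:R^-1.
have h0 n : 0 < h_ n by rewrite invr_gt0.
have hT n : h_ n <= T.
  rewrite /h_ -[leRHS]invrK lef_pV2 ?posrE ?invr_gt0//.
  apply: (@le_trans _ _ n0.+1%:R); first by apply: ltW; exact: truncnS_gt.
  by rewrite ler_nat ltnS leq_addl.
pose g0 := \int[P]_p Beta M (r p).
pose E := fine (Dgw s r); pose D := fine (Dgw s w).
have D0r : (0 <= Dgw s r)%E by apply: integral_ge0 => p _; exact: sqint_ge0.
have D0w : (0 <= Dgw s w)%E by apply: integral_ge0 => p _; exact: sqint_ge0.
have EE : Dgw s r = E%:E := ge0_lty_fineE D0r Dr.
have DE : Dgw s w = D%:E := ge0_lty_fineE D0w Dw.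
pose a (q : (V * V) * R) := gqt s r q.1 q.2.
pose b n (q : (V * V) * R) := gqt s (tphi w (h_ n)) q.1 q.2.
have ma : measurable_fun setT a by exact: measurable_gqt mr.
have mb n : measurable_fun setT (b n) by exact:
  (measurable_gqt s (measurable_tphi mw w_bnd (h_ n))).
have mab n : measurable_fun setT (fun q => a q + b n q) by exact: measurable_funD.
have sa : sqint P2 a = Dgw s r by exact: (sqint_prod1 (@mu2 R N) ma).
have sb n : (sqint P2 (b n) <= Dgw s w)%E.
  exact (sqint_gqt_phi mOm T0 Hrho M0 (h0 n)).
(* The square is expanded and the energy inequality bounds the cross term. *)
have upper n : (sqint P2 (fun q => a q + b n q)%R <=
  (E + D - (C_Ns (N := N) s / 2)^-1 * (2 * g0))%:E)%E.
  have fb : (sqint P2 (b n) < +oo)%E by exact: le_lt_trans (sb n) Dw.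
  have fa : (sqint P2 a < +oo)%E := eq_ind_r (fun e => (e < +oo)%E) Dr sa.
  pose I := \int[P2]_q (a q * b n q).
  have H : C_Ns (N := N) s / 2 * I + g0 <= 0.
    exact (weak_energy hs hN Om_bounded mOm T0 Hrho M0 f_le0 rho0_le (h0 n) (hT n) Hweak).
  have bD : fine (sqint P2 (b n)) <= D.
    rewrite -lee_fin -DE -(ge0_lty_fineE (sqint_ge0 P2 (b n)) fb); exact (sb n).
  have IE : I <= - ((C_Ns (N := N) s / 2)^-1 * g0).
    by rewrite -mulrN ler_pdivlMl//; move: H; lra.
  have -> := @sqint_expand _ _ R P2 a (b n) ma (mb n) fa fb.
  rewrite lee_fin -/I sa -/E; move: bD IE.
  by rewrite (mulrCA _ 2 g0); lra.
pose X n p := sqint leb (fun t => a (p, t) + b n (p, t)).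
have XE n : (\int[@mu2 R N]_p X n p)%E = sqint P2 (fun q => a q + b n q).
  exact (esym (sqint_prod1 (@mu2 R N) (mab n))).
(* Fatou's lemma in time, for a fixed pair of points. *)
have lower p : (sqint leb (gqt s r p) + sqint leb (gqt s w p) <= limn_einf (X ^~ p))%E.
  have bw := gqt_bdsupp s mw w_bnd w_supp p.
  have mar : measurable_fun setT (gqt s r p) by exact: (measurableT_comp ma (pair1_measurable p)).
  have mbn n : measurable_fun setT (fun t => b n (p, t))
    by exact: (measurableT_comp (mb n) (pair1_measurable p)).
  have mX n : measurable_fun setT (fun t => ((a (p, t) + b n (p, t)) ^+ 2)%:E : \bar R).
    exact: (measurable_sqr (measurable_funD mar (mbn n))).
  have X0 n t : setT t -> (0 <= ((a (p, t) + b n (p, t)) ^+ 2)%:E :> \bar R)%E.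
    by move=> _; rewrite lee_fin sqr_ge0.
  have := fatou leb measurableT mX X0; apply: le_trans.
  have -> : (\int[leb]_t limn_einf (fun n => ((a (p, t) + b n (p, t)) ^+ 2)%:E) =
     \int[leb]_t ((gqt s r p t + gqt s w p t) ^+ 2)%:E)%E.
    apply: ae_eq_integralT.
    have := avg_cvg bw; apply: filterS; first exact: (ae_filter_ringOfSetsType leb).
    move=> t ct.
    have cb : b n (p, t) @[n --> \oo] --> gqt s w p t.
      rewrite (_ : (fun n => b n (p, t)) = (fun n => avg (n + n0).+1%:R^-1 (gqt s w p) t)).
        by rewrite (cvg_shiftn n0 (fun n => avg n.+1%:R^-1 (gqt s w p) t)).
      by apply/funext => n; rewrite /b/= /gqt (gq_tphi s mw w_bnd w_supp).
    have cu : ((a (p, t) + b n (p, t)) ^+ 2)%:E @[n --> \oo] -->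
      ((gqt s r p t + gqt s w p t) ^+ 2)%:E.
      apply: cvg_EFin; first exact: nearW.
      have cs : a (p, t) + b n (p, t) @[n --> \oo] --> gqt s r p t + gqt s w p t.
        by apply: cvgD => //; exact: cvg_cst.
      exact: (cvgM cs cs).
    rewrite is_cvg_limn_einfE; first exact: cvg_lim cu.
    by apply/cvg_ex; eexists; exact: cu.
  rewrite -ge0_integralD//; last 4 first.
  - by move=> t _; rewrite lee_fin sqr_ge0.
  - exact: measurable_sqr.
  - by move=> t _; rewrite lee_fin sqr_ge0.
  - by apply: measurable_sqr; case: bw.
  apply: ge0_integral_mono => t _; first by rewrite adde_ge0// lee_fin sqr_ge0.
  rewrite -EFinD lee_fin; have := gqt_cut_wtest_ge0 p t.
  by rewrite !expr2; set A := gqt _ _ _ _; set B := gqt _ _ _ _ => H; nra.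
have mX n : measurable_fun setT (X n).
  apply: (measurable_fun_fubini_tonelli_F (m2 := leb) (fun q => ((a q + b n q) ^+ 2)%:E)).
    exact (measurable_sqr (mab n)).
  by move=> q; rewrite lee_fin sqr_ge0.
have X0 n p : setT p -> (0 <= X n p)%E by move=> _; exact: sqint_ge0.
have F2 := fatou (@mu2 R N) measurableT mX X0.
have U : (limn_einf (fun n => \int[@mu2 R N]_p X n p) <=
  (E + D - (C_Ns (N := N) s / 2)^-1 * (2 * g0))%:E)%E.
  by apply: limn_einf_le_cst => n; rewrite XE.
have L : ((E + D)%:E <= \int[@mu2 R N]_p limn_einf (X ^~ p))%E.
  have -> : (E + D)%:E = (Dgw s r + Dgw s w)%E.
    exact (esym (f_equal2 (fun e e' => e + e')%E EE DE)).
  rewrite /Dgw -(ge0_integralD _ measurableT); last 4 first.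
  - by move=> p _; exact: sqint_ge0.
  - apply: (measurable_fun_fubini_tonelli_F (m2 := leb) (fun q => (a q ^+ 2)%:E)).
      exact (measurable_sqr ma).
    by move=> q; rewrite lee_fin sqr_ge0.
  - by move=> p _; exact: sqint_ge0.
  - apply: (measurable_fun_fubini_tonelli_F (m2 := leb) (fun q => (gqt s w q.1 q.2 ^+ 2)%:E)).
      exact (measurable_sqr (measurable_gqt s mw)).
    by move=> q; rewrite lee_fin sqr_ge0.
  by apply: ge0_integral_mono => p _; [rewrite adde_ge0 ?sqint_ge0|exact: lower].
have := le_trans L (le_trans F2 U).
rewrite lee_fin -/g0 => H.
have : (C_Ns (N := N) s / 2)^-1 * (2 * g0) <= 0 by lra.
by rewrite pmulr_rle0 ?invr_gt0// pmulr_rle0.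
Qed.

Lemma cut_le : {ae P, forall p, r p <= M}.
Proof.
have iB := integrable_Beta_cut hs hN Om_bounded mOm Hrho M0.
have I0 : (\int[P]_p `|(Beta M (r p))%:E| = 0)%E.
  have -> : (\int[P]_p `|(Beta M (r p))%:E| = \int[P]_p (Beta M (r p))%:E)%E.
    by apply: eq_integral => p _; rewrite gee0_abs// lee_fin Beta_ge0.
  have fin : (\int[P]_p (Beta M (r p))%:E)%E \is a fin_num by exact: integrable_fin_num.
  have ge : (0 <= \int[P]_p (Beta M (r p))%:E)%E by apply: integral_ge0 => p _;
    rewrite lee_fin Beta_ge0.
  apply/eqP; rewrite eq_le ge andbT -[X in (X <= _)%E]fineK// lee_fin.
  exact: Beta_integral_le0.
have /(ae_eq_integral_abs P measurableT (measurable_int _ iB)) := I0.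
apply: filterS.
by move=> p /(_ I)[]; exact: Beta_eq0.
Qed.

(** The values of rho off Om vanish for almost every x at almost every time; Fubini
    turns this into almost every (x, t). *)
Lemma cut_ae_eq : {ae P, forall p, 0 < p.2 < T -> rho p = r p}.
Proof.
pose rT : V * R -> R := rho \_ ([set: V] `*` `]0, T[%classic).
have mS : measurable ([set: V] `*` (`]0, T[%classic : set (measurableTypeR R))).
  by apply: measurableX => //; exact: measurable_itv.
have mrT : measurable_fun setT rT.
  by apply: (iffLR (measurable_restrictT _ mS)); case: Hrho.
have mg : measurable_fun setT (fun p => rT p - r p) by exact: measurable_funB.
have S0 : (\int[P]_p `|((rT p - r p) ^+ 2)%:E| = 0)%E.
  transitivity (\int[P]_p ((rT p - r p) ^+ 2)%:E)%E.
    by apply: eq_integral => p _; rewrite gee0_abs// lee_fin sqr_ge0.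
  rewrite (fubini_tonelli2 (m1 := mu) (m2 := leb)); last 2 first.
    exact: measurable_sqr.
    by move=> p; rewrite lee_fin sqr_ge0.
  rewrite -(integral0 leb setT); apply: ae_eq_integralT.
  have := good_times Hrho; apply: filterS; first exact: (ae_filter_ringOfSetsType leb).
  move=> t Ht; rewrite -(integral0 mu setT); apply: ae_eq_integralT.
  have rTE x : rT (x, t) = if 0 < t < T then rho (x, t) else 0.
    rewrite /rT patchE; congr (if _ then _ else _).
    by apply/idP/idP; rewrite inE/= in_itv/= => // -[].
  have [tT|tT] := boolP (0 < t < T); last first.
    apply: aeW => x; rewrite rTE (negbTE tT) r_supp ?subrr ?expr0n//.
    by move=> [_ /=]; exact/negP.
  have := cut_ae tT (Ht tT); apply: filterS => x e.
  by rewrite rTE tT -[rho (x, t)]/(at_time rho t x) e subrr expr0n.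
have mg2 := measurable_sqr mg.
have /(ae_eq_integral_abs P measurableT mg2) := S0.
apply: filterS.
move=> [x t] /(_ I)[] /eqP; rewrite sqrf_eq0 subr_eq0 => /eqP e tT.
by rewrite -e /rT patchE mem_set//; split => //=; rewrite in_itv.
Qed.

Lemma time_slice_negligible (t0 : R) : P.-negligible [set p : V * R | p.2 = t0].
Proof.
exists (setT `*` [set t0]); split.
- by apply: measurableX => //; exact: measurable_set1.
- have H : leb [set t0] = 0%E := lebesgue_measure_set1 t0.
  rewrite product_measure1E//.
  exact: (eq_ind_r (fun e => (mu setT * e = 0)%E) (mule0 _) H).
- by move=> p /= ->.
Qed.

Lemma weak_solution_le : {ae P, forall p, 0 <= p.2 <= T -> rho p <= M}.
Proof.
have n1 := time_slice_negligible 0; have n2 := time_slice_negligible T.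
have nn : {ae P, forall p : V * R, p.2 != 0 /\ p.2 != T}.
  rewrite /almost_everywhere /=; apply: negligibleS (negligibleU n1 n2) => p /=.
  have [->|p0] := eqVneq p.2 0; first by left.
  have [->|pT] := eqVneq p.2 T; first by right.
  by case.
have c1 := cut_le; have c2 := cut_ae_eq.
have F := ae_filter_ringOfSetsType P.
move: nn c1 c2; apply: filterS3.
move=> p [p0 pT] rM e /andP[pge ple].
by rewrite e// !lt_neqAle eq_sym p0 pge pT ple.
Qed.

End maximum_principle.

(** * Essential suprema and the bound *)
Lemma Linfty_norm_fin d (X : measurableType d) (R : realType)
    (m : {measure set X -> \bar R}) (A : set X) (u : X -> R) :
  in_Linfty m A u -> Linfty_norm m A u \is a fin_num.
Proof.
rewrite /in_Linfty/= => /andP[_]; rewrite inE/= /finite_norm => uoo.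
by rewrite ge0_fin_numE// Lnorm_ge0.
Qed.

(** The L^oo norm is an essential supremum only if the measure is non-zero; if it is
    zero, everything is negligible. *)
Lemma ae_le_Linfty_norm d (X : measurableType d) (R : realType)
    (m : {measure set X -> \bar R}) (A : set X) (u : X -> R) :
  in_Linfty m A u ->
  {ae m, forall x, A x -> u x <= fine (Linfty_norm m A u)}.
Proof.
move=> uoo; have Nfin := Linfty_norm_fin uoo.
have [m0|] := ltP 0%E (m setT); last first.
  move=> mT; exists setT; split => //.
  by apply/eqP; rewrite eq_le mT measure_ge0.
have : {ae m, forall x, (`|(u \_ A) x|%:E <= Linfty_norm m A u)%E}.
  rewrite /Linfty_norm unlock m0; exact: ess_sup_ge.
apply: filterS => x H Ax; move: H; rewrite patchE mem_set// -(fineK Nfin) lee_fin.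
exact: le_trans (ler_norm _).
Qed.

Theorem theorem4p3 (R : realType) (N : nat) (hN : (1 <= N)%N)
  (Om : set 'rV[R]_N)
  (Om_bounded : bounded_set Om) (Om_open : open Om) (Om_connected : connected Om)
  (Om_nonempty : Om !=set0) (Om_lipschitz : lipschitz_boundary Om)
  (s : R) (hs : 0 < s < 1) (T : R) (hT : 0 < T)
  (f : 'rV[R]_N * R -> R)
  (f_Linfty : in_Linfty (lebesgue_rV R N \x @lebesgue_measure R)%E
                (cylinder Om T) f)
  (f_le0 : {ae (lebesgue_rV R N \x @lebesgue_measure R)%E,
              forall p, cylinder Om T p -> f p <= 0})
  (rho0 : 'rV[R]_N -> R)
  (rho0_Linfty : in_Linfty (lebesgue_rV R N) Om rho0)
  (rho : 'rV[R]_N * R -> R)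
  (rho_sol : weak_solution s Om T f rho0 rho) :
  {ae (lebesgue_rV R N \x @lebesgue_measure R)%E,
     forall p : 'rV[R]_N * R, 0 <= p.2 <= T ->
     ((rho p)%:E <=
        Linfty_norm (lebesgue_rV R N \x @lebesgue_measure R) (cylinder Om T) f
        + Linfty_norm (lebesgue_rV R N) Om rho0)%E}.
Proof.
have [[drho [Hrho _ _]] Hweak] := rho_sol.
have M0 : 0 <= fine (Linfty_norm (lebesgue_rV R N) Om rho0).
  by rewrite fine_ge0// Lnorm_ge0.
have := weak_solution_le hs hN Om_bounded (open_measurable_rV Om_open) hT Hrho M0
  f_le0 (ae_le_Linfty_norm rho0_Linfty) Hweak.
apply: filterS.
  exact: (ae_filter_ringOfSetsType (lebesgue_rV R N \x @lebesgue_measure R)%E).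
move=> p rhoM pT; have {pT}rhoM := rhoM pT.
apply: (@le_trans _ _ (Linfty_norm (lebesgue_rV R N) Om rho0)).
  by rewrite -(fineK (Linfty_norm_fin rho0_Linfty)) lee_fin.
by rewrite leeDr// Lnorm_ge0.
Qed.
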